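(* With probability $1$, we have $$ h_{\mathcal C}(n!)=\frac{\sqrt{2\pi}\,n^{1/2}}{(\log n)^{1/2}}\left(1-\frac{\log\log n}{2\log n}+\frac{1+\gamma+\log 8}{2\log n}+O\left(\frac{|\log\log n|}{(\log n)^{3/2}}\right)\right) $$ for all integers $n\geq 2$. (That is, almost surely there is a finite constant $K$, which may depend on the realization of $\mathcal C$, such that for all $n\ge2$ the formula holds with the $O$-term at most $K|\log\log n|/(\log n)^{3/2}$ in absolute value.)
   Context: $\gamma=0.577\ldots$ is the Euler constant. Cramér model: $\mathcal C$ is the random subset of the integers $l\ge 3$ such that $\mathbb P(l\in\mathcal C)=\frac{1}{\log l}$ for each $l\ge3$, the events $\{l\in\mathcal C\}$, $l\ge3$, being mutually independent. For integers $n\ge 2$ and $k\ge1$ let $I_k=\left(\frac{n}{k+1},\frac{n}{k}\right]$, and let $A_k$ be the indicator function of the event $I_k\cap\mathcal C\neq\varnothing$. Define the random variable $$h_{\mathcal C}(n!)=\sum_{k\ge1}A_k .$$ (The notation $h_{\mathcal C}(n!)$ is just a name for this random variable, all $n\ge 2$ being defined from the same random set $\mathcal C$.) *)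

(* Defs.v *)
From HB Require Import structures.
From mathcomp Require Import all_boot all_order all_algebra.
From mathcomp Require Import finmap.
From mathcomp Require Import all_classical all_reals all_analysis.

Set Implicit Arguments.
Unset Strict Implicit.
Unset Printing Implicit Defensive.

Import Order.TTheory GRing.Theory Num.Theory.
Import numFieldNormedType.Exports.

Local Open Scope classical_set_scope.
Local Open Scope ring_scope.

Definition euler_gamma (R : realType) : R :=
  limn (fun n : nat => series (@harmonic R) n - ln n%:R).

Definition mutually_independent (R : realType) (d : measure_display)
    (T : measurableType d) (P : probability T R) (I : choiceType)
    (D : set I) (E : I -> set T) : Prop :=
  (forall i, D i -> measurable (E i)) /\
  (forall J : {fset I}, [set` J] `<=` D ->
     P (\bigcap_(i in [set` J]) E i) = (\prod_(i <- J) P (E i))%E).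

Record cramer_model (R : realType) (d : measure_display)
    (T : measurableType d) (P : probability T R) (C : T -> set nat) : Prop :=
  CramerModel {
    cramer_ge3 : forall w l, C w l -> (3 <= l)%N ;
    cramer_prob : forall l, (3 <= l)%N ->
      P [set w | C w l] = ((ln (l%:R : R))^-1)%:E ;
    cramer_indep : mutually_independent P [set l | (3 <= l)%N]
      (fun l => [set w | C w l]) }.

Definition Ik (R : realType) (n k : nat) : set R :=
  `](n%:R / k.+1%:R), (n%:R / k%:R)]%classic.

Definition hit_event (R : realType) (T : Type) (C : T -> set nat)
    (n k : nat) : set T :=
  [set w | exists l : nat, Ik n k (l%:R : R) /\ C w l].

(* Extended-real valued, so that the series of nonnegative terms needs no
   convergence proof; if C w contains no 0, the k-th term vanishes for k > n. *)
Definition h_factorial (R : realType) (T : Type) (C : T -> set nat)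
    (n : nat) (w : T) : \bar R :=
  (\sum_(1 <= k <oo) (\1_(hit_event R C n k) w : R)%:E)%E.

(* Main.v *)
Require Import Defs.
From HB Require Import structures.
From mathcomp Require Import all_boot all_order all_algebra.
From mathcomp Require Import finmap.
From mathcomp Require Import all_classical all_reals all_analysis.
From mathcomp Require Import measurable_realfun.
From mathcomp Require Import ring lra.

(** The intervals I_k are disjoint, so that the number of hits is a sum of
    independent indicators. It is therefore close to its mean, and the formula
    is the asymptotic expansion of the mean. Write L = ln n and r = sqrt n.

    Concentration. The mean is at most 2 r ([expected_hits_le]). By Chernoff
    bounds with parameter n^{-1/4}, the count is at distance at least
    2 L n^{1/4} from its mean with probability O(n^{-2}) ([deviation_le]). By
    the Borel-Cantelli lemma, almost surely this happens for finitely many n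
    only, and 2 L n^{1/4} is much smaller than r ln L / L^2, the order of the
    error term. The remaining n >= 2 are absorbed in the constant, because
    ln L is nonzero for them ([ln_ln_nat_neq0]).

    Mean, blocks k <= r. Put s = r / k and Y = 2 s^2 / L. The integers l of
    I_k, in number j about s^2, satisfy ln l = L / 2 + ln s + O(1 / k), and the
    probability of a hit is 1 - e^{-X}, where X sums - ln (1 - 1 / ln l) over
    I_k. Expanding to first order around Y ([hit_term_expansion]), the
    probability is
      1 - e^{-Y} + e^{-Y} (2 / L) (j - s^2) + Y e^{-Y} (1 - 2 ln s) / L
    up to O((1 + ln s)^2 / L^2 + 1 / k). The discrepancies j - s^2 are, up to
    O(s^2 / k), increments of a fractional part, whose contribution is negligible
    after summation by parts ([abel_bound]). With w = r sqrt (2 / L), one has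
    Y = (w / k)^2, and what is left are Riemann sums over the points u = w / k of
    1 - e^{-u^2}, u^2 e^{-u^2} and u^2 ln (u^2) e^{-u^2} with respect to
    du / u^2. Their limits are sqrt pi, sqrt pi / 2 and
    - (sqrt pi / 2) (gamma + 2 ln 2).

    Mean, blocks k > r. Each contains at most one integer, so their
    probabilities add up to the sum of 1 / ln l for l up to about r, that is
    2 r / L + O(r / L^2) ([member_prob_sum]). This cancels the boundary term
    that arises because the first Riemann sum stops at k about r. Everything is
    collected in [mean_asymptotics].

    The constant. The moments of u^{2j} e^{-u^2}, with and without a factor
    ln u, obey recursions by integration by parts. They show that the mean of
    2 ln u for this weight exceeds the mean for j = 0 by twice the sum of
    1 / (2 i + 1) over i < j. As the weight concentrates around u^2 = j, the
    mean is also ln j + O(1 / j) ([log_mean_bounds]); comparing the two and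
    letting j tend to infinity gives the mean for j = 0, in which Euler's
    constant enters through harmonic sums ([log_gauss_prim_limit_value]). *)

Import Order.TTheory GRing.Theory Num.Theory.
Import numFieldNormedType.Exports.

Local Open Scope classical_set_scope.
Local Open Scope ring_scope.

Set Implicit Arguments.
Unset Strict Implicit.
Unset Printing Implicit Defensive.

(** * Derivatives and monotonicity *)

Section Derivatives.
Context {R : realType}.
Implicit Types (f g : R -> R) (x : R).

(** The differentiation rules for pointwise expressions, with the derivatives
    in the form that the tactics below assemble by unification. *)
Lemma is_derive_add f g x a b : is_derive x 1 f a -> is_derive x 1 g b ->
  is_derive x 1 (fun t => f t + g t) (a + b).
Proof. by move=> df dg; exact: is_deriveD. Qed.

Lemma is_derive_opp f x a : is_derive x 1 f a -> is_derive x 1 (fun t => - f t) (- a).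
Proof. by move=> df; exact: is_deriveN. Qed.

Lemma is_derive_mul f g x a b : is_derive x 1 f a -> is_derive x 1 g b ->
  is_derive x 1 (fun t => f t * g t) (a * g x + f x * b).
Proof.
move=> df dg; have := is_deriveM df dg.
by rewrite /GRing.scale /= addrC [g x * a]mulrC.
Qed.

Lemma is_derive_const (c : R) x : is_derive x 1 (fun=> c) 0.
Proof. exact: is_derive_cst. Qed.

Lemma is_derive_var x : is_derive x 1 (fun t : R => t) 1.
Proof. exact: is_derive_id. Qed.

Lemma is_derive_pow f n x a : is_derive x 1 f a ->
  is_derive x 1 (fun t => f t ^+ n.+1) (n.+1%:R * f x ^+ n * a).
Proof.
move=> df; have := is_deriveX n.+1 df; rewrite /GRing.scale /=.
by rewrite (_ : f ^+ n.+1 = fun t => f t ^+ n.+1)//; apply/funext => t; rewrite exprfctE.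
Qed.

Lemma is_derive_expR_comp f x a : is_derive x 1 f a ->
  is_derive x 1 (fun t => expR (f t)) (a * expR (f x)).
Proof.
move=> df; rewrite mulrC.
exact: (@is_derive1_comp _ expR f x _ _ (is_derive_expR _) df).
Qed.

Lemma is_derive_ln_comp f x a : 0 < f x -> is_derive x 1 f a ->
  is_derive x 1 (fun t => ln (f t)) (a / f x).
Proof.
move=> fx df; rewrite mulrC.
exact: (@is_derive1_comp _ (@ln R) f x _ _ (is_derive1_ln fx) df).
Qed.

Lemma is_derive_inv f x a : f x != 0 -> is_derive x 1 f a ->
  is_derive x 1 (fun t => (f t)^-1) (- a / f x ^+ 2).
Proof.
move=> fx df; have := is_deriveV fx df.
by rewrite /GRing.scale /= mulNr mulrC mulNr.
Qed.

Lemma is_derive_chain f g x a b : is_derive (g x) 1 f a -> is_derive x 1 g b ->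
  is_derive x 1 (fun t => f (g t)) (a * b).
Proof. by move=> df dg; exact: (@is_derive1_comp _ f g x _ _ df dg). Qed.

Lemma is_derive_continuous f x a : is_derive x 1 f a -> {for x, continuous f}.
Proof.
by move=> [df _]; apply/differentiable_continuous/derivable1_diffP.
Qed.

Lemma mean_value f (df : R -> R) a b : a < b ->
  (forall x, a <= x <= b -> is_derive x 1 f (df x)) ->
  exists2 c, a < c < b & f b - f a = df c * (b - a).
Proof.
move=> ab H.
have [||c] := @MVT R f df a b ab.
- by move=> x; rewrite in_itv /= => /andP[ax xb]; apply: H; rewrite !ltW.
- apply: continuous_in_subspaceT => x; rewrite inE /= in_itv /= => xab.
  by have := H _ xab; exact: is_derive_continuous.
- by rewrite in_itv /= => cab E; exists c.
Qed.

Lemma nondecreasing_from f (df : R -> R) a : 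
  (forall x, a < x -> is_derive x 1 f (df x)) ->
  (forall x, a < x -> 0 <= df x) ->
  forall x y, a < x -> x <= y -> f x <= f y.
Proof.
move=> H H0 x y ax; rewrite le_eqVlt => /predU1P[->//|xy].
have [z|c /andP[xc cy] E] := @mean_value f df x y xy.
  by case/andP=> xz _; apply: H; exact: lt_le_trans xz.
rewrite -subr_ge0 E mulr_ge0//; last by rewrite subr_ge0 ltW.
by apply: H0; exact: lt_trans xc.
Qed.

(** Every comparison of integrals from 0 goes through this form of
    monotonicity: the functions are differentiable on the open half-line only,
    so a right limit replaces the value at 0. *)
Lemma ge0_from_right_limit f (df : R -> R) :
  (forall x, 0 < x -> is_derive x 1 f (df x)) ->
  (forall x, 0 < x -> 0 <= df x) ->
  f x @[x --> 0^'+] --> 0 ->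
  forall x, 0 < x -> 0 <= f x.
Proof.
move=> H H0 f0 x x0.
rewrite -(cvg_lim _ f0)//; apply: limr_le; first by apply/cvg_ex; exists 0.
near=> y.
apply: (@nondecreasing_from f df 0 H H0); first by near: y; exact: nbhs_right_gt.
by near: y; apply: nbhs_right_le.
Unshelve. all: by end_near. Qed.

End Derivatives.

(** Differentiates along the structure of the expression; derivatives of
    abstract functions come from hypotheses or are left as goals, like the
    positivity and nonvanishing conditions. *)
Ltac derive := repeat first
  [ exact: is_derive_var | exact: is_derive_const | eassumption
  | notypeclasses refine (is_derive_add _ _) | notypeclasses refine (is_derive_opp _)
  | notypeclasses refine (is_derive_expR_comp _) | notypeclasses refine (is_derive_ln_comp _ _)
  | notypeclasses refine (is_derive_inv _ _) | notypeclasses refine (is_derive_pow _ _)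
  | notypeclasses refine (is_derive_mul _ _) ]; cbv beta.

Lemma derivative_eq {R : realType} (f : R -> R) (x a b : R) :
  is_derive x 1 f a -> a = b -> is_derive x 1 f b.
Proof. by move=> + <-. Qed.

(** Also leaves the equation between the derivative found and the expected
    one. *)
Ltac derive_as := notypeclasses refine (derivative_eq _ _); [derive|cbv beta].

(** * Elementary bounds for the exponential and the logarithm *)

Section ElementaryBounds.
Context {R : realType}.

(** No smallness of X - Y is required: weighting the remainder by both
    exponentials makes the bound valid everywhere. *)
Lemma expR_taylor2 (X Y : R) :
  `|expR (- X) - expR (- Y) * (1 - (X - Y))|
    <= (X - Y) ^+ 2 * (expR (- X) + expR (- Y)).
Proof.
set D := X - Y.
have -> : expR (- X) = expR (- Y) * expR (- D) by rewrite -expRD /D; congr expR; ring.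
have e0 := expR_gt0 (- Y).
have d0 := expR_gt0 (- D).
have h1 := expR_ge1Dx (- D).
have h2 : (1 + D) * expR (- D) <= 1.
  by rewrite -[leRHS](expRxMexpNx_1 D) ler_pM2r ?expR_ge1Dx.
rewrite -mulrBr ger0_norm; last by apply: mulr_ge0; lra.
have -> : D ^+ 2 * (expR (- Y) * expR (- D) + expR (- Y)) =
  expR (- Y) * (D ^+ 2 * (expR (- D) + 1)) by ring.
rewrite ler_pM2l//.
have -> : expR (- D) - (1 - D) = expR (-D) - 1 + D by ring.
have [D0|D0] := leP 0 D; nra.
Qed.

Lemma ln_taylor2 (u : R) : 0 <= u <= 1 / 2 ->
  `|- ln (1 - u) - u - u ^+ 2 / 2| <= 2 * u ^+ 3.
Proof.
case/andP; rewrite le_eqVlt => /predU1P[<-|u0] u1.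
  by rewrite !subr0 ln1 !expr0n/= mul0r mulr0 !subr0 oppr0 normr0.
pose f (t : R) := - ln (1 - t) - t - t ^+ 2 / 2.
pose df (t : R) := t ^+ 2 / (1 - t).
have [x /andP[x0 x1]|c /andP[c0 cu]] := @mean_value R f df 0 u u0.
  rewrite /f /df; derive_as; first lra.
  by field; lra.
rewrite {1 2}/f !subr0 ln1 expr0n/= mul0r !(oppr0, subr0, addr0) /df => ->.
rewrite ger0_norm; last by rewrite mulr_ge0 ?divr_ge0 ?sqr_ge0//; lra.
have c1 : 0 < 1 - c by lra.
rewrite mulrAC ler_pdivrMr//.
have : c ^+ 2 * u <= u ^+ 3.
  by rewrite [leRHS]exprSr ler_pM2r// !expr2; nra.
have : 0 < u ^+ 3 by rewrite exprn_gt0.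
set w := u ^+ 3; nra.
Qed.

Lemma expR_ge_pow (x : R) n : 0 <= x -> x ^+ n / n`!%:R <= expR x.
Proof.
case: n => [|n] x0.
  by rewrite expr0 fact0 divr1 -expR0 ler_expR.
by apply: le_trans (expR_ge1Dxn n x0); lra.
Qed.

Lemma pow_expRN_bound n (a : R) : 0 < a -> 
  exists2 C, 0 < C & forall x, 0 <= x -> x ^+ n * expR (- (a * x)) <= C.
Proof.
move=> a0; exists (n`!%:R / a ^+ n).
  by rewrite divr_gt0 ?exprn_gt0 ?ltr0n ?fact_gt0.
move=> x x0; rewrite expRN ler_pdivrMr ?expR_gt0//.
have /expR_ge_pow - /(_ n) : 0 <= a * x by rewrite mulr_ge0 // ltW.
rewrite exprMn => h.
have f0 : 0 < n`!%:R :> R by rewrite ltr0n fact_gt0.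
have an : 0 < a ^+ n by rewrite exprn_gt0.
rewrite -(ler_pM2l (divr_gt0 an f0)).
apply: le_trans (le_trans h _); first by rewrite [leRHS]mulrAC.
rewrite mulrA [a ^+ n / _ * _](_ : _ = 1) ?mul1r//.
by field; rewrite !gt_eqF.
Qed.

Lemma ln_le_root (s : R) : 1 <= s -> ln s <= 4 * Num.sqrt (Num.sqrt s).
Proof.
move=> s1.
have s0 : 0 < s by lra.
set q : R := Num.sqrt (Num.sqrt s).
have q0 : 0 < q by rewrite !sqrtr_gt0.
have -> : s = q ^+ 4.
  by rewrite (exprM q 2 2) /q !sqr_sqrtr ?sqrtr_ge0// ltW.
by rewrite lnXn// -[ln q *+ 4]mulr_natl; have := ln_sublinear q0; lra.
Qed.

(** Dominating the squared logarithm by a square root makes its values at s =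
    r / k, for k at most r, add up to O(r). *)
Lemma one_add_ln_sqr_le (s : R) : 1 <= s ->
  (1 + ln s) ^+ 2 <= 25 * Num.sqrt s.
Proof.
move=> s1; have h := ln_le_root s1; have l0 := ln_ge0 s1.
have q1 : 1 <= Num.sqrt (Num.sqrt s) by rewrite -sqrtr1 ler_sqrt ?sqrtr_ge0// -[leLHS]sqrtr1 ler_sqrt; lra.
rewrite -[in leRHS](sqr_sqrtr (sqrtr_ge0 s)).
set q := Num.sqrt (Num.sqrt s) in h q1 *.
nra.
Qed.

End ElementaryBounds.

(** * Primitives that vanish at the origin *)

Section Primitive.
Context {R : realType}.
Implicit Types (f g df dg : R -> R) (x s C : R).

Definition primitive f (s : R) : R := parameterized_integral lebesgue_measure 0 s f.

Lemma continuous_itv_integrable f (b : R) : continuous f ->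
  (@lebesgue_measure R).-integrable `[0, b] (EFin \o f).
Proof.
move=> cf; apply: continuous_compact_integrable; first exact: segment_compact.
exact: continuous_subspaceT.
Qed.

Lemma is_derive_primitive f s : continuous f -> 0 < s ->
  is_derive s 1 (primitive f) (f s).
Proof.
move=> cf s0.
have [||d <-] := @continuous_FTC1_closed R f 0 s (s + 1) _ _ s0 (cf s).
- by rewrite ltrDl.
- exact: continuous_itv_integrable.
- by rewrite derive1E; exact: DeriveDef.
Qed.

Lemma primitive_cvg0 f : continuous f -> primitive f s @[s --> 0^'+] --> 0.
Proof.
move=> cf; apply: cvg_at_right_filter.
exact: (parameterized_integral_cvg_left ltr01 (continuous_itv_integrable 1 cf)).
Qed.

Lemma le_from_right_limit f g df dg :
  (forall x : R, 0 < x -> is_derive x 1 f (df x)) ->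
  (forall x : R, 0 < x -> is_derive x 1 g (dg x)) ->
  (forall x : R, 0 < x -> df x <= dg x) ->
  f x @[x --> 0^'+] --> 0 -> g x @[x --> 0^'+] --> 0 ->
  forall x : R, 0 < x -> f x <= g x.
Proof.
move=> Hf Hg H0 f0 g0 x x0; rewrite -subr_ge0.
apply: (@ge0_from_right_limit R (fun t => g t - f t) (fun t => dg t - df t)) => //.
- by move=> y y0; derive; [exact: Hg|exact: Hf].
- by move=> y y0; rewrite subr_ge0 H0.
- by rewrite -[X in _ --> X](subr0 0); apply: cvgB.
Qed.

Lemma cvg_id0 : (fun x : R => x) x @[x --> 0^'+] --> (0 : R).
Proof. by apply: cvg_at_right_filter; exact: cvg_id. Qed.

(** f increases while f + C / x decreases, which yields the limit and the rate
    at the same time. *)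
Lemma convergent_at_infinity f df C :
  (forall x : R, 1 <= x -> is_derive x 1 f (df x)) ->
  (forall x : R, 1 <= x -> 0 <= df x <= C / x ^+ 2) ->
  exists2 l, f x @[x --> +oo] --> l & forall x : R, 1 <= x -> `|l - f x| <= C / x.
Proof.
move=> Hf Hd.
have up x y : 1 <= x -> x <= y -> f x <= f y.
  move=> x1; rewrite le_eqVlt => /predU1P[->//|xy].
  have [z /andP[xz _]|c /andP[xc cy] E] := @mean_value R f df x y xy.
    by apply: Hf; lra.
  have [|d0 _] := andP (Hd c _); first lra.
  have : 0 <= df c * (y - x) by apply: mulr_ge0; lra.
  lra.
have dn x y : 1 <= x -> x <= y -> f y <= f x + C / x - C / y.
  move=> x1; rewrite le_eqVlt => /predU1P[->//|xy]; first lra.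
  pose g t := f t + C / t; pose dg t := df t - C / t ^+ 2.
  have [z /andP[xz _]|c /andP[xc cy] E] := @mean_value R g dg x y xy.
    rewrite /g /dg; derive_as; [by apply: Hf; lra|lra|].
    by field; lra.
  have [|_ d0] := andP (Hd c _); first lra.
  have : 0 <= - dg c * (y - x) by apply: mulr_ge0; rewrite /dg; lra.
  by move: E; rewrite /g; lra.
have C0 : 0 <= C.
  have [//|] := andP (Hd 1 _).
  by rewrite expr1n divr1; apply: le_trans.
pose g t := f (Num.max 1 t).
have ub x : 1 <= x -> f x <= f 1 + C.
  move=> x1; have := dn 1 x (lexx _) x1.
  have : 0 <= C / x by rewrite divr_ge0//; lra.
  by rewrite divr1; lra.
have gl : g x @[x --> +oo] --> sup (range g).
  apply: nondecreasing_cvgr.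
    move=> x y xy; apply: up; first by rewrite le_max lexx.
    by rewrite ge_max !le_max lexx xy orbT.
  exists (f 1 + C) => _ [x _ <-]; apply: ub.
  by rewrite le_max lexx.
have fl : f x @[x --> +oo] --> sup (range g).
  apply: cvg_trans gl; apply: near_eq_cvg; near=> x.
  rewrite /g max_r//; near: x; apply: nbhs_pinfty_ge; exact: num_real.
exists (sup (range g)) => // x x1.
have h1 : f x <= sup (range g).
  rewrite -(cvg_lim _ fl)//; apply: limr_ge; first by apply/cvg_ex; exists (sup (range g)).
  near=> y; apply: up => //; near: y; apply: nbhs_pinfty_ge; exact: num_real.
have h2 : sup (range g) <= f x + C / x.
  rewrite -(cvg_lim _ fl)//; apply: limr_le; first by apply/cvg_ex; exists (sup (range g)).
  near=> y.
  have xy : x <= y by near: y; apply: nbhs_pinfty_ge; exact: num_real.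
  have := dn x y x1 xy.
  have : 0 <= C / y by rewrite divr_ge0//; lra.
  lra.
by rewrite ger0_norm; lra.
Unshelve. all: by end_near. Qed.

End Primitive.

(** * Gaussian moments, with and without a logarithm *)

Section LogGauss.
Context {R : realType}.
Implicit Types (s : R) (j : nat).

Definition gauss_prim : R -> R := primitive gauss_fun.

Lemma is_derive_gauss_prim s : 0 < s -> is_derive s 1 gauss_prim (expR (- s ^+ 2)).
Proof. exact: is_derive_primitive continuous_gauss_fun. Qed.

Lemma gauss_prim_cvg0 : gauss_prim s @[s --> 0^'+] --> 0.
Proof. exact: primitive_cvg0 continuous_gauss_fun. Qed.

Lemma gauss_prim_bounds s : 0 < s -> s * expR (- s ^+ 2) <= gauss_prim s <= s.
Proof.
move=> s0; apply/andP; split.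
- apply: (@le_from_right_limit R (fun t => t * expR (- t ^+ 2)) gauss_prim
    (fun t => expR (- t ^+ 2) - 2 * t ^+ 2 * expR (- t ^+ 2))
    (fun t => expR (- t ^+ 2))) => // [x x0|x x0|x x0||].
  + by derive_as; ring.
  + exact: is_derive_gauss_prim.
  + rewrite gerBl; apply: mulr_ge0; last exact: expR_ge0.
    by rewrite mulr_ge0 ?sqr_ge0.
  + rewrite -[X in _ --> X](mul0r (expR (- 0 ^+ 2))).
    apply: cvgM; first exact: cvg_id0.
    by apply: cvg_at_right_filter; exact: continuous_gauss_fun.
  + exact: gauss_prim_cvg0.
- apply: (@le_from_right_limit R gauss_prim (fun t => t)
    (fun t => expR (- t ^+ 2)) (fun=> 1)) => // [x x0|x x0||].
  + exact: is_derive_gauss_prim.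
  + exact: gauss_fun_le1.
  + exact: gauss_prim_cvg0.
  + exact: cvg_id0.
Qed.

(** The quotient G(s) / s, where G is the primitive of e^{-u^2}, continued by
    its limit 1 so that it is continuous on the whole line and has a
    primitive. *)
Definition gauss_slope s : R := if s <= 0 then 1 else gauss_prim s / s.

Lemma gauss_slope_bounds s : expR (- s ^+ 2) <= gauss_slope s <= 1.
Proof.
rewrite /gauss_slope; have [_|s0] := leP s 0.
  by rewrite lexx andbT gauss_fun_le1.
have /andP[h1 h2] := gauss_prim_bounds s0.
by rewrite ler_pdivlMr// ler_pdivrMr// mulrC h1 mul1r.
Qed.

Lemma continuous_gauss_slope : continuous gauss_slope.
Proof.
move=> x; have [x0|x0|->] := ltrgt0P x.
- have : (fun t => gauss_prim t / t) t @[t --> x] --> gauss_prim x / x.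
    apply: (@is_derive_continuous R _ x); derive; last by rewrite gt_eqF.
    exact: is_derive_gauss_prim.
  rewrite /continuous_at {2}/gauss_slope leNgt x0 /=.
  apply: cvg_trans; apply: near_eq_cvg; near=> t.
  rewrite /gauss_slope leNgt ifN//; apply/negPn.
  by near: t; exact: lt_nbhsr.
- rewrite /continuous_at {2}/gauss_slope ltW//.
  have : (fun=> 1) t @[t --> x] --> (1 : R) by exact: cvg_cst.
  apply: cvg_trans; apply: near_eq_cvg; near=> t.
  rewrite /gauss_slope ifT//.
  by apply: ltW; near: t; exact: lt_nbhsl.
- rewrite /continuous_at {2}/gauss_slope lexx.
  apply: (@squeeze_cvgr _ _ _ _ gauss_fun (fun=> 1)).
  + by near=> t; exact: gauss_slope_bounds.
  + have := @continuous_gauss_fun R 0.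
    by rewrite /continuous_at {2}/gauss_fun expr0n oppr0 expR0.
  + exact: cvg_cst.
Unshelve. all: by end_near. Qed.

(** The integral of ln u e^{-u^2} over (0, s) after an integration by parts:
    the singularity of the logarithm at 0 disappears, and only the continuous
    quotient G(u) / u is integrated. *)
Definition log_gauss_prim s : R :=
  ln s * gauss_prim s - primitive gauss_slope s.

Lemma is_derive_log_gauss_prim s : 0 < s ->
  is_derive s 1 log_gauss_prim (ln s * expR (- s ^+ 2)).
Proof.
move=> s0; rewrite /log_gauss_prim.
derive_as; [exact: is_derive_gauss_prim|exact: is_derive_primitive continuous_gauss_slope s0|].
by rewrite /gauss_slope leNgt s0 /=; field; rewrite gt_eqF.
Qed.

Lemma abs_ln_le s : 0 < s <= 1 -> `|ln s| <= 2 / Num.sqrt s.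
Proof.
move=> /andP[s0 s1]; have q0 : 0 < Num.sqrt s by rewrite sqrtr_gt0.
rewrite ler0_norm; last exact: ln_le0.
have := @ln_sublinear R (Num.sqrt s)^-1; rewrite invr_gt0 => /(_ q0).
have -> : s = Num.sqrt s ^+ 2 by rewrite sqr_sqrtr// ltW.
rewrite lnXn ?posrE// sqrtr_sqr gtr0_norm// lnV ?posrE// -mulr_natl.
lra.
Qed.

Lemma log_gauss_prim_bound s : 0 < s -> `|log_gauss_prim s| <= s * (1 + `|ln s|).
Proof.
move=> s0.
have /andP[g1 g2] := gauss_prim_bounds s0.
have g0 : 0 <= gauss_prim s by apply: le_trans g1; rewrite mulr_ge0 ?expR_ge0 ?ltW.
have n0 : 0 <= primitive gauss_slope s.
  apply: (@ge0_from_right_limit R _ gauss_slope) s0 => [x|x _|].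
  - exact: is_derive_primitive continuous_gauss_slope.
  - by have /andP[+ _] := gauss_slope_bounds x; apply: le_trans; exact: expR_ge0.
  - exact: primitive_cvg0 continuous_gauss_slope.
have n1 : primitive gauss_slope s <= s.
  apply: (@le_from_right_limit R _ (fun t => t) gauss_slope (fun=> 1)) s0 => // [x|x _||].
  - exact: is_derive_primitive continuous_gauss_slope.
  - by have /andP[] := gauss_slope_bounds x.
  - exact: primitive_cvg0 continuous_gauss_slope.
  - exact: cvg_id0.
rewrite /log_gauss_prim (le_trans (ler_normB _ _))//.
rewrite normrM (ger0_norm g0) (ger0_norm n0).
have : `|ln s| * gauss_prim s <= `|ln s| * s by rewrite ler_wpM2l.
lra.
Qed.



Lemma pow_gauss_bound k : exists2 C : R, 0 < C &
  forall s, 0 <= s -> s ^+ k * expR (- s ^+ 2) <= C.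
Proof.
have [C C0 h] := @pow_expRN_bound R k 1 ltr01.
exists (C + 1); first lra.
move=> s s0; have [s1|s1] := leP 1 s; last first.
  have e1 := @gauss_fun_le1 R s; have e0 := expR_gt0 (- s ^+ 2).
  have : s ^+ k <= 1 by rewrite exprn_ile1// ltW.
  have : 0 <= s ^+ k by rewrite exprn_ge0.
  rewrite /gauss_fun in e1; nra.
have := h (s ^+ 2) (sqr_ge0 s); rewrite mul1r.
have : s ^+ k <= (s ^+ 2) ^+ k by rewrite -exprM ler_weXn2l// leq_pmull.
have := expR_gt0 (- s ^+ 2); nra.
Qed.

Lemma invr_cvg_pinfty (C : R) : C / s @[s --> +oo] --> 0.
Proof.
rewrite -[X in _ --> X](mulr0 C); apply: cvgM; first exact: cvg_cst.
apply/gtr0_cvgV0; last exact: cvg_id.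
by near=> s; near: s; apply: nbhs_pinfty_gt; exact: num_real.
Unshelve. all: by end_near. Qed.

Lemma pow_gauss_cvgy k : s ^+ k * expR (- s ^+ 2) @[s --> +oo] --> (0 : R).
Proof.
have [C C0 h] := pow_gauss_bound k.+1.
apply: (@squeeze_cvgr _ _ _ _ (fun=> 0) (fun s => C / s)); last 2 first.
- exact: cvg_cst.
- exact: invr_cvg_pinfty.
near=> s; have s0 : 0 < s by near: s; apply: nbhs_pinfty_gt; exact: num_real.
apply/andP; split; first by rewrite mulr_ge0 ?exprn_ge0 ?expR_ge0// ltW.
by rewrite ler_pdivlMr//; have := h s (ltW s0); rewrite exprS; lra.
Unshelve. all: by end_near. Qed.

Lemma pow_ln_gauss_cvgy k :
  s ^+ k * ln s * expR (- s ^+ 2) @[s --> +oo] --> (0 : R).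
Proof.
apply: (@squeeze_cvgr _ _ _ _ (fun=> 0) (fun s => s ^+ k.+1 * expR (- s ^+ 2))); last 2 first.
- exact: cvg_cst.
- exact: pow_gauss_cvgy.
near=> s; have s1 : 1 < s by near: s; apply: nbhs_pinfty_gt; exact: num_real.
have s0 : 0 < s by lra.
have l0 := ln_ge0 (ltW s1); have ls := ln_sublinear s0.
apply/andP; split; first by rewrite !mulr_ge0 ?exprn_ge0 ?expR_ge0// ltW.
by rewrite [s ^+ k.+1]exprSr ler_pM2r ?expR_gt0// ler_pM2l ?exprn_gt0// ltW.
Unshelve. all: by end_near. Qed.

Lemma sqrt_cvg0 : 2 * Num.sqrt s @[s --> 0^'+] --> (0 : R).
Proof.
rewrite -[X in _ --> X](mulr0 2); apply: cvgM; first exact: cvg_cst.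
apply: cvg_at_right_filter; rewrite -[X in _ --> X]sqrtr0.
exact: sqrt_continuous.
Qed.

Lemma mulr_div_sqrt s : 0 < s -> s * (2 / Num.sqrt s) = 2 * Num.sqrt s.
Proof.
move=> s0; rewrite -{1}(sqr_sqrtr (ltW s0)).
by field; rewrite gt_eqF// sqrtr_gt0.
Qed.

Lemma cvg0_of_sqrt_bound (f : R -> R) :
  (forall s, 0 < s <= 1 -> `|f s| <= 2 * Num.sqrt s) ->
  f s @[s --> 0^'+] --> 0.
Proof.
move=> h; apply: (@squeeze_cvgr _ _ _ _ (fun s => - (2 * Num.sqrt s))
  (fun s => 2 * Num.sqrt s)).
- near=> s; rewrite -ler_norml h//; apply/andP; split.
    by near: s; exact: nbhs_right_gt.
  by near: s; exact: nbhs_right_le.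
- by rewrite -[X in _ --> X]oppr0; apply: cvgN; exact: sqrt_cvg0.
- exact: sqrt_cvg0.
Unshelve. all: by end_near. Qed.

Lemma pow_gauss_le_id k s : 0 < s <= 1 -> 0 <= s ^+ k.+1 * expR (- s ^+ 2) <= s.
Proof.
move=> /andP[s0 s1].
have e1 := @gauss_fun_le1 R s; have e0 := expR_gt0 (- s ^+ 2); rewrite /gauss_fun in e1.
have : s ^+ k <= 1 by rewrite exprn_ile1// ltW.
have : 0 <= s ^+ k by rewrite exprn_ge0// ltW.
rewrite exprS; set w := s ^+ k; set e := expR _ in e0 e1 *; move=> w0 w1.
have : 0 <= w * e <= 1 by nra.
move=> /andP[h1 h2]; apply/andP; split; nra.
Qed.

Lemma pow_gauss_cvg0 k : s ^+ k.+1 * expR (- s ^+ 2) @[s --> 0^'+] --> (0 : R).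
Proof.
apply: cvg0_of_sqrt_bound => s s01.
have /andP[h1 h2] := pow_gauss_le_id k s01.
case/andP: s01 => s0 s1.
rewrite ger0_norm// (le_trans h2)//.
have q1 : Num.sqrt s <= 1 by rewrite -sqrtr1 ler_sqrt.
have q0 := sqrtr_ge0 s.
have := sqr_sqrtr (ltW s0); nra.
Qed.

Lemma pow_ln_gauss_cvg0 k :
  s ^+ k.+1 * ln s * expR (- s ^+ 2) @[s --> 0^'+] --> (0 : R).
Proof.
apply: cvg0_of_sqrt_bound => s s01.
have /andP[h1 h2] := pow_gauss_le_id k s01.
have h3 := abs_ln_le s01.
case/andP: s01 => s0 s1.
by rewrite mulrAC normrM (ger0_norm h1) -mulr_div_sqrt//; exact: ler_pM.
Qed.

Lemma log_gauss_prim_cvg0 : log_gauss_prim s @[s --> 0^'+] --> 0.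
Proof.
have h : (fun s => s * (1 + 2 / Num.sqrt s)) s @[s --> 0^'+] --> (0 : R).
  have : (fun s => s + 2 * Num.sqrt s) s @[s --> 0^'+] --> (0 : R).
    rewrite -[X in _ --> X](addr0 0); apply: cvgD; first exact: cvg_id0.
    exact: sqrt_cvg0.
  apply: cvg_trans; apply: near_eq_cvg; near=> s.
  have s0 : 0 < s by near: s; exact: nbhs_right_gt.
  by rewrite mulrDr mulr1 mulr_div_sqrt.
apply: (@squeeze_cvgr _ _ _ _ (fun s => - (s * (1 + 2 / Num.sqrt s)))
  (fun s => s * (1 + 2 / Num.sqrt s))) => //.
- near=> s; have s0 : 0 < s by near: s; exact: nbhs_right_gt.
  rewrite -ler_norml (le_trans (log_gauss_prim_bound s0))// ler_pM2l// lerD2l.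
  by apply: abs_ln_le; rewrite s0/=; near: s; exact: nbhs_right_le.
- by rewrite -[X in _ --> X]oppr0; apply: cvgN.
Unshelve. all: by end_near. Qed.

(** The integral of u^{2j} e^{-u^2} over (0, s), through the recursion given
    by integration by parts. *)
Fixpoint gauss_moment j s : R :=
  if j is i.+1 then
    i.*2.+1%:R / 2 * gauss_moment i s - s ^+ i.*2.+1 * expR (- s ^+ 2) / 2
  else gauss_prim s.

(** The integral of u^{2j} ln u e^{-u^2} over (0, s), through the recursion
    given by integration by parts. *)
Fixpoint log_gauss_moment j s : R :=
  if j is i.+1 then
    i.*2.+1%:R / 2 * log_gauss_moment i s + gauss_moment i s / 2
      - s ^+ i.*2.+1 * ln s * expR (- s ^+ 2) / 2
  else log_gauss_prim s.

Lemma is_derive_gauss_moment j s : 0 < s ->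
  is_derive s 1 (gauss_moment j) (s ^+ j.*2 * expR (- s ^+ 2)).
Proof.
move=> s0; elim: j => [|j IH] /=; first by rewrite mul1r; exact: is_derive_gauss_prim.
derive_as.
by rewrite doubleS !exprS; set w := s ^+ j.*2; set c := _%:R; field.
Qed.

Lemma is_derive_log_gauss_moment j s : 0 < s ->
  is_derive s 1 (log_gauss_moment j) (s ^+ j.*2 * ln s * expR (- s ^+ 2)).
Proof.
move=> s0; elim: j => [|j IH] /=; first by rewrite mul1r; exact: is_derive_log_gauss_prim.
derive_as; first exact: is_derive_gauss_moment.
by rewrite doubleS !exprS; set w := s ^+ j.*2; set c := _%:R; field; rewrite gt_eqF.
Qed.

Lemma gauss_moment_cvg0 j : gauss_moment j s @[s --> 0^'+] --> 0.
Proof.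
elim: j => [|j IH] /=; first exact: gauss_prim_cvg0.
rewrite -[X in _ --> X](_ : j.*2.+1%:R / 2 * 0 - 0 / 2 = 0); last by rewrite mulr0 mul0r subr0.
apply: cvgB; first by apply: cvgM => //; exact: cvg_cst.
by apply: cvgM; [exact: pow_gauss_cvg0|exact: cvg_cst].
Qed.

Lemma log_gauss_moment_cvg0 j : log_gauss_moment j s @[s --> 0^'+] --> 0.
Proof.
elim: j => [|j IH] /=; first exact: log_gauss_prim_cvg0.
rewrite -[X in _ --> X](_ : j.*2.+1%:R / 2 * 0 + 0 / 2 - 0 / 2 = 0); last by rewrite mulr0 mul0r addr0 subr0.
apply: cvgB; [apply: cvgD|].
- by apply: cvgM => //; exact: cvg_cst.
- by apply: cvgM; [exact: gauss_moment_cvg0|exact: cvg_cst].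
- by apply: cvgM; [exact: pow_ln_gauss_cvg0|exact: cvg_cst].
Qed.

End LogGauss.

(** * The integral of ln u e^{-u^2} over the half-line *)

Section LogGaussLimit.
Context {R : realType}.
Implicit Types (s l : R) (j n : nat).

Lemma ln_le_sub1 (y : R) : 0 < y -> ln y <= y - 1.
Proof.
move=> y0; have := @le_ln1Dx R (y - 1).
by rewrite (addrC 1) subrK; apply; lra.
Qed.

Lemma harmonicE n : harmonic n = n.+1%:R^-1 :> R.
Proof. by []. Qed.

(** The square of the limit is known to be pi / 4; the rate comes from
    e^{-s^2} = O(1 / s^2). *)
Lemma gauss_prim_limit : gauss_prim s @[s --> +oo] --> (Num.sqrt pi / 2 : R) /\
  exists2 C : R, 0 < C & forall s, 1 <= s -> `|Num.sqrt pi / 2 - gauss_prim s| <= C / s.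
Proof.
have [C C0 hC] := @pow_gauss_bound R 2.
have [s s1|s s1|l gl hl] := @convergent_at_infinity R gauss_prim (fun s => expR (- s ^+ 2)) C.
- by apply: is_derive_gauss_prim; lra.
- rewrite expR_ge0/= ler_pdivlMr; last by rewrite exprn_gt0//; lra.
  by have := hC s; rewrite mulrC; apply; lra.
suff <- : l = Num.sqrt pi / 2 by split=> //; exists C.
have l0 : 0 <= l.
  apply: (@ler_cvg_to _ _ _ _ (fun=> 0) gauss_prim) gl _; first exact: cvg_cst.
  near=> s; have s0 : 0 < s by near: s; apply: nbhs_pinfty_gt; exact: num_real.
  have /andP[+ _] := gauss_prim_bounds s0; apply: le_trans.
  by rewrite mulr_ge0 ?expR_ge0// ltW.
have h : l ^+ 2 = pi / 4.
  have h1 : gauss_prim s ^+ 2 @[s --> +oo] --> l ^+ 2.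
    by under eq_fun do rewrite expr2; rewrite expr2; exact: cvgM.
  by rewrite -(cvg_lim _ h1)//; apply/cvg_lim => //; exact: gauss_integral_proof.cvg_integral0_gauss_sqr.
have : l ^+ 2 = (Num.sqrt pi / 2) ^+ 2.
  by rewrite h exprMn sqr_sqrtr ?pi_ge0//; field.
move/eqP; rewrite eqrXn2 ?divr_ge0 ?sqrtr_ge0// => /eqP//.
Unshelve. all: by end_near. Qed.

Lemma log_gauss_prim_limit : exists l : R, log_gauss_prim s @[s --> +oo] --> l /\
  exists2 C : R, 0 < C & forall s, 1 <= s -> `|l - log_gauss_prim s| <= C / s.
Proof.
have [C C0 hC] := @pow_gauss_bound R 3.
have [s s1|s s1|l gl hl] := @convergent_at_infinity R log_gauss_prim (fun s => ln s * expR (- s ^+ 2)) C.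
- by apply: is_derive_log_gauss_prim; lra.
- rewrite mulr_ge0 ?expR_ge0 ?ln_ge0//= ler_pdivlMr; last by rewrite exprn_gt0//; lra.
  have s0 : 0 < s by lra.
  apply: le_trans (hC s (ltW s0)).
  rewrite mulrAC ler_pM2r ?expR_gt0// [s ^+ 3]exprS ler_pM2r ?exprn_gt0//.
  by rewrite ltW// ln_sublinear.
by exists l; split=> //; exists C.
Qed.

(** The total mass of u^{2j} e^{-u^2} on the half-line. *)
Fixpoint gauss_mass j : R :=
  if j is i.+1 then i.*2.+1%:R / 2 * gauss_mass i else Num.sqrt pi / 2.

(** The sum of 1 / (2 i + 1) for i < j. By the recursion for the moments, it
    is the amount by which the mean of ln u for the weight u^{2j} e^{-u^2}
    exceeds that for the weight e^{-u^2}. *)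
Fixpoint odd_harmonic j : R :=
  if j is i.+1 then odd_harmonic i + i.*2.+1%:R^-1 else 0.

Lemma gauss_mass_gt0 j : 0 < gauss_mass j.
Proof.
by elim: j => [|j IH] /=; rewrite ?mulr_gt0// ?divr_gt0// ?sqrtr_gt0// ?pi_gt0.
Qed.

Lemma gauss_moment_cvgy j : gauss_moment j s @[s --> +oo] --> gauss_mass j.
Proof.
elim: j => [|j IH] /=; first by have [] := gauss_prim_limit.
rewrite -[X in _ --> X](_ : j.*2.+1%:R / 2 * gauss_mass j - 0 / 2 = _); last by rewrite mul0r subr0.
apply: cvgB; first by apply: cvgM => //; exact: cvg_cst.
by apply: cvgM; [exact: pow_gauss_cvgy|exact: cvg_cst].
Qed.

Lemma log_gauss_moment_cvgy l j : log_gauss_prim s @[s --> +oo] --> l ->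
  log_gauss_moment j s @[s --> +oo] -->
    gauss_mass j * (l / (Num.sqrt pi / 2) + odd_harmonic j).
Proof.
move=> hl; have q0 : 0 < Num.sqrt (pi : R) by rewrite sqrtr_gt0 pi_gt0.
elim: j => [|j IH] /=.
  by rewrite addr0 [X in _ --> X](_ : _ = l)//; field; rewrite gt_eqF.
have n0 : j.*2.+1%:R != 0 :> R by rewrite pnatr_eq0.
rewrite -[X in _ --> X](_ : j.*2.+1%:R / 2 * (gauss_mass j * (l / (Num.sqrt pi / 2) + odd_harmonic j)) + gauss_mass j / 2 - 0 / 2 = _); last first.
  by field; rewrite ?n0 ?gt_eqF.
apply: cvgB; [apply: cvgD|].
- by apply: cvgM => //; exact: cvg_cst.
- by apply: cvgM; [exact: gauss_moment_cvgy|exact: cvg_cst].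
- by apply: cvgM; [exact: pow_ln_gauss_cvgy|exact: cvg_cst].
Qed.

(** The inequality ln y <= y - 1 at y = u^2 / c, integrated against u^{2j}
    e^{-u^2}. *)
Lemma log_gauss_moment_le j (c : R) s : 0 < c -> 0 < s ->
  2 * log_gauss_moment j s <= gauss_moment j.+1 s / c + (ln c - 1) * gauss_moment j s.
Proof.
move=> c0.
apply: (@le_from_right_limit R (fun s => 2 * log_gauss_moment j s)
  (fun s => gauss_moment j.+1 s / c + (ln c - 1) * gauss_moment j s)
  (fun s => 2 * (s ^+ j.*2 * ln s * expR (- s ^+ 2)))
  (fun s => (s ^+ j.+1.*2 * expR (- s ^+ 2)) / c + (ln c - 1) * (s ^+ j.*2 * expR (- s ^+ 2)))).
- by move=> x x0; have d1 := is_derive_log_gauss_moment j x0; derive_as; ring.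
- move=> x x0; have d1 := is_derive_gauss_moment j x0.
  by have d2 := is_derive_gauss_moment j.+1 x0; derive_as; ring.
- move=> x x0.
  have h := @ln_le_sub1 (x ^+ 2 / c) (divr_gt0 (exprn_gt0 2 x0) c0).
  have w0 : 0 <= x ^+ j.*2 * expR (- x ^+ 2) by rewrite mulr_ge0 ?expR_ge0 ?exprn_ge0 ?ltW.
  move: h; rewrite ln_div ?posrE ?exprn_gt0// lnXn// -[ln x *+ 2]mulr_natl => h.
  rewrite (_ : x ^+ j.+1.*2 = x ^+ 2 * x ^+ j.*2); last by rewrite doubleS -exprD.
  have -> : x ^+ 2 * x ^+ j.*2 * expR (- x ^+ 2) / c = x ^+ j.*2 * expR (- x ^+ 2) * (x ^+ 2 / c) by ring.
  rewrite [x ^+ j.*2 * ln x * _]mulrAC; set w := x ^+ j.*2 * expR _ in w0 *.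
  nra.
- by rewrite -[X in _ --> X](mulr0 2); apply: cvgM; [exact: cvg_cst|exact: log_gauss_moment_cvg0].
- rewrite -[X in _ --> X](_ : 0 / c + (ln c - 1) * 0 = 0); last by rewrite mul0r mulr0 addr0.
  apply: cvgD; apply: cvgM; try exact: gauss_moment_cvg0; exact: cvg_cst.
Qed.

(** The inequality ln y <= y - 1 at y = c / u^2, integrated against the weight
    of index j + 1. *)
Lemma log_gauss_moment_ge j (c : R) s : 0 < c -> 0 < s ->
  (ln c + 1) * gauss_moment j.+1 s - c * gauss_moment j s <= 2 * log_gauss_moment j.+1 s.
Proof.
move=> c0.
apply: (@le_from_right_limit R 
  (fun s => (ln c + 1) * gauss_moment j.+1 s - c * gauss_moment j s)
  (fun s => 2 * log_gauss_moment j.+1 s)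
  (fun s => (ln c + 1) * (s ^+ j.+1.*2 * expR (- s ^+ 2)) - c * (s ^+ j.*2 * expR (- s ^+ 2)))
  (fun s => 2 * (s ^+ j.+1.*2 * ln s * expR (- s ^+ 2)))).
- move=> x x0; have d1 := is_derive_gauss_moment j x0.
  by have d2 := is_derive_gauss_moment j.+1 x0; derive_as; ring.
- by move=> x x0; have d1 := is_derive_log_gauss_moment j.+1 x0; derive_as; ring.
- move=> x x0.
  have h := @ln_le_sub1 (c / x ^+ 2) (divr_gt0 c0 (exprn_gt0 2 x0)).
  have w0 : 0 <= x ^+ j.+1.*2 * expR (- x ^+ 2) by rewrite mulr_ge0 ?expR_ge0 ?exprn_ge0 ?ltW.
  move: h; rewrite ln_div ?posrE ?exprn_gt0// lnXn// -[ln x *+ 2]mulr_natl => h.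
  have -> : x ^+ j.*2 * expR (- x ^+ 2) = x ^+ j.+1.*2 * expR (- x ^+ 2) / x ^+ 2.
    rewrite (_ : x ^+ j.+1.*2 = x ^+ 2 * x ^+ j.*2); last by rewrite doubleS -exprD.
    by field; rewrite gt_eqF.
  rewrite [x ^+ j.+1.*2 * ln x * _]mulrAC; set w := x ^+ j.+1.*2 * expR _ in w0 *.
  have -> : c * (w / x ^+ 2) = w * (c / x ^+ 2) by ring.
  nra.
- rewrite -[X in _ --> X](_ : (ln c + 1) * 0 - c * 0 = 0); last by rewrite !mulr0 subr0.
  apply: cvgB; apply: cvgM; try exact: gauss_moment_cvg0; exact: cvg_cst.
- by rewrite -[X in _ --> X](mulr0 2); apply: cvgM; [exact: cvg_cst|exact: log_gauss_moment_cvg0].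
Qed.

(** The mean of ln u^2 for the weight u^{2j} e^{-u^2} is ln j + O(1 / j). The
    two comparisons above are used with c equal to the ratio of two
    consecutive total masses, j + 1/2 or j - 1/2: at this value the terms
    linear in the masses cancel and only ln c is left. *)
Lemma log_mean_bounds l j : log_gauss_prim s @[s --> +oo] --> l -> (0 < j)%N ->
  ln (j%:R - 1 / 2) <= 2 * (l / (Num.sqrt pi / 2) + odd_harmonic j) <= ln (j%:R + 1 / 2).
Proof.
move=> hl j0.
have hj := @log_gauss_moment_cvgy l j hl.
have M0 := gauss_mass_gt0 j.
have E : gauss_mass j * (2 * (l / (Num.sqrt pi / 2) + odd_harmonic j)) =
  2 * (gauss_mass j * (l / (Num.sqrt pi / 2) + odd_harmonic j)) by ring.
have h2 : 2 * log_gauss_moment j s @[s --> +oo] -->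
   2 * (gauss_mass j * (l / (Num.sqrt pi / 2) + odd_harmonic j)).
  by apply: cvgM => //; exact: cvg_cst.
apply/andP; split; rewrite -(ler_pM2l M0) E {E}.
- case: j j0 M0 h2 {hj} => // j _ M0 h2.
  have c0 : 0 < j.+1%:R - 1 / 2 :> R by rewrite -natr1; have := ler0n R j; lra.
  set c : R := j.+1%:R - 1 / 2 in c0 *.
  rewrite -[leLHS](_ : (ln c + 1) * gauss_mass j.+1 - c * gauss_mass j = _); last first.
    rewrite /= /c.
    have -> : j.*2.+1%:R = 2 * (j.+1%:R - 1 / 2) :> R by rewrite -[j.*2.+1%:R]natr1 -[j.+1%:R]natr1 -muln2 natrM; field.
    by field.
  apply: ler_cvg_to _ h2 _; last first.
    near=> s; have s0 : 0 < s by near: s; apply: nbhs_pinfty_gt; exact: num_real.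
    exact: log_gauss_moment_ge c0 s0.
  apply: cvgB; apply: cvgM; try exact: gauss_moment_cvgy; exact: cvg_cst.
- have c0 : 0 < j%:R + 1 / 2 :> R by have := ler0n R j; lra.
  set c : R := j%:R + 1 / 2 in c0 *.
  rewrite -[leRHS](_ : gauss_mass j.+1 / c + (ln c - 1) * gauss_mass j = _); last first.
    rewrite /= /c.
    have -> : j.*2.+1%:R = 2 * (j%:R + 1 / 2) :> R by rewrite -[j.*2.+1%:R]natr1 -muln2 natrM; field.
    by field; rewrite gt_eqF//; rewrite /c in c0; lra.
  apply: ler_cvg_to h2 _ _; last first.
    near=> s; have s0 : 0 < s by near: s; apply: nbhs_pinfty_gt; exact: num_real.
    exact: log_gauss_moment_le c0 s0.
  apply: cvgD; apply: cvgM; try exact: gauss_moment_cvgy; exact: cvg_cst.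
Unshelve. all: by end_near. Qed.

(** From the index 1 on the sequence decreases and is nonnegative, both by ln
    y <= y - 1. *)
Lemma euler_gamma_cvg :
  series (@harmonic R) n - ln n%:R @[n --> \oo] --> euler_gamma R.
Proof.
pose u n := series (@harmonic R) n - ln n%:R : R.
have uS : [sequence u n.+1]_n @ \oo --> inf (range [sequence u n.+1]_n).
  apply: nonincreasing_cvgn.
    apply/nonincreasing_seqP => n /=; rewrite /u.
    rewrite seriesSr harmonicE.
    have := @ln_le_sub1 (n.+1%:R / n.+2%:R) (divr_gt0 (ltr0Sn R _) (ltr0Sn R _)).
    rewrite ln_div ?posrE//.
    have -> : n.+1%:R / n.+2%:R - 1 = - n.+2%:R^-1 :> R.
      by rewrite -[n.+2%:R]natr1; field; have := ler0n R n; lra.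
    rewrite -addrA lerD2l; move: (ln n.+1%:R) (ln n.+2%:R) (n.+2%:R^-1) => a b c; lra.
  exists 0 => _ [n _ <-] /=; rewrite /u subr_ge0.
  suff : ln n.+2%:R <= series (@harmonic R) n.+1.
    by apply: le_trans; rewrite ler_ln ?posrE// ler_nat.
  elim: n => [|n IH].
    by rewrite seriesSr harmonicE seriesEord /= big_ord0; have := @ln_le_sub1 2 (ltr0Sn R 1); lra.
  rewrite seriesSr harmonicE.
  have := @ln_le_sub1 (n.+3%:R / n.+2%:R) (divr_gt0 (ltr0Sn R _) (ltr0Sn R _)).
  rewrite ln_div ?posrE//.
  have -> : n.+3%:R / n.+2%:R - 1 = n.+2%:R^-1 :> R.
    by rewrite -[n.+3%:R]natr1; field; have := ler0n R n; lra.
  move: IH; move: (ln n.+2%:R) (ln n.+3%:R) (n.+2%:R^-1) => a b c; lra.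
have : u n @[n --> \oo] --> inf (range [sequence u n.+1]_n) by rewrite -cvg_shiftS.
by move=> h; rewrite /euler_gamma -/u (cvg_lim _ h).
Qed.

Lemma odd_harmonicE j : 2 * odd_harmonic j =
  2 * series (@harmonic R) j.*2 - series (@harmonic R) j.
Proof.
elim: j => [|j IH] /=; first by rewrite !seriesEord /= !big_ord0; ring.
rewrite mulrDr IH doubleS !seriesSr !harmonicE.
have -> : j.*2.+2%:R = 2 * j.+1%:R :> R by rewrite -natrM mul2n.
have a0 : j.*2.+1%:R != 0 :> R by rewrite pnatr_eq0.
have b0 : j.+1%:R != 0 :> R by rewrite pnatr_eq0.
by move: (j.*2.+1%:R) (j.+1%:R) a0 b0 => a b a0 b0; field; rewrite a0 b0.
Qed.

(** Let j tend to infinity in [log_mean_bounds]. Twice the odd harmonic sum is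
    2 H_{2j} - H_j = ln j + 2 ln 2 + gamma + o(1), so twice the mean of ln u
    for the weight e^{-u^2} has to be - (gamma + 2 ln 2); the total mass of
    that weight is sqrt pi / 2. *)
Lemma log_gauss_prim_limit_value :
  log_gauss_prim s @[s --> +oo] --> (- (Num.sqrt pi / 4 * (euler_gamma R + 2 * ln 2)) : R).
Proof.
have [l [hl _]] := log_gauss_prim_limit.
suff <- : l = - (Num.sqrt pi / 4 * (euler_gamma R + 2 * ln 2)) by [].
have q0 : 0 < Num.sqrt (pi : R) by rewrite sqrtr_gt0 pi_gt0.
set t := l / (Num.sqrt pi / 2).
suff : 2 * t = - (euler_gamma R + 2 * ln 2).
  move=> h; have -> : l = t * (Num.sqrt pi / 2) by rewrite /t divfK// gt_eqF// divr_gt0.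
  have -> : t = - (euler_gamma R + 2 * ln 2) / 2 by lra.
  by field.
pose g n := series (@harmonic R) n - ln n%:R : R.
have gc : g n @[n --> \oo] --> euler_gamma R by exact: euler_gamma_cvg.
have gc1 : g n.+1 @[n --> \oo] --> euler_gamma R by rewrite (cvg_shiftS g).
have gc2 : g n.+1.*2 @[n --> \oo] --> euler_gamma R.
  apply: (@cvg_comp _ _ _ (fun n => n.+1.*2) g _ _ _ _ gc).
  apply/cvgnyPge => A; near=> n.
  rewrite -addnn; apply: leq_trans (leq_addr _ _).
  by apply: leqW; near: n; exact: nbhs_infty_ge.
pose v n := 2 * t + 2 * g n.+1.*2 - g n.+1 + 2 * ln 2 : R.
have vE n : v n = 2 * (t + odd_harmonic n.+1) - ln n.+1%:R.
  rewrite /v [in RHS]mulrDr odd_harmonicE /g.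
  have -> : n.+1.*2%:R = 2 * n.+1%:R :> R by rewrite -natrM mul2n.
  by rewrite lnM ?posrE//; ring.
have vc : v n @[n --> \oo] --> 2 * t + 2 * euler_gamma R - euler_gamma R + 2 * ln 2.
  apply: cvgD; last exact: cvg_cst.
  apply: cvgB => //; apply: cvgD; first exact: cvg_cst.
  by apply: cvgM => //; exact: cvg_cst.
have vc0 : v n @[n --> \oo] --> 0.
  apply: (@squeeze_cvgr _ _ _ _ (fun n => - harmonic n) (fun n => harmonic n)).
  - near=> n; rewrite vE.
    have /andP[h1 h2] := log_mean_bounds hl (ltn0Sn n).
    have n1 : 1 <= n.+1%:R :> R by rewrite ler1n.
    rewrite !harmonicE; rewrite /= -/t in h1 h2 *.
    have a1 := @ln_le_sub1 (n.+1%:R / (n.+1%:R - 1 / 2)) _.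
    have a2 := @ln_le_sub1 ((n.+1%:R + 1 / 2) / n.+1%:R) _.
    rewrite !ln_div ?posrE in a1 a2; try lra.
    have b1 : n.+1%:R / (n.+1%:R - 1 / 2) - 1 <= n.+1%:R^-1 :> R.
      have -> : n.+1%:R / (n.+1%:R - 1 / 2) - 1 = (2 * n.+1%:R - 1)^-1 :> R by field; lra.
      by rewrite lef_pV2 ?posrE; lra.
    have b2 : (n.+1%:R + 1 / 2) / n.+1%:R - 1 <= n.+1%:R^-1 :> R.
      have -> : (n.+1%:R + 1 / 2) / n.+1%:R - 1 = (2 * n.+1%:R)^-1 :> R by field; lra.
      by rewrite lef_pV2 ?posrE; lra.
    have c1 : 0 < n.+1%:R / (n.+1%:R - 1 / 2) :> R by apply: divr_gt0; lra.
    have c2 : 0 < (n.+1%:R + 1 / 2) / n.+1%:R :> R by apply: divr_gt0; lra.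
    move/(_ c1) in a1; move/(_ c2) in a2.
    have := le_trans a1 b1; have := le_trans a2 b2; move: h1 h2; clear.
    move: (n.+1%:R^-1) (odd_harmonic n + _) (ln n.+1%:R) => a b c.
    by move=> h1 h2 h3 h4; apply/andP; split; lra.
  - by rewrite -[X in _ --> X]oppr0; apply: cvgN; exact: cvg_harmonic.
  - exact: cvg_harmonic.
have : 2 * t + 2 * euler_gamma R - euler_gamma R + 2 * ln 2 = 0.
  exact: (cvg_unique (@norm_hausdorff _ _) vc vc0).
lra.
Unshelve. all: by end_near. Qed.

Lemma log_gauss_prim_rate : exists2 C : R, 0 < C & forall s, 1 <= s ->
  `|- (Num.sqrt pi / 4 * (euler_gamma R + 2 * ln 2)) - log_gauss_prim s| <= C / s.
Proof.
have [l [hl h]] := log_gauss_prim_limit.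
by rewrite -(cvg_unique _ hl log_gauss_prim_limit_value).
Qed.

End LogGaussLimit.

(** * Three Riemann sums *)

Section RiemannSums.
Context {R : realType}.
Implicit Types (s l C w : R) (F g dg : R -> R) (m k : nat).

(** F(1/x) has derivative - g(1/x), so the increment of F is d times a value
    of g inside the step; a second use of the mean value theorem compares this
    value with the one at the right end. *)
Lemma riemann_step F g dg C (d x : R) : 0 < d -> 0 < x ->
  (forall s, 0 < s -> is_derive s 1 F (g s / s ^+ 2)) ->
  (forall s, 0 < s -> is_derive s 1 g (dg s)) ->
  (forall s, 0 < s -> `|s ^+ 2 * dg s| <= C) ->
  `|g (x + d)^-1 * d - (F x^-1 - F (x + d)^-1)| <= C * d ^+ 2.
Proof.
move=> d0 x0 dF dG hC.
have xd : x < x + d by lra.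
have [t /andP[xt _]|c /andP[xc cd] E] :=
    @mean_value R (fun t => - F t^-1) (fun t => g t^-1) x (x + d) xd.
  have t0 : 0 < t by lra.
  have tV : 0 < t^-1 by rewrite invr_gt0.
  notypeclasses refine (derivative_eq (is_derive_opp (is_derive_chain (dF _ tV) (is_derive_inv _ (is_derive_var t)))) _).
    by rewrite gt_eqF.
  by cbv beta; field; rewrite gt_eqF.
have [t /andP[xt _]|e /andP[ec ed] E2] :=
    @mean_value R (fun t => g t^-1) (fun t => - (t^-1 ^+ 2 * dg t^-1)) c (x + d) cd.
  have t0 : 0 < t by lra.
  have tV : 0 < t^-1 by rewrite invr_gt0.
  notypeclasses refine (derivative_eq (is_derive_chain (dG _ tV) (is_derive_inv _ (is_derive_var t))) _).
    by rewrite gt_eqF.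
  by cbv beta; field; rewrite gt_eqF.
have eV : 0 < e^-1 by rewrite invr_gt0; lra.
have -> : g (x + d)^-1 * d - (F x^-1 - F (x + d)^-1) = (g (x + d)^-1 - g c^-1) * d.
  by move: E; rewrite opprK addrC => ->; ring.
have h := hC _ eV.
rewrite E2; move: h; set u := _ * dg _ => h.
rewrite mulNr mulNr normrN normrM normrM expr2 mulrA.
rewrite (gtr0_norm d0) ler_pM2r//.
have -> : `|x + d - c| = x + d - c by rewrite gtr0_norm//; lra.
have h0 : 0 <= C by exact: le_trans h.
by apply: ler_pM => //; lra.
Qed.

(** The points w / k are the inverses of the grid of step 1 / w. By
    [riemann_step] each step costs C / w after multiplication by w, hence the
    term m / w; the part of the integral above the first point w is bounded by
    C / w. *)
Lemma riemann_sum F g dg l C w m : 1 <= w -> (0 < m)%N ->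
  (forall s, 0 < s -> is_derive s 1 F (g s / s ^+ 2)) ->
  (forall s, 0 < s -> is_derive s 1 g (dg s)) ->
  (forall s, 0 < s -> `|s ^+ 2 * dg s| <= C) ->
  (forall s, 0 < s -> `|g s| <= C) ->
  (forall s, 1 <= s -> `|l - F s| <= C / s) ->
  `|\sum_(1 <= k < m.+1) g (w / k%:R) - w * (l - F (w / m%:R))|
    <= C * (2 + m%:R / w).
Proof.
move=> w1 m0 dF dG hC gC lC.
have w0 : 0 < w by lra.
have h2 : `|w * (l - F w)| <= C.
  by rewrite normrM gtr0_norm// mulrC -ler_pdivlMr//; exact: lC.
have h1 := gC _ w0.
suff : `|\sum_(1 <= k < m.+1) g (w / k%:R) - g w - w * (F w - F (w / m%:R))| <= C * (m%:R / w).
  move=> h3.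
  have -> : \sum_(1 <= k < m.+1) g (w / k%:R) - w * (l - F (w / m%:R)) =
   (\sum_(1 <= k < m.+1) g (w / k%:R) - g w - w * (F w - F (w / m%:R))) +
    g w - w * (l - F w) by ring.
  apply: le_trans (ler_normB _ _) _.
  have := ler_normD (\sum_(1 <= k < m.+1) g (w / k%:R) - g w - w * (F w - F (w / m%:R))) (g w).
  lra.
have C0 : 0 <= C by exact: le_trans h1.
elim: m m0 => // -[|m] IH _.
  rewrite big_nat1 divr1 !subrr mulr0 subr0 normr0.
  by rewrite mulr_ge0// divr_ge0// ltW.
have {IH} := IH isT.
set m1 := m.+1; move=> IH.
rewrite big_nat_recr//=.
have m1p : 0 < m1%:R :> R by rewrite ltr0n.
have step := @riemann_step F g dg C (w^-1) (m1%:R / w) _ _ dF dG hC.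
have {step} := step _ _; rewrite invr_gt0 w0 divr_gt0// => /(_ isT isT).
have -> : m1%:R / w + w^-1 = m1.+1%:R / w.
  by rewrite -[m1.+1%:R]natr1; field; rewrite gt_eqF.
rewrite !invf_div => step.
set S := (X in `|X - g w - _| <= _) in IH *.
have -> : S + g (w / m1.+1%:R) - g w - w * (F w - F (w / m1.+1%:R)) =
  (S - g w - w * (F w - F (w / m1%:R))) +
  w * (g (w / m1.+1%:R) / w - (F (w / m1%:R) - F (w / m1.+1%:R))).
  by field; rewrite gt_eqF.
apply: le_trans (ler_normD _ _) _.
rewrite normrM (gtr0_norm w0).
have : w * `|g (w / m1.+1%:R) / w - (F (w / m1%:R) - F (w / m1.+1%:R))| <= C / w.
  have -> : C / w = w * (C * w^-1 ^+ 2) by field; rewrite gt_eqF.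
  by rewrite ler_pM2l.
have -> : C * (m1.+1%:R / w) = C * (m1%:R / w) + C / w.
  by rewrite -[m1.+1%:R]natr1; field; rewrite gt_eqF.
lra.
Qed.

Lemma abs_ln_le_add s : 0 < s -> `|ln s| <= s + s^-1.
Proof.
move=> s0; have sV : 0 < s^-1 by rewrite invr_gt0.
have := ln_sublinear s0; have := ln_sublinear sV; rewrite lnV ?posrE// => h1 h2.
by rewrite ler_norml; apply/andP; split; lra.
Qed.

Lemma low_pow_gauss_bound : exists2 C : R, 0 < C &
  forall s, 0 <= s -> forall k, (k <= 6)%N -> s ^+ k * expR (- s ^+ 2) <= C.
Proof.
have [C0 c0 h0] := @pow_gauss_bound R 0.
have [C6 c6 h6] := @pow_gauss_bound R 6.
exists (C0 + C6); first lra.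
move=> s s0 k k6; have e0 := expR_gt0 (- s ^+ 2).
have [s1|s1] := leP 1 s.
  have := h6 s s0; have : s ^+ k <= s ^+ 6 by rewrite ler_weXn2l.
  nra.
have := h0 s s0; rewrite expr0 mul1r.
have : s ^+ k <= 1 by rewrite exprn_ile1// ltW.
nra.
Qed.

(** The integral of (1 - e^{-u^2}) / u^2 over the half-line is sqrt pi. Its
    part below the last point s = w / m is s + O(s^3), which accounts for the
    term w^2 / m. *)
Lemma riemann_one_sub_gauss : exists2 C : R, 0 < C & forall w m, 1 <= w -> (0 < m)%N ->
  `|\sum_(1 <= k < m.+1) (1 - expR (- (w / k%:R) ^+ 2)) -
    (w * Num.sqrt pi - w ^+ 2 / m%:R)| <= C * (1 + m%:R / w + w * (w / m%:R) ^+ 3).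
Proof.
have [C C0 hC] := low_pow_gauss_bound.
have [_ [D D0 hD]] := @gauss_prim_limit R.
pose F s := 2 * gauss_prim s - (1 - expR (- s ^+ 2)) / s.
exists (2 * (2 * C + 1 + 2 * D + 1) + 2); first lra.
move=> w m w1 m0.
have w0 : 0 < w by lra.
have mp : 0 < m%:R :> R by rewrite ltr0n.
set s := w / m%:R.
have s0 : 0 < s by rewrite divr_gt0.
have Fs : `|F s - s| <= 2 * s ^+ 3.
  have /andP[g1 g2] := gauss_prim_bounds s0.
  have e1 : 1 - s ^+ 2 <= expR (- s ^+ 2) by have := expR_ge1Dx (- s ^+ 2); lra.
  have e2 : expR (- s ^+ 2) <= 1 - s ^+ 2 + 2 * s ^+ 4.
    have := @expR_taylor2 R (s ^+ 2) 0; rewrite subr0 oppr0 expR0 mul1r -exprM.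
    have h : expR (- s ^+ 2) <= 1 by exact: gauss_fun_le1.
    have s4 : 0 <= s ^+ 4 by rewrite exprn_ge0// ltW.
    rewrite ler_norml => /andP[_]; nra.
  have b1 : (1 - expR (- s ^+ 2)) / s <= s by rewrite ler_pdivrMr// -expr2; lra.
  have b2 : s - 2 * s ^+ 3 <= (1 - expR (- s ^+ 2)) / s.
    rewrite ler_pdivlMr// (_ : (s - 2 * s ^+ 3) * s = s ^+ 2 - 2 * s ^+ 4); last ring.
    lra.
  have b3 : s - s ^+ 3 <= s * expR (- s ^+ 2).
    have -> : s - s ^+ 3 = s * (1 - s ^+ 2) by ring.
    by rewrite ler_pM2l.
  have s3 : 0 < s ^+ 3 by rewrite exprn_gt0.
  by rewrite /F ler_norml; apply/andP; split; lra.
have h : `|\sum_(1 <= k < m.+1) (1 - expR (- (w / k%:R) ^+ 2)) - w * (Num.sqrt pi - F s)|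
    <= (2 * C + 1 + 2 * D) * (2 + m%:R / w).
  apply: (@riemann_sum F (fun s => 1 - expR (- s ^+ 2)) (fun s => 2 * s * expR (- s ^+ 2))
  (Num.sqrt pi) (2 * C + 1 + 2 * D) w m w1 m0).
- move=> x x0; have dG := is_derive_gauss_prim x0.
  rewrite /F; derive_as; first by rewrite gt_eqF.
  by field; rewrite gt_eqF.
- by move=> x x0; derive_as; ring.
- move=> x x0; have := hC x (ltW x0) 3 isT.
  have : 0 <= x ^+ 3 * expR (- x ^+ 2) by rewrite mulr_ge0 ?expR_ge0// exprn_ge0// ltW.
  have -> : x ^+ 2 * (2 * x * expR (- x ^+ 2)) = 2 * (x ^+ 3 * expR (- x ^+ 2)) by ring.
  by move=> a b; rewrite ger0_norm; lra.
- move=> x x0; have h : expR (- x ^+ 2) <= 1 by exact: gauss_fun_le1.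
  by have := expR_gt0 (- x ^+ 2); rewrite ger0_norm; lra.
- move=> x x1; have x0 : 0 < x by lra.
  have h := hD x x1.
  have h1 : expR (- x ^+ 2) <= 1 by exact: gauss_fun_le1.
  have h0 := expR_gt0 (- x ^+ 2).
  have -> : Num.sqrt pi - F x = 2 * (Num.sqrt pi / 2 - gauss_prim x) + (1 - expR (- x ^+ 2)) / x.
    by rewrite /F; field; rewrite gt_eqF.
  apply: le_trans (ler_normD _ _) _.
  have : `|(1 - expR (- x ^+ 2)) / x| <= x^-1.
    rewrite ger0_norm; last by rewrite divr_ge0; lra.
    by rewrite ler_pdivrMr// mulVf ?gt_eqF//; lra.
  have : 0 <= 2 * C / x by apply: divr_ge0; lra.
  rewrite [Num.norm (2 * _)]normrM (@ger0_norm _ 2)// => a b.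
  have -> : (2 * C + 1 + 2 * D) / x = 2 * C / x + x^-1 + 2 * (D / x) by field; rewrite gt_eqF.
  lra.
have -> : w ^+ 2 / m%:R = w * s by rewrite /s; field; rewrite gt_eqF.
set S := \sum_(1 <= k < m.+1) _ in h *.
have -> : S - (w * Num.sqrt pi - w * s) = (S - w * (Num.sqrt pi - F s)) - w * (F s - s) by ring.
apply: le_trans (ler_normB _ _) _.
rewrite [Num.norm (w * _)]normrM (gtr0_norm w0).
have k0 : w * `|F s - s| <= w * (2 * s ^+ 3) by rewrite ler_pM2l.
have k1 : 0 < w * s ^+ 3 by rewrite mulr_gt0 ?exprn_gt0.
have k2 : 0 < m%:R / w by rewrite divr_gt0.
set q := m%:R / w in h k2 *; set r := w * s ^+ 3 in k1 *.
rewrite (_ : w * (2 * s ^+ 3) = 2 * r) in k0; last by rewrite /r; ring.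
nra.
Qed.

Lemma riemann_sqr_gauss : exists2 C : R, 0 < C & forall w m, 1 <= w -> (0 < m)%N ->
  `|\sum_(1 <= k < m.+1) ((w / k%:R) ^+ 2 * expR (- (w / k%:R) ^+ 2)) -
    w * (Num.sqrt pi / 2)| <= C * (1 + m%:R / w + w * (w / m%:R)).
Proof.
have [C C0 hC] := low_pow_gauss_bound.
have [_ [D D0 hD]] := @gauss_prim_limit R.
exists (2 * (4 * C + D) + 1); first lra.
move=> w m w1 m0.
have w0 : 0 < w by lra.
have mp : 0 < m%:R :> R by rewrite ltr0n.
set s := w / m%:R.
have s0 : 0 < s by rewrite divr_gt0.
have pos (x : R) k : 0 < x -> 0 <= x ^+ k * expR (- x ^+ 2).
  by move=> x0; rewrite mulr_ge0 ?expR_ge0// exprn_ge0// ltW.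
have h : `|\sum_(1 <= k < m.+1) ((w / k%:R) ^+ 2 * expR (- (w / k%:R) ^+ 2)) - w * (Num.sqrt pi / 2 - gauss_prim s)|
    <= (4 * C + D) * (2 + m%:R / w).
  apply: (@riemann_sum gauss_prim (fun s => s ^+ 2 * expR (- s ^+ 2))
  (fun s => 2 * (s - s ^+ 3) * expR (- s ^+ 2)) (Num.sqrt pi / 2) (4 * C + D) w m w1 m0).
- move=> x x0; rewrite [X in is_derive _ _ _ X](_ : _ = expR (- x ^+ 2)).
    exact: is_derive_gauss_prim.
  by field; rewrite gt_eqF.
- by move=> x x0; derive_as; ring.
- move=> x x0; have := hC x (ltW x0) 3 isT; have := hC x (ltW x0) 5 isT.
  have := pos x 3 x0; have := pos x 5 x0.
  have -> : x ^+ 2 * (2 * (x - x ^+ 3) * expR (- x ^+ 2)) =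
    2 * (x ^+ 3 * expR (- x ^+ 2)) - 2 * (x ^+ 5 * expR (- x ^+ 2)) by ring.
  by move=> *; rewrite ler_norml; apply/andP; split; lra.
- by move=> x x0; have := pos x 2 x0; have := hC x (ltW x0) 2 isT => a b; rewrite ger0_norm; lra.
- move=> x x1; have x0 : 0 < x by lra.
  have := hD x x1; have : 0 <= 4 * C / x by apply: divr_ge0; lra.
  have -> : (4 * C + D) / x = 4 * C / x + D / x by field; rewrite gt_eqF.
  lra.
have /andP[g1 g2] := gauss_prim_bounds s0.
have g0 : 0 <= gauss_prim s by apply: le_trans g1; have := pos s 1 s0; rewrite expr1.
set S := \sum_(1 <= k < m.+1) _ in h *.
have -> : S - w * (Num.sqrt pi / 2) = (S - w * (Num.sqrt pi / 2 - gauss_prim s)) - w * gauss_prim s by ring.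
apply: le_trans (ler_normB _ _) _.
rewrite [Num.norm (w * _)]normrM (gtr0_norm w0) (ger0_norm g0).
have k0 : w * gauss_prim s <= w * s by rewrite ler_pM2l.
have k1 : 0 < w * s by rewrite mulr_gt0.
have k2 : 0 < m%:R / w by rewrite divr_gt0.
set q := m%:R / w in h k2 *; set r := w * s in k0 k1 *.
nra.
Qed.

(** The limit is twice the integral of ln u e^{-u^2}: this is the origin of
    gamma in the final formula. *)
Lemma riemann_sqr_log_gauss : exists2 C : R, 0 < C & forall w m, 1 <= w -> (0 < m)%N ->
  `|\sum_(1 <= k < m.+1)
      ((w / k%:R) ^+ 2 * ln ((w / k%:R) ^+ 2) * expR (- (w / k%:R) ^+ 2)) +
    w * (Num.sqrt pi / 2 * (euler_gamma R + 2 * ln 2))|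
  <= C * (1 + m%:R / w + w * (w / m%:R) * (1 + `|ln (w / m%:R)|)).
Proof.
have [C C0 hC] := low_pow_gauss_bound.
have [D D0 hD] := @log_gauss_prim_rate R.
exists (2 * (20 * C + 2 * D) + 2); first lra.
move=> w m w1 m0.
have w0 : 0 < w by lra.
have mp : 0 < m%:R :> R by rewrite ltr0n.
set s := w / m%:R.
have s0 : 0 < s by rewrite divr_gt0.
set l := - (Num.sqrt pi / 4 * (euler_gamma R + 2 * ln 2)) in hD *.
have pos (x : R) k : 0 < x -> 0 <= x ^+ k * expR (- x ^+ 2).
  by move=> x0; rewrite mulr_ge0 ?expR_ge0// exprn_ge0// ltW.
have ln2 (x : R) : 0 < x -> ln (x ^+ 2) = 2 * ln x by move=> x0; rewrite lnXn// mulr_natl.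
have powln (x : R) k : 0 < x -> (k <= 4)%N -> `|x ^+ k.+1 * ln x * expR (- x ^+ 2)| <= 2 * C.
  move=> x0 k5; have h1 := abs_ln_le_add x0.
  rewrite mulrAC normrM (ger0_norm (pos x k.+1 x0)).
  have := ler_wpM2l (pos x k.+1 x0) h1.
  have -> : x ^+ k.+1 * expR (- x ^+ 2) * (x + x^-1) =
    x ^+ k.+2 * expR (- x ^+ 2) + x ^+ k * expR (- x ^+ 2).
    by rewrite !exprS; set y := expR _; field; rewrite gt_eqF.
  have := hC x (ltW x0) k.+2 (k5 : (k.+2 <= 6)%N); have := hC x (ltW x0) k (leq_trans k5 (isT : (4 <= 6)%N)).
  lra.
have h : `|\sum_(1 <= k < m.+1) ((w / k%:R) ^+ 2 * ln ((w / k%:R) ^+ 2) * expR (- (w / k%:R) ^+ 2)) - w * (2 * l - 2 * log_gauss_prim s)|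
    <= (20 * C + 2 * D) * (2 + m%:R / w).
  apply: (@riemann_sum (fun s => 2 * log_gauss_prim s)
  (fun s => s ^+ 2 * ln (s ^+ 2) * expR (- s ^+ 2))
  (fun s => (4 * s * ln s + 2 * s - 4 * s ^+ 3 * ln s) * expR (- s ^+ 2))
  (2 * l) (20 * C + 2 * D) w m w1 m0).
- move=> x x0; have d0 := is_derive_log_gauss_prim x0; derive_as.
  by rewrite ln2//; field; rewrite gt_eqF.
- move=> x x0; derive_as; first by rewrite exprn_gt0.
  by rewrite ln2//; field; rewrite gt_eqF.
- move=> x x0; have := powln x 2 x0 isT; have := powln x 4 x0 isT.
  have := pos x 3 x0; have := hC x (ltW x0) 3 isT.
  have -> : x ^+ 2 * ((4 * x * ln x + 2 * x - 4 * x ^+ 3 * ln x) * expR (- x ^+ 2)) =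
    4 * (x ^+ 3 * ln x * expR (- x ^+ 2)) + 2 * (x ^+ 3 * expR (- x ^+ 2))
    - 4 * (x ^+ 5 * ln x * expR (- x ^+ 2)) by ring.
  rewrite !ler_norml => a b /andP[c1 c2] /andP[c3 c4].
  by apply/andP; split; lra.
- move=> x x0; have := powln x 1 x0 isT; rewrite ln2//.
  have -> : x ^+ 2 * (2 * ln x) * expR (- x ^+ 2) = 2 * (x ^+ 2 * ln x * expR (- x ^+ 2)) by ring.
  by rewrite !ler_norml => /andP[c1 c2]; apply/andP; split; lra.
- move=> x x1; have x0 : 0 < x by lra.
  have := hD x x1; have : 0 <= 20 * C / x by apply: divr_ge0; lra.
  have -> : (20 * C + 2 * D) / x = 20 * C / x + 2 * (D / x) by field; rewrite gt_eqF.
  have -> : 2 * l - 2 * log_gauss_prim x = 2 * (l - log_gauss_prim x) by ring.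
  rewrite [Num.norm (2 * _)]normrM (@ger0_norm _ 2)//; lra.
have g0 := log_gauss_prim_bound s0.
set S := \sum_(1 <= k < m.+1) _ in h *.
have -> : S + w * (Num.sqrt pi / 2 * (euler_gamma R + 2 * ln 2)) =
  (S - w * (2 * l - 2 * log_gauss_prim s)) - 2 * (w * log_gauss_prim s) by rewrite /l; field.
apply: le_trans (ler_normB _ _) _.
rewrite [Num.norm (2 * _)]normrM [Num.norm (w * _)]normrM (gtr0_norm w0) (@ger0_norm _ 2)//.
have k0 : w * `|log_gauss_prim s| <= w * (s * (1 + `|ln s|)) by rewrite ler_pM2l.
have k1 : 0 < w * s by rewrite mulr_gt0.
have k2 : 0 < m%:R / w by rewrite divr_gt0.
have k3 : 0 <= w * s * (1 + `|ln s|) by rewrite mulr_ge0 ?ltW// addr_ge0.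
rewrite mulrA in k0.
set q := m%:R / w in h k2 *; set r := w * s * _ in k0 k3 *.
nra.
Qed.

End RiemannSums.

(** * Expansion of the probability of a hit *)

Section TermExpansion.
Context {R : realType}.
Implicit Types (L s a X Y : R).

(** Here ln l = L / 2 + s - eta for an integer l of I_k, where s = ln (sqrt n
    / k) depends on the block and eta, at most 1 / k, on the position of l in
    it. The left side is the hazard of the event that l is a member, minus its
    first two terms in 1 / L. *)
Lemma hazard_expansion L s (eta : R) : 8 <= L -> 0 <= s <= L / 2 -> 0 <= eta <= 1 ->
  `|- ln (1 - (L / 2 + s - eta)^-1) - 2 / L * (1 + (1 - 2 * s) / L)|
    <= 160 * ((1 + s) ^+ 2 / L ^+ 3 + eta / L ^+ 2).
Proof.
move=> L8 /andP[s0 sL] /andP[e0 e1].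
set a := L / 2 + s - eta; set a0 := L / 2 + s.
have aL : L / 4 <= a by rewrite /a; lra.
have a0L : L / 2 <= a0 by rewrite /a0; lra.
have ap : 0 < a by lra.
have a0p : 0 < a0 by lra.
set u := L^-1; set v := a^-1; set v0 := a0^-1.
have uL : L * u = 1 by rewrite mulfV// gt_eqF//; lra.
have va : a * v = 1 by rewrite mulfV// gt_eqF.
have va0 : a0 * v0 = 1 by rewrite mulfV// gt_eqF.
have up : 0 < u by rewrite invr_gt0; lra.
have vp : 0 < v by rewrite invr_gt0.
have v0p : 0 < v0 by rewrite invr_gt0.
have v4 : v <= 4 * u.
  have -> : 4 * u = (L / 4)^-1 by rewrite invf_div.
  by rewrite lef_pV2 ?posrE//; lra.
have v02 : v0 <= 2 * u.
  have -> : 2 * u = (L / 2)^-1 by rewrite invf_div.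
  by rewrite lef_pV2 ?posrE//; lra.
have u8 : u <= 1 / 8 by rewrite -[leRHS]invf_div divr1 lef_pV2 ?posrE//; lra.
have T := @ln_taylor2 R v _; have {T} := T _.
have -> : 0 <= v <= 1 / 2 by apply/andP; split; lra.
move=> /(_ isT) T.
have v3 : 2 * v ^+ 3 <= 128 * u ^+ 3.
  have : v ^+ 3 <= (4 * u) ^+ 3 by rewrite lerXn2r ?nnegrE//; lra.
  by rewrite exprMn; lra.
have E1 : v - v0 = eta * (v * v0).
  by rewrite /v /v0 /a -/a0; field; rewrite !gt_eqF//; rewrite /a in ap; lra.
have B1 : 0 <= v - v0 <= 8 * (eta * u ^+ 2).
  have h : 0 <= v * v0 <= 8 * u ^+ 2.
    apply/andP; split; first by rewrite mulr_ge0// ltW.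
    by apply: le_trans (ler_pM (ltW vp) (ltW v0p) v4 v02) _; lra.
  rewrite E1; nra.
have E2 : v0 - 2 * u * (1 - 2 * s * u) = v0 * (4 * s ^+ 2 * u ^+ 2).
  have -> : v0 - 2 * u * (1 - 2 * s * u) = v0 - 2 * u * (1 - 2 * s * u) * (a0 * v0) by rewrite va0 mulr1.
  have -> : a0 = L / 2 + s by [].
  have -> : v0 - 2 * u * (1 - 2 * s * u) * ((L / 2 + s) * v0) =
    v0 * (1 - (L * u) * (1 - 2 * s * u) - 2 * u * s * (1 - 2 * s * u)) by field.
  by rewrite uL; ring.
have B2 : 0 <= v0 - 2 * u * (1 - 2 * s * u) <= 8 * (s ^+ 2 * u ^+ 3).
  rewrite E2.
  have h : 0 <= s ^+ 2 * u ^+ 2 by rewrite mulr_ge0 ?sqr_ge0.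
  have -> : 8 * (s ^+ 2 * u ^+ 3) = (2 * u) * (4 * (s ^+ 2 * u ^+ 2)) by ring.
  rewrite -[4 * s ^+ 2 * _]mulrA; apply/andP; split; first by rewrite mulr_ge0; lra.
  by apply: ler_wpM2r => //; lra.
have E3 : v - 2 * u = 2 * (u * v) * (eta - s).
  have -> : v - 2 * u = v * (L * u) - 2 * u * (a * v) by rewrite uL va !mulr1.
  by rewrite /a; field.
have B3 : `|v - 2 * u| <= 8 * (u ^+ 2 * (1 + s)).
  have h : 0 <= u * v <= 4 * u ^+ 2.
    apply/andP; split; first by rewrite mulr_ge0// ltW.
    have : u * v <= u * (4 * u) by rewrite ler_pM2l.
    lra.
  rewrite E3 ler_norml; case/andP: h => h1 h2; apply/andP; split; nra.
have B4 : `|v ^+ 2 / 2 - 2 * u ^+ 2| <= 24 * (u ^+ 3 * (1 + s)).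
  have -> : v ^+ 2 / 2 - 2 * u ^+ 2 = (v - 2 * u) * ((v + 2 * u) / 2) by field.
  rewrite normrM.
  have -> : `|(v + 2 * u) / 2| = (v + 2 * u) / 2 by rewrite ger0_norm; lra.
  have -> : 24 * (u ^+ 3 * (1 + s)) = (8 * (u ^+ 2 * (1 + s))) * (3 * u) by ring.
  by apply: ler_pM => //; lra.
have -> : 2 * u * (1 + (1 - 2 * s) * u) = 2 * u * (1 - 2 * s * u) + 2 * u ^+ 2 by ring.
have -> : 160 * ((1 + s) ^+ 2 / L ^+ 3 + eta / L ^+ 2) = 160 * ((1 + s) ^+ 2 * u ^+ 3 + eta * u ^+ 2).
  by rewrite !exprVn.
have u3 : 0 < u ^+ 3 by rewrite exprn_gt0.
have eu : 0 <= eta * u ^+ 2 by rewrite mulr_ge0 ?sqr_ge0.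
have su : 0 <= s * u ^+ 3 by rewrite mulr_ge0// ltW.
have ssu : 0 <= s ^+ 2 * u ^+ 3 by rewrite mulr_ge0 ?sqr_ge0// ltW.
have -> : (1 + s) ^+ 2 * u ^+ 3 = u ^+ 3 + 2 * (s * u ^+ 3) + s ^+ 2 * u ^+ 3 by ring.
move: B4; have -> : u ^+ 3 * (1 + s) = u ^+ 3 + s * u ^+ 3 by ring.
move: T; rewrite !ler_norml.
case/andP: B1 => B1 B1'; case/andP: B2 => B2 B2'.
move=> /andP[T T'] /andP[B4 B4'].
by apply/andP; split; lra.
Qed.

End TermExpansion.

Section HitTermExpansion.
Context {R : realType}.
Implicit Types (L s a X Y : R).

Lemma quarter_exp_bound : exists2 C : R, 0 < C &
  forall Y, 0 <= Y -> (1 + Y) ^+ 2 * expR (- (Y / 4)) <= C.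
Proof.
have [C C0 h] := @pow_expRN_bound R 2 (1 / 4) ltac:(lra).
exists (2 + 2 * C); first lra.
move=> Y Y0; have := h Y Y0.
have -> : 1 / 4 * Y = Y / 4 by ring.
have e0 := expR_gt0 (- (Y / 4)).
have e1 : expR (- (Y / 4)) <= 1 by rewrite expR_le1; lra.
set e := expR _ in e0 e1 *.
have : (1 + Y) ^+ 2 <= 2 + 2 * Y ^+ 2 by have := sqr_ge0 (Y - 1); rewrite !expr2; lra.
nra.
Qed.

(** D = X - Y may be polynomially large in Y, but both exponentials are
    O(e^{-Y/4}), which absorbs every power of Y. This bounds the remainder of
    [expR_taylor2]. *)
Lemma second_order_bound (K : R) : exists2 c : R, 0 <= c &
  forall D X Y v p, 0 <= Y -> 0 <= v -> 0 <= p <= 1 -> Y / 4 - 1 <= X ->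
  `|D| <= K * ((1 + Y) * v + Y * p) ->
  D ^+ 2 * (expR (- X) + expR (- Y)) <= c * (v ^+ 2 + p).
Proof.
have [C C0 hC] := quarter_exp_bound.
exists (2 * K ^+ 2 * (C * (1 + expR 1))).
  have e1 : 0 <= 1 + expR 1 :> R by rewrite addr_ge0 ?expR_ge0.
  by apply: mulr_ge0; apply: mulr_ge0 => //; [exact: sqr_ge0|exact: ltW].
move=> D X Y v p Y0 v0 /andP[p0 p1] XY HD.
have D2 : D ^+ 2 <= 2 * K ^+ 2 * ((1 + Y) ^+ 2 * (v ^+ 2 + p)).
  have -> : D ^+ 2 = `|D| ^+ 2 by rewrite real_normK ?num_real.
  have h : `|D| ^+ 2 <= (K * ((1 + Y) * v + Y * p)) ^+ 2.
    by rewrite lerXn2r// nnegrE; apply: le_trans HD.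
  apply: le_trans h _; rewrite exprMn.
  have -> : 2 * K ^+ 2 * ((1 + Y) ^+ 2 * (v ^+ 2 + p)) =
    K ^+ 2 * (2 * ((1 + Y) ^+ 2 * v ^+ 2) + 2 * ((1 + Y) ^+ 2 * p)) by ring.
  apply: ler_wpM2l; first exact: sqr_ge0.
  have h1 : ((1 + Y) * v + Y * p) ^+ 2 <= 2 * ((1 + Y) ^+ 2 * v ^+ 2) + 2 * (Y ^+ 2 * p ^+ 2).
    have := sqr_ge0 ((1 + Y) * v - Y * p); clear.
    rewrite -!exprMn; move: ((1 + Y) * v) (Y * p) => a b; rewrite !expr2; lra.
  have h2 : Y ^+ 2 * p ^+ 2 <= (1 + Y) ^+ 2 * p.
    apply: ler_pM; rewrite ?sqr_ge0//; first by rewrite lerXn2r ?nnegrE//; lra.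
    by rewrite expr2 ler_piMl.
  apply: le_trans h1 _; lra.
have eX : expR (- X) + expR (- Y) <= (1 + expR 1) * expR (- (Y / 4)).
  have h1 : expR (- X) <= expR 1 * expR (- (Y / 4)).
    by rewrite -expRD ler_expR; lra.
  have h2 : expR (- Y) <= expR (- (Y / 4)) by rewrite ler_expR; lra.
  by rewrite mulrDl mul1r addrC; exact: lerD.
have q0 : 0 <= v ^+ 2 + p by rewrite addr_ge0 ?sqr_ge0.
have e0 : 0 <= expR (- X) + expR (- Y) by rewrite addr_ge0// expR_ge0.
apply: le_trans (ler_wpM2r e0 D2) _.
have z0 : 0 <= 2 * K ^+ 2 * ((1 + Y) ^+ 2 * (v ^+ 2 + p)).
  by apply: mulr_ge0; apply: mulr_ge0 => //; exact: sqr_ge0.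
apply: le_trans (ler_wpM2l z0 eX) _.
have z1 : 0 <= 2 * K ^+ 2 * (1 + expR 1) * (v ^+ 2 + p).
  apply: mulr_ge0 => //; apply: mulr_ge0; last by rewrite addr_ge0 ?expR_ge0.
  by apply: mulr_ge0 => //; exact: sqr_ge0.
have := ler_wpM2l z1 (hC Y Y0); clear.
set x1 := expR 1; set x2 := expR _; set x3 := v ^+ 2 + p; set x4 := (1 + Y) ^+ 2.
set x5 := K ^+ 2.
have -> : 2 * x5 * (1 + x1) * x3 * C = 2 * x5 * (C * (1 + x1)) * x3 by ring.
apply: le_trans; rewrite le_eqVlt; apply/orP; left; apply/eqP; ring.
Qed.

(** X is the total hazard of the block I_k, kappa stands for k, t for ln s,
    and j for the number of integers of the block, which differs from its
    length s^2 k / (k + 1) by at most 1. The difference X - Y comes from j -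
    s^2 and from the second term (1 - 2 t) / L of the hazards; e^{-X} is
    expanded to first order around Y. *)
Lemma hit_term_expansion : exists2 C : R, 0 < C & forall L s (t kappa j X Y : R),
  8 <= L -> 1 <= s -> 0 <= t <= L / 2 -> 1 <= kappa -> 0 <= j ->
  `|j - s ^+ 2 * (kappa / (kappa + 1))| <= 1 ->
  `|X - j * (2 / L * (1 + (1 - 2 * t) / L))|
     <= j * (160 * ((1 + t) ^+ 2 / L ^+ 3 + kappa^-1 / L ^+ 2)) ->
  j / L <= X ->
  Y = 2 / L * s ^+ 2 ->
  `|1 - expR (- X) - ((1 - expR (- Y)) + expR (- Y) * (2 / L * (j - s ^+ 2))
     + Y * expR (- Y) * ((1 - 2 * t) / L))|
   <= C * ((1 + t) ^+ 2 / L ^+ 2 + kappa^-1).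
Proof.
have [c c0 hc] := second_order_bound 170.
exists (166 + c); first by lra.
move=> L s t kappa j X Y L8 s1 /andP[t0 tL] k1 j0 hj hX jX YE.
set u := L^-1 in YE hX jX *; set p := kappa^-1 in hX *.
have uL : L * u = 1 by rewrite mulfV// gt_eqF//; lra.
have up : 0 < u by rewrite invr_gt0; lra.
have u8 : u <= 1 / 8 by rewrite -[leRHS]invf_div divr1 lef_pV2 ?posrE//; lra.
have p0 : 0 < p by rewrite invr_gt0; lra.
have pk : kappa * p = 1 by rewrite mulfV// gt_eqF//; lra.
have p1 : p <= 1 by rewrite -[leRHS]invr1 lef_pV2 ?posrE//; lra.
have ss : 1 <= s ^+ 2 by rewrite expr2; nra.
have Y0 : 0 < Y by rewrite YE; nra.
set b := (1 - 2 * t) * u in hX *; set v := (1 + t) * u.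
have v0 : 0 < v by rewrite mulr_gt0//; lra.
have tu : t * u <= 1 / 2.
  have : t * u <= (L / 2) * u by rewrite ler_pM2r.
  by lra.
have v1 : v <= 1 by rewrite /v; lra.
have tu0 : 0 <= t * u by rewrite mulr_ge0// ltW.
have bv : `|b| <= 2 * v.
  rewrite /b /v ler_norml; apply/andP; split; lra.
have b2 : `|b| <= 2 by lra.
(* r is the ratio k / (k + 1) of the length of the block to s^2 *)
set r := kappa / (kappa + 1) in hj.
have r1 : 1 / 2 <= r by rewrite /r ler_pdivlMr; lra.
have r2 : 1 - r <= p.
  have -> : 1 - r = (kappa + 1)^-1 by rewrite /r; field; lra.
  by rewrite lef_pV2 ?posrE; lra.
have r3 : r <= 1 by rewrite /r ler_pdivrMr; lra.
have jle : j <= 2 * s ^+ 2 by move: hj; rewrite ler_norml; nra.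
have jge : s ^+ 2 / 2 - 1 <= j by move: hj; rewrite ler_norml; nra.
set d := j - s ^+ 2.
have ud : `|2 * u * d| <= 2 * u + Y * p.
  move: hj; rewrite !ler_norml YE /d => /andP[h1 h2].
  have h3 : 0 <= s ^+ 2 * (1 - r) <= s ^+ 2 * p by nra.
  by apply/andP; split; nra.
have uj : j * u <= Y by rewrite YE; nra.
have uj0 : 0 <= j * u by rewrite mulr_ge0// ltW.
set A := X - j * (2 * u * (1 + b)) in hX.
have HA : `|A| <= 160 * Y * (v ^+ 2 + p * u).
  apply: le_trans hX _.
  have -> : j * (160 * ((1 + t) ^+ 2 / L ^+ 3 + p / L ^+ 2)) = 160 * (j * u) * (v ^+ 2 + p * u).
    by rewrite -!exprVn -/u /v; ring.
  have : 0 <= v ^+ 2 + p * u by rewrite addr_ge0 ?sqr_ge0// mulr_ge0// ltW.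
  nra.
set D := X - Y.
have DE : D - 2 * u * d - Y * b = A + 2 * u * d * b.
  by rewrite /D /A /d YE; ring.
have eY0 := expR_gt0 (- Y).
have eY1 : expR (- Y) <= 1 by rewrite expR_le1; lra.
have YeY : Y * expR (- Y) <= 1.
  have := expR_ge1Dx Y; have := expRxMexpNx_1 Y.
  have := expR_gt0 Y; nra.
have pu : p * u <= p by nra.
have H1 : `|expR (- Y) * (D - 2 * u * d - Y * b)| <= 162 * (v ^+ 2 + p) + 4 * v ^+ 2.
  rewrite DE normrM (gtr0_norm eY0).
  have : `|A + 2 * u * d * b| <= 160 * Y * (v ^+ 2 + p) + (2 * u * (2 * v) + Y * p * 2).
    apply: le_trans (ler_normD _ _) _; apply: lerD.
      apply: le_trans HA _; rewrite ler_wpM2l//; lra.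
    rewrite normrM; apply: le_trans (ler_wpM2r _ ud) _ => //.
    rewrite mulrDl; apply: lerD; apply: ler_wpM2l => //; first lra.
    by rewrite mulr_ge0// ltW.
  move=> h; apply: le_trans (ler_wpM2l (ltW eY0) h) _.
  have uv : 2 * u * (2 * v) <= 4 * v ^+ 2.
    have : u <= v by rewrite /v; lra.
    nra.
  have v2 : 0 <= v ^+ 2 by exact: sqr_ge0.
  have -> : expR (- Y) * (160 * Y * (v ^+ 2 + p) + (2 * u * (2 * v) + Y * p * 2)) =
     (Y * expR (- Y)) * (160 * (v ^+ 2 + p) + 2 * p) + expR (- Y) * (2 * u * (2 * v)) by ring.
  have w0 : 0 <= 2 * u * (2 * v) by nra.
  have w1 : 0 <= 160 * (v ^+ 2 + p) + 2 * p by lra.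
  have := ler_wpM2r w1 YeY; have := ler_wpM2r w0 eY1.
  lra.
have HD : `|D| <= 170 * ((1 + Y) * v + Y * p).
  have -> : D = A + 2 * u * d * b + 2 * u * d + Y * b by move: DE; lra.
  have k1' : `|A| <= 160 * Y * (v + p).
    apply: le_trans HA _; rewrite ler_wpM2l//; first by lra.
    have : v ^+ 2 <= v by rewrite expr2; nra.
    lra.
  have k2 : `|2 * u * d * b| <= 2 * (2 * u + Y * p).
    by rewrite normrM mulrC; apply: ler_pM.
  have k3 : `|Y * b| <= Y * (2 * v) by rewrite normrM gtr0_norm// ler_pM2l.
  have uv : u <= v by rewrite /v; lra.
  apply: le_trans (ler_normD _ _) _.
  apply: le_trans (lerD (ler_normD _ _) (lexx _)) _.
  apply: le_trans (lerD (lerD (ler_normD _ _) (lexx _)) (lexx _)) _.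
  have : 0 <= Y * p by rewrite mulr_ge0// ltW.
  have : 0 <= Y * v by rewrite mulr_ge0// ltW.
  lra.
have H2 : D ^+ 2 * (expR (- X) + expR (- Y)) <= c * (v ^+ 2 + p).
  have p01 : 0 <= p <= 1 by rewrite p1 andbT ltW.
  apply: hc (ltW Y0) (ltW v0) p01 _ HD.
  have -> : Y / 4 = s ^+ 2 / 2 * u by rewrite YE; field.
  have h1 : (s ^+ 2 / 2 - 1) * u <= j * u by rewrite ler_pM2r.
  by move: jX h1; clear -u8; move: (j * u) (s ^+ 2 / 2) => a e; lra.
have H3 := expR_taylor2 X Y; rewrite -/D in H3.
have -> : (1 + t) ^+ 2 / L ^+ 2 = v ^+ 2 by rewrite -!exprVn -/u /v; ring.
set Z := expR (- X) - expR (- Y) * (1 - D) in H3.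
have -> : 1 - expR (- X) - (1 - expR (- Y) + expR (- Y) * (2 * u * (j - s ^+ 2)) + Y * expR (- Y) * b)
  = expR (- Y) * (D - 2 * u * d - Y * b) - Z by rewrite /Z /d /D; ring.
apply: le_trans (ler_normB _ _) _.
apply: le_trans (lerD H1 (le_trans H3 H2)) _.
have v2 : 0 <= v ^+ 2 by exact: sqr_ge0.
by rewrite (mulrDl 166 c) lerD2r; move: v2 p0; clear; move: (v ^+ 2) (p) => a e; lra.
Qed.

End HitTermExpansion.

Section HitProbability.
Context {R : realType}.
Implicit Types (n k l m : nat).

Definition member_prob l : R := if (3 <= l)%N then (ln l%:R)^-1 else 0.

(** The numbers l + 1 in the product are the integers of the interval I_k,
    from floor (n / (k + 1)) + 1 to floor (n / k). *)
Definition hit_prob n k : R :=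
  1 - \prod_(n %/ k.+1 <= l < n %/ k) (1 - member_prob l.+1).

Definition block_size n k : R := (n %/ k)%:R - (n %/ k.+1)%:R.

Lemma divn_floor n k : (0 < k)%N ->
  (n%:R / k%:R - 1 : R) < (n %/ k)%:R <= (n%:R / k%:R : R).
Proof.
move=> k0; have kp : 0 < k%:R :> R by rewrite ltr0n.
rewrite ler_pdivlMr// -natrM ler_nat leq_divM andbT.
rewrite ltrBlDr ltr_pdivrMr// natr1 -natrM ltr_nat.
by rewrite {1}(divn_eq n k) mulSn addnC ltn_add2r ltn_pmod.
Qed.

Lemma ler_norm_sum_nat (a b : nat) (f : nat -> R) (K B : R) : (a <= b)%N ->
  (forall l, (a <= l < b)%N -> `|f l - K| <= B) ->
  `|\sum_(a <= l < b) f l - (b%:R - a%:R) * K| <= (b%:R - a%:R) * B.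
Proof.
move=> ab h.
have c (x : R) : (b%:R - a%:R) * x = \sum_(a <= l < b) x.
  by rewrite sumr_const_nat -natrB// mulr_natl.
rewrite !c -sumrB; apply: le_trans (ler_norm_sum _ _ _) _.
by apply: ler_sum_nat => l hl; exact: h.
Qed.

Lemma ln_nat_sqrt n : (0 < n)%N -> ln (Num.sqrt (n%:R : R)) = ln n%:R / 2.
Proof.
move=> n0; have np : 0 < n%:R :> R by rewrite ltr0n.
have := @lnXn R 2 (Num.sqrt n%:R); rewrite sqr_sqrtr ?ltW// sqrtr_gt0 => /(_ np) ->.
by rewrite -mulr_natl; field.
Qed.

(** The endpoints of I_k have ratio (k + 1) / k, so ln l varies by at most 1 /
    k on it, and ln (n / k) = L / 2 + ln (sqrt n / k). *)
Lemma block_log n k l : (0 < k)%N -> 8 <= ln n%:R :> R ->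
  k%:R <= Num.sqrt (n%:R : R) -> (n %/ k.+1 <= l < n %/ k)%N ->
  [/\ (3 <= l.+1)%N,
    (0 : R) <= ln (n%:R : R) / 2 + ln (Num.sqrt n%:R / k%:R) - ln l.+1%:R <= (k%:R^-1 : R) &
    ln l.+1%:R <= ln n%:R :> R].
Proof.
move=> k0 L8 km /andP[hl1 hl2].
have n0 : (0 < n)%N by case: n L8 {km hl1 hl2} => // ; rewrite ln0//; lra.
have np : 0 < n%:R :> R by rewrite ltr0n.
have kp : 0 < k%:R :> R by rewrite ltr0n.
have k1p : 0 < k.+1%:R :> R by rewrite ltr0n.
have rp : 0 < Num.sqrt (n%:R : R) by rewrite sqrtr_gt0.
have rr : Num.sqrt (n%:R : R) ^+ 2 = n%:R by rewrite sqr_sqrtr// ltW.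
have r5 : 5 <= Num.sqrt (n%:R : R).
  rewrite -[leRHS]lnK ?posrE// ln_nat_sqrt//.
  by have := expR_ge1Dx (ln (n%:R : R) / 2); lra.
have /andP[f1 f2] := divn_floor n k0.
have /andP[g1 g2] := divn_floor n (ltn0Sn k).
have lp : 0 < l.+1%:R :> R by rewrite ltr0n.
have x1 : l.+1%:R <= n%:R / k%:R :> R.
  by apply: le_trans f2; rewrite ler_nat.
have x2 : n%:R / k.+1%:R <= l.+1%:R :> R.
  have : (n %/ k.+1)%:R + 1 <= l.+1%:R :> R by rewrite natr1 ler_nat.
  by apply: le_trans; rewrite -lerBlDr ltW.
have x3 : 5 / 2 <= l.+1%:R :> R.
  apply: le_trans x2; rewrite ler_pdivlMr// -natr1 -rr expr2; nra.
split.
- by rewrite ltnNge; apply/negP => h; move: x3; rewrite leNgt => /negP; apply;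
    apply: (@le_lt_trans _ _ 2%:R); [rewrite ler_nat|lra].
- have -> : ln n%:R / 2 + ln (Num.sqrt n%:R / k%:R) = ln (n%:R / k%:R) :> R.
    rewrite -ln_nat_sqrt// -lnM ?posrE ?divr_gt0//; congr ln.
    by rewrite mulrA -expr2 rr.
  rewrite -ln_div ?posrE ?divr_gt0//; apply/andP; split.
    by apply: ln_ge0; rewrite ler_pdivlMr// mul1r.
  apply: (@le_trans _ _ (ln (1 + k%:R^-1))); last first.
    have pk : 0 < k%:R^-1 :> R by rewrite invr_gt0.
    by apply: le_ln1Dx; lra.
  rewrite ler_ln ?posrE ?divr_gt0 ?addr_gt0 ?invr_gt0//.
  rewrite ler_pdivrMr//; apply: le_trans (ler_wpM2l _ x2); last first.
    by rewrite addr_ge0 ?invr_ge0 ?ltW.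
  have -> : (1 + k%:R^-1) * (n%:R / k.+1%:R) = n%:R / k%:R :> R.
    by rewrite -[k.+1%:R]natr1; field; rewrite ?natr1 ?gt_eqF.
  by [].
- rewrite ler_ln ?posrE//; apply: le_trans x1 _.
  by rewrite ler_pdivrMr// ler_peMr ?ler1n// ltW.
Qed.

(** The total hazard of a block is the sum of the hazards of its integers,
    each of which obeys [hazard_expansion]. *)
Lemma hit_prob_expansion : exists2 C : R, 0 < C & forall n k,
  8 <= ln n%:R :> R -> (0 < k)%N -> k%:R <= Num.sqrt (n%:R : R) ->
  let s := Num.sqrt n%:R / k%:R in
  forall Y : R, Y = 2 / ln n%:R * s ^+ 2 ->
  `|hit_prob n k - ((1 - expR (- Y)) +
      expR (- Y) * (2 / ln n%:R * (block_size n k - s ^+ 2)) +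
      Y * expR (- Y) * ((1 - 2 * ln s) / ln n%:R))|
   <= C * ((1 + ln s) ^+ 2 / ln n%:R ^+ 2 + k%:R^-1).
Proof.
have [C C0 hC] := @hit_term_expansion R.
exists C => // n k L8 k0 km s Y YE.
have n0 : (0 < n)%N by case: n L8 {km s YE} => // ; rewrite ln0//; lra.
have np : 0 < n%:R :> R by rewrite ltr0n.
have kp : 0 < k%:R :> R by rewrite ltr0n.
have k1 : 1 <= k%:R :> R by rewrite ler1n.
have rp : 0 < Num.sqrt (n%:R : R) by rewrite sqrtr_gt0.
have rr : Num.sqrt (n%:R : R) ^+ 2 = n%:R by rewrite sqr_sqrtr// ltW.
set L := ln n%:R in L8 YE *.
have s1 : 1 <= s by rewrite /s ler_pdivlMr// mul1r.
have t0 : 0 <= ln s by exact: ln_ge0.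
have tL : ln s <= L / 2.
  rewrite -ln_nat_sqrt// ler_ln ?posrE ?divr_gt0//.
  by rewrite /s ler_pdivrMr// ler_peMr// ltW.
pose hz l : R := - ln (1 - (ln l.+1%:R)^-1).
pose X := \sum_(n %/ k.+1 <= l < n %/ k) hz l.
have ab : (n %/ k.+1 <= n %/ k)%N by apply: leq_div2l.
have lnl l : (n %/ k.+1 <= l < n %/ k)%N -> 3 <= ln l.+1%:R :> R.
  move=> hl; have [_ /andP[_ h] _] := block_log k0 L8 km hl.
  have : k%:R^-1 <= 1 :> R by rewrite invf_le1.
  by rewrite -/L -/s in h; lra.
have -> : hit_prob n k = 1 - expR (- X).
  rewrite /hit_prob /X -sumrN expR_sum; congr (1 - _).
  apply: eq_big_nat => l hl.
  have [l3 _ _] := block_log k0 L8 km hl.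
  have h := lnl l hl.
  rewrite /member_prob l3 /hz opprK lnK// posrE subr_gt0 invf_lt1; lra.
apply: (hC L s (ln s) k%:R (block_size n k) X Y) => //.
- by rewrite t0 tL.
- by rewrite subr_ge0 ler_nat.
- have -> : s ^+ 2 * (k%:R / (k%:R + 1)) = n%:R / k%:R - n%:R / k.+1%:R.
    rewrite /s exprMn rr -[k.+1%:R]natr1; field.
    by rewrite natr1 !gt_eqF ?ltr0n.
  have /andP[f1 f2] := divn_floor n k0.
  have /andP[g1 g2] := divn_floor n (ltn0Sn k).
  move: f1 f2 g1 g2; rewrite /block_size; clear.
  move: (n%:R / k%:R) (n%:R / k.+1%:R) (n %/ k)%:R (n %/ k.+1)%:R => a b c d *.
  by rewrite ler_norml; apply/andP; split; lra.
- apply: ler_norm_sum_nat => // l hl.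
  have [l3 h hL] := block_log k0 L8 km hl.
  have := @hazard_expansion R L (ln s) (L / 2 + ln s - ln l.+1%:R) L8.
  rewrite t0 tL => /(_ isT).
  have pk : k%:R^-1 <= 1 :> R by rewrite invf_le1.
  rewrite -/L -/s in h; case/andP: h => h1 h2.
  have -> : 0 <= L / 2 + ln s - ln l.+1%:R <= 1 by apply/andP; split; lra.
  rewrite subKr => /(_ isT) h; apply: le_trans h _.
  rewrite ler_pM2l// lerD2l ler_pM2r// invr_gt0 exprn_gt0//; lra.
- have -> : block_size n k / L = \sum_(n %/ k.+1 <= l < n %/ k) L^-1.
    by rewrite sumr_const_nat /block_size -natrB// mulr_natl.
  apply: ler_sum_nat => l hl.
  have [_ _] := block_log k0 L8 km hl; rewrite -/L => hL.
  have l3 := lnl l hl.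
  apply: (@le_trans _ _ (ln l.+1%:R)^-1); first by rewrite lef_pV2 ?posrE//; lra.
  rewrite /hz lerNr; apply: le_ln1Dx.
  by rewrite ltrN2 invf_lt1; lra.
Qed.

End HitProbability.

(** * Blocks beyond the square root *)

Section Sums.
Context {R : realType}.
Implicit Types (n k l m y : nat).

(** Summation by parts: increasing weights turn the increments of a bounded
    sequence into a sum bounded independently of m. *)
Lemma abel_bound (w f : nat -> R) m : (0 < m)%N ->
  (forall k, (0 < k)%N -> 0 <= w k <= 1) ->
  (forall k, (0 < k)%N -> w k <= w k.+1) ->
  (forall k, (0 < k)%N -> 0 <= f k <= 1) ->
  `|\sum_(1 <= k < m.+1) w k * (f k.+1 - f k)| <= 1.
Proof.
move=> m0 w01 wS f01.
suff : w m * (f m.+1 - 1) <= \sum_(1 <= k < m.+1) w k * (f k.+1 - f k) <= w m * f m.+1.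
  have /andP[a b] := w01 m m0; have /andP[c d] := f01 m.+1 isT.
  by move=> /andP[h1 h2]; rewrite ler_norml; apply/andP; split; nra.
elim: m m0 => // -[|m] IH _.
  rewrite big_nat1; have /andP[a b] := w01 1%N isT.
  have /andP[c d] := f01 1%N isT; apply/andP; split; nra.
have /andP[h1 h2] := IH isT; rewrite big_nat_recr//=.
have := wS m.+1 isT; have /andP[c d] := f01 m.+2 isT.
by move=> h3; apply/andP; split; nra.
Qed.

Lemma sum_inv_sqrt m :
  \sum_(0 <= k < m) (Num.sqrt k.+1%:R)^-1 <= 2 * Num.sqrt m%:R :> R.
Proof.
elim: m => [|m IH]; first by rewrite big_nil sqrtr0 mulr0.
rewrite big_nat_recr//=; apply: le_trans (lerD IH (lexx _)) _.
have a0 := sqrtr_ge0 (m%:R : R).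
have b0 : 0 < Num.sqrt m.+1%:R :> R by rewrite sqrtr_gt0.
have aa : Num.sqrt m%:R ^+ 2 = m%:R :> R by rewrite sqr_sqrtr.
have bb : Num.sqrt m.+1%:R ^+ 2 = m%:R + 1 :> R by rewrite sqr_sqrtr// natr1.
rewrite -(ler_pM2r b0) mulrDl mulVf ?gt_eqF//.
move: a0 b0 aa bb; move: (Num.sqrt m%:R : R) (Num.sqrt m.+1%:R : R) (m%:R : R) => a b c.
move=> a0 b0 aa bb; have := sqr_ge0 (a - b); rewrite !expr2 in aa bb *; nra.
Qed.

Lemma sum_inv m : (0 < m)%N ->
  \sum_(1 <= k < m.+1) k%:R^-1 <= 1 + ln m%:R :> R.
Proof.
elim: m => // -[|m] IH _; first by rewrite big_nat1 ln1; lra.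
rewrite big_nat_recr//=; apply: le_trans (lerD (IH isT) (lexx _)) _.
have := @ln_le_sub1 R (m.+1%:R / m.+2%:R) (divr_gt0 (ltr0Sn R _) (ltr0Sn R _)).
rewrite ln_div ?posrE//.
have -> : m.+1%:R / m.+2%:R - 1 = - m.+2%:R^-1 :> R.
  by rewrite -[m.+2%:R]natr1; field; have := ler0n R m; lra.
by move: (ln m.+1%:R) (ln m.+2%:R) (m.+2%:R^-1) => a b c; lra.
Qed.

Lemma hit_prob_single n k : (n %/ k <= (n %/ k.+1).+1)%N ->
  hit_prob n k = \sum_(n %/ k.+1 <= l < n %/ k) member_prob l.+1 :> R.
Proof.
rewrite leq_eqVlt /hit_prob => /orP[/eqP->|h].
  by rewrite !big_nat1 subKr.
by rewrite !big_geq// subrr.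
Qed.

Lemma sum_blocks (g : nat -> R) n m N : (m <= N)%N ->
  \sum_(m.+1 <= k < N.+1) \sum_(n %/ k.+1 <= l < n %/ k) g l =
  \sum_(n %/ N.+1 <= l < n %/ m.+1) g l.
Proof.
elim: N => [|N IH].
  by rewrite leqn0 => /eqP->; rewrite !big_geq.
rewrite leq_eqVlt => /orP[/eqP->|mN]; first by rewrite !big_geq.
rewrite big_nat_recr//= IH//.
rewrite addrC -big_cat_nat//=; first exact: leq_div2l.
by apply: leq_div2l.
Qed.

(** For k > sqrt n the interval I_k is shorter than 1, so a hit is the
    membership of its only integer, if there is one; and the intervals tile
    the integers up to n / (m + 1). *)
Lemma hit_prob_tail n m : (m <= n)%N -> Num.sqrt (n%:R : R) < m.+1%:R ->
  \sum_(m.+1 <= k < n.+1) hit_prob n k =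
  \sum_(0 <= l < n %/ m.+1) member_prob l.+1 :> R.
Proof.
move=> mn hm.
have -> : \sum_(0 <= l < n %/ m.+1) member_prob l.+1 =
    \sum_(n %/ n.+1 <= l < n %/ m.+1) member_prob l.+1 :> R.
  by rewrite [(n %/ n.+1)%N]divn_small.
rewrite -sum_blocks//; apply: eq_big_nat => k /andP[mk kn].
apply: hit_prob_single.
have k0 : (0 < k)%N by apply: leq_trans mk.
have kp : 0 < k%:R :> R by rewrite ltr0n.
have kn2 : n%:R < k%:R * k%:R :> R.
  rewrite -(@sqr_sqrtr R n%:R)// expr2.
  have h : Num.sqrt (n%:R : R) < k%:R by apply: lt_le_trans hm _; rewrite ler_nat.
  by apply: ltr_pM; rewrite ?sqrtr_ge0.
have /andP[_ f2] := @divn_floor R n k k0.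
have /andP[g1 _] := @divn_floor R n k.+1 isT.
have h : n%:R / k%:R - n%:R / k.+1%:R < 1 :> R.
  have -> : n%:R / k%:R - n%:R / k.+1%:R = n%:R / (k%:R * k.+1%:R) :> R.
    by rewrite -[k.+1%:R]natr1; field; rewrite natr1 !gt_eqF// ltr0n.
  rewrite ltr_pdivrMr ?mulr_gt0// mul1r; apply: lt_le_trans kn2 _.
  by rewrite ler_pM2l// ler_nat.
rewrite -ltnS -(@ltr_nat R) -[X in _ < X]natr1 -[X in _ < X + _]natr1.
move: f2 g1 h; move: (n%:R / k%:R) (n%:R / k.+1%:R) (n %/ k)%:R (n %/ k.+1)%:R => a b c d; lra.
Qed.

(** With t = ln (sqrt n / l), the difference is of order t / L^2 as long as t
    <= L / 4. The factor e^{t/2} dominates t; for t > L / 4 it exceeds a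
    multiple of L^2, which covers the small l as well; and it is summable over
    l. *)
Lemma member_prob_gap n l : 8 <= ln (n%:R : R) ->
  l.+1%:R <= Num.sqrt (n%:R : R) ->
  `|member_prob l.+1 - 2 / ln (n%:R : R)|
    <= 192 / ln n%:R ^+ 2 * (Num.sqrt (Num.sqrt n%:R) / Num.sqrt l.+1%:R).
Proof.
move=> L8 ln'.
have n0 : (0 < n)%N by case: n L8 {ln'} => // ; rewrite ln0//; lra.
have np : 0 < n%:R :> R by rewrite ltr0n.
have rp : 0 < Num.sqrt (n%:R : R) by rewrite sqrtr_gt0.
have xp : 0 < l.+1%:R :> R by rewrite ltr0n.
set L := ln (n%:R : R) in L8 *.
have rE : Num.sqrt (n%:R : R) = expR (L / 2) by rewrite -ln_nat_sqrt// lnK ?posrE.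
set x : R := l.+1%:R in ln' xp *.
have sE : Num.sqrt (Num.sqrt (n%:R : R)) / Num.sqrt x = expR ((L / 2 - ln x) / 2).
  have h (z : R) : Num.sqrt (expR z) = expR (z / 2).
    by rewrite [in LHS](_ : z = z / 2 + z / 2) ?expRD -?expr2 ?sqrtr_sqr ?gtr0_norm ?expR_gt0//; field.
  rewrite rE h -{1}[x]lnK; last by rewrite posrE.
  by rewrite h -expRB; congr expR; field.
rewrite sE; set t := L / 2 - ln x.
have t0 : 0 <= t by rewrite /t -ln_nat_sqrt// subr_ge0 ler_ln ?posrE.
have L2 : 0 < L ^+ 2 by rewrite exprn_gt0//; lra.
have big : t >= L / 4 -> 3 / 2 <= 192 / L ^+ 2 * expR (t / 2).
  move=> tL; rewrite mulrAC ler_pdivlMr//.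
  have h : expR (L / 8) <= expR (t / 2) by rewrite ler_expR; lra.
  have L80 : 0 <= L / 8 by lra.
  have := @expR_ge_pow R (L / 8) 2 L80; rewrite (_ : 2`! = 2)%N// exprMn.
  by move: h; rewrite !expr2; lra.
rewrite /member_prob; case: ifPn => l3.
- have x3 : 3 <= x by rewrite /x (ler_nat _ 3).
  have a0 : 2 / 3 <= ln x.
    have := @ln_le_sub1 R (x^-1); rewrite invr_gt0 lnV ?posrE// => /(_ xp) h.
    have : x^-1 <= 3^-1 by rewrite lef_pV2 ?posrE//; lra.
    by move: h; clear; move: (x^-1) (ln x) => a b; lra.
  have aL : ln x = L / 2 - t by rewrite /t; ring.
  rewrite -/x; set a := ln x in a0 aL *.
  have E : a^-1 - 2 / L = 2 * t / (a * L) by rewrite (_ : t = L / 2 - a); [field; lra|rewrite aL; ring].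
  have d0 : 0 < a * L by rewrite mulr_gt0; lra.
  rewrite E ger0_norm; last by apply: divr_ge0; [lra|exact: ltW].
  have [tL|tL] := leP t (L / 4).
  + have tt : t <= 2 * expR (t / 2) by have := expR_ge1Dx (t / 2); lra.
    have d1 : L ^+ 2 / 4 <= a * L by rewrite expr2; nra.
    rewrite ler_pdivrMr//.
    have e0 := expR_gt0 (t / 2).
    have -> : 192 / L ^+ 2 * expR (t / 2) * (a * L) = 192 * expR (t / 2) * (a * L / L ^+ 2) by ring.
    have : 1 / 4 <= a * L / L ^+ 2 by rewrite ler_pdivlMr//; lra.
    nra.
  + apply: le_trans (big (ltW tL)); rewrite -E.
    have : a^-1 <= (2 / 3)^-1 by rewrite lef_pV2 ?posrE//; lra.
    rewrite invf_div.
    have : 0 <= 2 / L by apply: divr_ge0; lra.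
    lra.
- have x2 : x <= 2 by rewrite /x (ler_nat _ _ 2); move: l3; rewrite -ltnNge.
  have lx : ln x <= 1.
    by have := ln_le_sub1 xp; lra.
  apply: le_trans (big _); last by rewrite /t; lra.
  rewrite sub0r normrN ger0_norm ?divr_ge0 ?ler_pdivrMr; lra.
Qed.

Lemma member_prob_sum : exists2 C : R, 0 < C & forall n y, 8 <= ln (n%:R : R) ->
  y%:R <= Num.sqrt (n%:R : R) <= y%:R + 2 ->
  `|\sum_(0 <= l < y) member_prob l.+1 - 2 / ln n%:R * Num.sqrt (n%:R : R)|
    <= C * (Num.sqrt n%:R / ln n%:R ^+ 2).
Proof.
exists (192 * 2 + 8); first lra.
move=> n y L8 /andP[y1 y2].
have n0 : (0 < n)%N by case: n L8 {y1 y2} => // ; rewrite ln0//; lra.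
have np : 0 < n%:R :> R by rewrite ltr0n.
have rE : Num.sqrt (n%:R : R) = expR (ln n%:R / 2) by rewrite -ln_nat_sqrt// lnK ?posrE// sqrtr_gt0.
set L := ln (n%:R : R) in L8 rE *; set r := Num.sqrt n%:R in y1 y2 rE *.
have r0 : 0 < r by rewrite rE expR_gt0.
have h := @ler_norm_sum_nat.
have c : y%:R * (2 / L) = \sum_(0 <= l < y) 2 / L by rewrite sumr_const_nat subn0 mulr_natl.
have H : `|\sum_(0 <= l < y) member_prob l.+1 - y%:R * (2 / L)| <= 192 / L ^+ 2 * (2 * r).
  rewrite c -sumrB; apply: le_trans (ler_norm_sum _ _ _) _.
  apply: (@le_trans _ _ (\sum_(0 <= l < y) 192 / L ^+ 2 * (Num.sqrt r / Num.sqrt l.+1%:R))).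
    apply: ler_sum_nat => l /andP[_ ly]; apply: member_prob_gap => //.
    by apply: le_trans y1; rewrite ler_nat.
  rewrite -mulr_sumr ler_pM2l; last by rewrite divr_gt0 ?exprn_gt0//; lra.
  rewrite -mulr_sumr.
  apply: (@le_trans _ _ (Num.sqrt r * (2 * Num.sqrt y%:R))).
    by apply: ler_wpM2l; [exact: sqrtr_ge0|exact: sum_inv_sqrt].
  rewrite mulrCA ler_pM2l//.
  rewrite -[leRHS](sqr_sqrtr (ltW r0)) expr2 ler_pM2l ?sqrtr_gt0//.
  exact: ler_wsqrtr.
have H2 : `|y%:R * (2 / L) - 2 / L * r| <= 4 / L.
  have -> : y%:R * (2 / L) - 2 / L * r = - (2 / L * (r - y%:R)) by ring.
  have l0 : 0 < 2 / L by apply: divr_gt0; lra.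
  rewrite normrN ger0_norm; last by rewrite mulr_ge0; lra.
  have -> : 4 / L = 2 / L * 2 by field; lra.
  by rewrite ler_pM2l//; lra.
have H3 : 4 / L <= 8 * (r / L ^+ 2).
  have -> : 4 / L = 8 * ((L / 2) / L ^+ 2) by field; lra.
  rewrite ler_pM2l// ler_pM2r ?invr_gt0 ?exprn_gt0//; try lra.
  by rewrite rE; have := expR_ge1Dx (L / 2); lra.
have -> : \sum_(0 <= l < y) member_prob l.+1 - 2 / L * r =
  (\sum_(0 <= l < y) member_prob l.+1 - y%:R * (2 / L)) + (y%:R * (2 / L) - 2 / L * r) by ring.
apply: le_trans (ler_normD _ _) _.
have -> : (192 * 2 + 8) * (r / L ^+ 2) = 192 / L ^+ 2 * (2 * r) + 8 * (r / L ^+ 2) by ring.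
by apply: lerD => //; apply: le_trans H3.
Qed.

End Sums.

(** * The expected number of hits *)

Section MeanAsymptotics.
Context {R : realType}.
Implicit Types (n k m : nat) (L r w : R).

Definition expected_hits n : R := \sum_(1 <= k < n.+1) hit_prob n k.

Lemma sum_one_add_ln_sqr r m : m%:R <= r ->
  \sum_(1 <= k < m.+1) (1 + ln (r / k%:R)) ^+ 2 <= 50 * r.
Proof.
move=> mr; have r0 : 0 <= r by apply: le_trans mr; exact: ler0n.
apply: (@le_trans _ _ (\sum_(1 <= k < m.+1) 25 * Num.sqrt r * (Num.sqrt k%:R)^-1)).
  apply: ler_sum_nat => k /andP[k0 km].
  have kp : 0 < k%:R :> R by rewrite ltr0n.
  have h : 1 <= r / k%:R.
    by rewrite ler_pdivlMr// mul1r; apply: le_trans mr; rewrite ler_nat.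
  apply: le_trans (one_add_ln_sqr_le h) _.
  by rewrite sqrtrM// sqrtrV ?mulrA// ltW.
rewrite -mulr_sumr big_add1/=.
apply: le_trans (ler_wpM2l _ (sum_inv_sqrt m)) _; first by rewrite mulr_ge0 ?sqrtr_ge0.
have h : Num.sqrt m%:R <= Num.sqrt r by exact: ler_wsqrtr.
have := sqrtr_ge0 r; have := sqr_sqrtr r0; rewrite expr2.
move: h; move: (Num.sqrt m%:R : R) (Num.sqrt r) => a b h1 h2 h3; nra.
Qed.

Lemma nat_of_ln_gt0 n : 0 < ln (n%:R : R) -> (0 < n)%N.
Proof. by case: n => //; rewrite ln0// ltxx. Qed.

Lemma mul_expN_le1 (Y : R) : 0 <= Y -> Y * expR (- Y) <= 1.
Proof.
move=> Y0; have h1 := expR_ge1Dx Y; have h2 := expRxMexpNx_1 Y.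
have h3 := expR_gt0 (- Y); nra.
Qed.

(** The number of integers of I_k is the length of I_k plus an increment of
    the fractional part of n / k. These increments contribute O(1 / L) by
    [abel_bound], since e^{-Y} increases with k. Replacing the length by s^2
    costs Y e^{-Y} / (k + 1), hence a logarithm in total. *)
Lemma small_blocks_sum : exists2 C : R, 0 < C & forall n m, 8 <= ln (n%:R : R) ->
  (0 < m)%N -> m%:R <= Num.sqrt (n%:R : R) ->
  let L := ln (n%:R : R) in let r := Num.sqrt (n%:R : R) in
  forall w, w = Num.sqrt (2 / L) * r ->
  `|\sum_(1 <= k < m.+1) hit_prob n k -
     (\sum_(1 <= k < m.+1) (1 - expR (- (w / k%:R) ^+ 2)) +
      ((1 + ln (2 / L)) * \sum_(1 <= k < m.+1) ((w / k%:R) ^+ 2 * expR (- (w / k%:R) ^+ 2)) -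
       \sum_(1 <= k < m.+1) ((w / k%:R) ^+ 2 * ln ((w / k%:R) ^+ 2) * expR (- (w / k%:R) ^+ 2))) / L)|
   <= C * (r / L ^+ 2 + L).
Proof.
have [C C0 hC] := @hit_prob_expansion R.
exists (50 * C + 2 * C + 3); first lra.
move=> n m L8 m0 mr L r w wE; have n0 : (0 < n)%N by exact: nat_of_ln_gt0 (lt_le_trans _ L8).
rewrite -/L in L8; rewrite -/r in mr.
have np : 0 < n%:R :> R by rewrite ltr0n.
have rp : 0 < r by rewrite sqrtr_gt0.
have rr : r ^+ 2 = n%:R by rewrite sqr_sqrtr// ltW.
have L0 : 0 < L by lra.
have l0 : 0 < 2 / L by rewrite divr_gt0.
have mL : ln m%:R <= L.
  have m1 : 1 <= m%:R :> R by rewrite ler1n.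
  rewrite ler_ln ?posrE//; last lra.
  have r1 : 1 <= r by exact: le_trans mr.
  by apply: (le_trans mr); rewrite -rr expr2; apply: ler_peMl => //; exact: ltW.
pose s k := r / k%:R : R; pose Y k := (w / k%:R) ^+ 2 : R.
have YE k : (0 < k)%N -> Y k = 2 / L * s k ^+ 2.
  have ll : Num.sqrt (2 / L) ^+ 2 = 2 / L by rewrite sqr_sqrtr// ltW.
  by move=> k0; rewrite /Y /s wE -[in RHS]ll; ring.
have Y0 k : 0 <= Y k by exact: sqr_ge0.
pose T1 k := 1 - expR (- Y k); pose T2 k := expR (- Y k) * (2 / L * (block_size n k - s k ^+ 2)).
pose T3 k := Y k * expR (- Y k) * ((1 - 2 * ln (s k)) / L).
have e3 : ((1 + ln (2 / L)) * \sum_(1 <= k < m.+1) (Y k * expR (- Y k)) -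
    \sum_(1 <= k < m.+1) (Y k * ln (Y k) * expR (- Y k))) / L = \sum_(1 <= k < m.+1) T3 k.
  rewrite mulr_sumr -sumrB mulr_suml; apply: eq_big_nat => k /andP[k0 km].
  have sp : 0 < s k by rewrite divr_gt0// ltr0n.
  have -> : ln (Y k) = ln (2 / L) + 2 * ln (s k).
    by rewrite YE// lnM ?posrE ?exprn_gt0// lnXn// -[ln (s k) *+ 2]mulr_natl.
  by rewrite /T3; field; rewrite gt_eqF.
have inv1 : \sum_(1 <= k < m.+1) (k%:R^-1 : R) <= 1 + L by apply: le_trans (sum_inv m0) _; lra.
have h1 : `|\sum_(1 <= k < m.+1) hit_prob n k - \sum_(1 <= k < m.+1) (T1 k + T2 k + T3 k)| <=
    C * (50 * r / L ^+ 2 + (1 + L)).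
  rewrite -sumrB; apply: le_trans (ler_norm_sum _ _ _) _.
  apply: (@le_trans _ _ (\sum_(1 <= k < m.+1) C * ((1 + ln (s k)) ^+ 2 / L ^+ 2 + k%:R^-1))).
    apply: ler_sum_nat => k /andP[k0 km].
    apply: hC => //; last exact: YE.
    by apply: le_trans mr; rewrite ler_nat.
  rewrite -mulr_sumr ler_pM2l// big_split/=; apply: lerD => //.
  rewrite -mulr_suml ler_pM2r ?invr_gt0 ?exprn_gt0//.
  exact: sum_one_add_ln_sqr.
have h2 : `|\sum_(1 <= k < m.+1) T2 k| <= 1 + (1 + L).
  pose f k := n%:R / k%:R - (n %/ k)%:R : R.
  have e2 : \sum_(1 <= k < m.+1) T2 k = 2 / L * (\sum_(1 <= k < m.+1) expR (- Y k) * (f k.+1 - f k))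
      - \sum_(1 <= k < m.+1) (Y k * expR (- Y k) / k.+1%:R).
    rewrite mulr_sumr -sumrB; apply: eq_big_nat => k /andP[k0 km].
    rewrite /T2 /f /block_size; move: (expR (- Y k)) => E; rewrite YE//.
    rewrite /s exprMn rr -[k.+1%:R]natr1.
    have kp : 0 < k%:R :> R by rewrite ltr0n.
    have k1p : 0 < k%:R + 1 :> R by rewrite addr_gt0.
    by field; rewrite !gt_eqF.
  rewrite e2; apply: le_trans (ler_normB _ _) _; apply: lerD.
  - rewrite normrM gtr0_norm//.
    have h : `|\sum_(1 <= k < m.+1) expR (- Y k) * (f k.+1 - f k)| <= 1.
      apply: (@abel_bound R (fun k => expR (- Y k)) f) => // k k0.
      + by rewrite expR_ge0 expR_le1 oppr_le0 Y0.
      + have s0 i : 0 <= s i by apply: divr_ge0; [exact: ltW|exact: ler0n].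
        rewrite ler_expR lerN2 !YE// ler_pM2l//; apply: lerXn2r; rewrite ?nnegrE//.
        by rewrite /s ler_pM2l// lef_pV2 ?posrE ?ltr0n// ler_nat.
      + have /andP[a b] := @divn_floor R n k k0.
        by rewrite /f; apply/andP; split; lra.
    have : 2 / L <= 1 by rewrite ler_pdivrMr//; lra.
    have := normr_ge0 (\sum_(1 <= k < m.+1) expR (- Y k) * (f k.+1 - f k)).
    move: h; move: `|_| => a; nra.
  - rewrite ger0_norm; last first.
      by apply: sumr_ge0 => k _; rewrite divr_ge0// mulr_ge0 ?expR_ge0.
    apply: le_trans inv1; apply: ler_sum_nat => k /andP[k0 km].
    have kp : 0 < k%:R :> R by rewrite ltr0n.
    apply: (@le_trans _ _ k.+1%:R^-1); last by rewrite lef_pV2 ?posrE ?ltr0n// ler_nat.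
    by rewrite ler_piMl ?invr_ge0// mul_expN_le1.
rewrite -/L in e3 *.
rewrite (_ : \sum_(1 <= k < m.+1) (1 - expR (- (w / k%:R) ^+ 2)) = \sum_(1 <= k < m.+1) T1 k)//.
rewrite e3.
have -> : \sum_(1 <= k < m.+1) hit_prob n k - (\sum_(1 <= k < m.+1) T1 k + \sum_(1 <= k < m.+1) T3 k) =
  (\sum_(1 <= k < m.+1) hit_prob n k - \sum_(1 <= k < m.+1) (T1 k + T2 k + T3 k)) + \sum_(1 <= k < m.+1) T2 k.
  by rewrite !big_split/=; ring.
apply: le_trans (ler_normD _ _) _; apply: le_trans (lerD h1 h2) _.
have rl : 0 < r / L ^+ 2 by rewrite divr_gt0// exprn_gt0.
rewrite -[50 * r / _]mulrA; nra.
Qed.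

End MeanAsymptotics.

Section ExpectedHits.
Context {R : realType}.
Implicit Types (n k m : nat) (L r w : R).

(** With L = ln n and r = sqrt n, the main term of the expected number of
    hits. *)
Definition mean_main L r : R :=
  Num.sqrt (2 / L) * r * Num.sqrt pi *
    (1 + (1 + euler_gamma R + 3 * ln 2 - ln L) / (2 * L)).

Lemma ln2_bounds : 1 / 2 <= ln (2 : R) <= 1.
Proof.
have h1 := @ln_le_sub1 R 2 (ltr0Sn R 1).
have := @ln_le_sub1 R (2^-1); rewrite lnV ?posrE// invr_gt0 => /(_ (ltr0Sn R 1)) h2.
by apply/andP; split; lra.
Qed.

Lemma ln_ge1 L : 8 <= L -> 1 <= ln L.
Proof.
move=> L8; have /andP[l2 _] := ln2_bounds.
have h : ln (2 ^+ 3) <= ln L by rewrite ler_ln ?posrE ?exprn_gt0//; lra.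
by move: h; rewrite lnXn// -[ln 2 *+ 3]mulr_natl; lra.
Qed.

Lemma abs_one_add_ln L : 8 <= L -> `|1 + ln (2 / L)| <= 2 * ln L.
Proof.
move=> L8; have h := ln_ge1 L8; have /andP[l2 l2'] := ln2_bounds.
rewrite ln_div ?posrE//; last lra.
by rewrite ler_norml; apply/andP; split; lra.
Qed.

Lemma abs_ln_cutoff L (s : R) : 8 <= L ->
  Num.sqrt (2 / L) <= s <= 2 * Num.sqrt (2 / L) -> `|ln s| <= ln L.
Proof.
move=> L8; have h := ln_ge1 L8; have /andP[l2 l2'] := ln2_bounds.
have L0 : 0 < L by lra.
have l0 : 0 < 2 / L by rewrite divr_gt0.
set q := Num.sqrt (2 / L); move=> /andP[sq1 sq2].
have qq : q ^+ 2 = 2 / L by rewrite sqr_sqrtr// ltW.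
have q0 : 0 < q by rewrite sqrtr_gt0.
have s0 : 0 < s by exact: lt_le_trans sq1.
have lq : ln q = (ln 2 - ln L) / 2.
  have : ln (q ^+ 2) = ln 2 - ln L by rewrite qq ln_div ?posrE.
  by rewrite lnXn// -[ln q *+ 2]mulr_natl; lra.
have u1 : ln q <= ln s by rewrite ler_ln ?posrE.
have u2 : ln s <= ln (2 * q) by rewrite ler_ln ?posrE// mulr_gt0.
rewrite lnM ?posrE// lq in u2; rewrite lq in u1.
by rewrite ler_norml; apply/andP; split; lra.
Qed.

(** The points w / k of the Riemann sums stop at s = w / m, which is
    comparable with sqrt (2 / L) when m = floor r. These relations turn the
    errors of the Riemann sums into multiples of r / L^2 and L. *)
Lemma scale_facts L r (m : R) (q := Num.sqrt (2 / L)) (w := q * r) (s := w / m) :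
  8 <= L -> 5 <= r -> L ^+ 3 <= 48 * r -> m <= r < m + 1 ->
  [/\ 1 <= w, q <= s <= 2 * q, 0 < m / w <= L,
    0 <= w * s ^+ 3 <= 32 * (r / L ^+ 2) & 0 <= w * s <= 4 * (r / L) /\
    `|w ^+ 2 / m - 2 / L * r| <= 1].
Proof.
move=> L8 r5 L3r /andP[mr rm].
have L0 : 0 < L by lra.
have l0 : 0 < 2 / L by rewrite divr_gt0.
have rp : 0 < r by lra.
have mp : 0 < m by lra.
have qq : q ^+ 2 = 2 / L by rewrite sqr_sqrtr// ltW.
have q0 : 0 < q by rewrite sqrtr_gt0.
have w0 : 0 < w by rewrite mulr_gt0.
have qL : 1 <= q * L.
  have h : 1 <= (q * L) * (q * L).
    by rewrite -expr2 exprMn qq expr2 mulrA divfK ?gt_eqF//; lra.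
  have : 0 <= q * L by rewrite mulr_ge0// ltW.
  by move: h; clear; move: (q * L) => x h x0; nra.
have Lr : L <= r.
  have : L * 64 <= L ^+ 3 by rewrite !exprS expr0 mulr1 ler_pM2l//; clear -L8; nra.
  by move: L3r rp; clear; move: (L ^+ 3) => x; lra.
have w1 : 1 <= w.
  by apply: (le_trans qL); rewrite ler_pM2l.
have sq : q <= s <= 2 * q.
  rewrite /s /w ler_pdivlMr// ler_pdivrMr// ler_pM2l// mr /=.
  by rewrite mulrAC mulrC ler_pM2r//; lra.
have s0 : 0 < s by rewrite divr_gt0.
case/andP: (sq) => sq1 sq2.
split => //.
- rewrite divr_gt0//= ler_pdivrMr//; apply: (le_trans mr).
  by rewrite /w mulrA [L * q]mulrC ler_peMl// ltW.
- apply/andP; split; first by rewrite mulr_ge0 ?exprn_ge0// ltW.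
  have h : s ^+ 3 <= (2 * q) ^+ 3 by rewrite lerXn2r ?nnegrE// ltW// mulr_gt0.
  apply: le_trans (ler_wpM2l (ltW w0) h) _.
  have -> : w * (2 * q) ^+ 3 = 8 * r * (q ^+ 2) ^+ 2 by rewrite /w; ring.
  by rewrite qq le_eqVlt; apply/orP; left; apply/eqP; field; rewrite gt_eqF.
split.
- apply/andP; split; first by rewrite mulr_ge0// ltW.
  apply: le_trans (ler_wpM2l (ltW w0) sq2) _.
  have -> : w * (2 * q) = 2 * r * q ^+ 2 by rewrite /w; ring.
  by rewrite qq le_eqVlt; apply/orP; left; apply/eqP; field; rewrite gt_eqF.
- have -> : w ^+ 2 / m - 2 / L * r = 2 / L * (r * ((r - m) / m)).
    by rewrite /w exprMn qq; field; rewrite !gt_eqF.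
  have u0 : 0 <= (r - m) / m by apply: divr_ge0; [lra|exact: ltW].
  have u2 : r * ((r - m) / m) <= 2.
    rewrite mulrA ler_pdivrMr//; clear -rm mr r5.
    have : r * (r - m) <= r * 1 by rewrite ler_pM2l; lra.
    lra.
  rewrite ger0_norm; last by apply: mulr_ge0; [exact: ltW|apply: mulr_ge0 => //; exact: ltW].
  apply: le_trans (ler_wpM2l (ltW l0) u2) _.
  by rewrite mulrAC ler_pdivrMr//; lra.
Qed.

Lemma ler_norm_sum6 (x0 x1 x2 x3 x4 x5 a0 a1 a2 a3 a4 a5 : R) :
  `|x0| <= a0 -> `|x1| <= a1 -> `|x2| <= a2 -> `|x3| <= a3 -> `|x4| <= a4 ->
  `|x5| <= a5 ->
  `|x0 + x1 - x2 + x3 - x4 + x5| <= a0 + a1 + a2 + a3 + a4 + a5.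
Proof.
move=> h0 h1 h2 h3 h4 h5.
apply: le_trans (ler_normD _ _) _; apply: lerD h5.
apply: le_trans (ler_normB _ _) _; apply: lerD h4.
apply: le_trans (ler_normD _ _) _; apply: lerD h3.
apply: le_trans (ler_normB _ _) _; apply: lerD h2.
by apply: le_trans (ler_normD _ _) _; exact: lerD.
Qed.

(** Cut at m = floor (sqrt n). The blocks k <= m give the three Riemann sums,
    and the later ones a sum of 1 / ln l, about 2 sqrt n / L, which cancels
    the term w^2 / m of the first Riemann sum. *)
Lemma mean_asymptotics : exists2 C : R, 0 < C & forall n, 8 <= ln (n%:R : R) ->
  `|expected_hits n - mean_main (ln n%:R) (Num.sqrt n%:R)|
    <= C * (Num.sqrt n%:R * ln (ln n%:R) / ln n%:R ^+ 2).
Proof.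
have [C0 c0 h0] := @small_blocks_sum R.
have [C1 c1 h1] := @riemann_one_sub_gauss R.
have [C2 c2 h2] := @riemann_sqr_gauss R.
have [C3 c3 h3] := @riemann_sqr_log_gauss R.
have [C4 c4 h4] := @member_prob_sum R.
exists (C0 * 49 + C1 * 128 + 48 + C2 * 200 + C3 * 104 + C4); first by clear -c0 c1 c2 c3 c4; lra.
move=> n L8.
have n0 : (0 < n)%N by exact: nat_of_ln_gt0 (lt_le_trans _ L8).
move: {h0 h4} (h0 n) (h4 n).
set L := ln (n%:R : R) in L8 *; set r : R := Num.sqrt n%:R => /= h0 h4.
have np : 0 < n%:R :> R by rewrite ltr0n.
have rp : 0 < r by rewrite sqrtr_gt0.
have rr : r ^+ 2 = n%:R by rewrite sqr_sqrtr// ltW.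
have L0 : 0 < L by clear -L8; lra.
have rE : r = expR (L / 2) by rewrite -ln_nat_sqrt// lnK ?posrE.
have L3r : L ^+ 3 <= 48 * r.
  have L20 : 0 <= L / 2 by rewrite divr_ge0// ltW.
  have := @expR_ge_pow R (L / 2) 3 L20; rewrite -rE (_ : 3`! = 6)%N// exprMn.
  by clear; move: (L ^+ 3) r => z r'; rewrite !exprS !expr0; lra.
have r5 : 5 <= r by rewrite rE; have := expR_ge1Dx (L / 2); clear -L8; lra.
pose m := Num.truncn r.
have /andP[mr rm] : m%:R <= r < m.+1%:R by apply: truncn_itv; exact: ltW.
have rm1 : m%:R <= r < m%:R + 1 by rewrite natr1 mr.
have mp : 0 < m%:R :> R by clear -rm1 r5; lra.
have m0 : (0 < m)%N by rewrite -(@ltr_nat R).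
have mn : (m <= n)%N.
  rewrite -(@ler_nat R) -rr; apply: (le_trans mr).
  by rewrite expr2 ler_peMl// ?(ltW rp)//; clear -r5; lra.
have lnL1 := ln_ge1 L8.
have [w1 sq mw sw [sw1 b5]] := scale_facts L8 r5 L3r rm1.
have lns := abs_ln_cutoff L8 sq.
have lnl := abs_one_add_ln L8.
set q := Num.sqrt (2 / L) in w1 mw sw sw1 b5 lns *; set w := q * r in w1 mw sw sw1 b5 lns.
have wE : w = Num.sqrt (2 / L) * r by [].
set s := w / m%:R in sw sw1 lns.
set E := r * ln L / L ^+ 2.
have E1 : r / L ^+ 2 <= E.
  by rewrite /E ler_pM2r ?invr_gt0 ?exprn_gt0// ler_peMr// ltW.
have LE : L <= 48 * E.
  have : L <= 48 * (r / L ^+ 2) by rewrite mulrA ler_pdivlMr ?exprn_gt0// -exprS.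
  by clear -E1; lra.
have lnE : ln L <= 48 * E by apply: le_trans LE; exact: ltW (ln_sublinear L0).
have := h0 m L8 m0 mr w wE.
have := h1 w m w1 m0; have := h2 w m w1 m0; have := h3 w m w1 m0.
rewrite -/s.
set S := \sum_(1 <= k < m.+1) hit_prob n k.
set A := \sum_(1 <= k < m.+1) (1 - expR _).
set D := \sum_(1 <= k < m.+1) (_ * ln _ * _).
set B := \sum_(1 <= k < m.+1) (_ * expR _).
clearbody A B D => b3 b2 b1 b0.
have {b0} b0 : `|S - (A + ((1 + ln (2 / L)) * B - D) / L)| <= C0 * (49 * E).
  by apply: (le_trans b0); rewrite ler_pM2l//; clear -E1 LE; lra.
have {b1} b1 : `|A - (w * Num.sqrt pi - w ^+ 2 / m%:R)| <= C1 * (128 * E).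
  apply: (le_trans b1); rewrite ler_pM2l//.
  by move: mw sw; clear -E1 LE L8; move: (m%:R / w) (w * s ^+ 3) (r / L ^+ 2) E1 => a b c *; lra.
have {b5} b5 : `|w ^+ 2 / m%:R - 2 / L * r| <= 48 * E.
  by apply: (le_trans b5); clear -LE L8; lra.
have {b2} b2 : `|(1 + ln (2 / L)) * (B - w * (Num.sqrt pi / 2)) / L| <= C2 * (200 * E).
  have h : `|B - w * (Num.sqrt pi / 2)| <= C2 * (2 * L + 4 * (r / L)).
    apply: (le_trans b2); rewrite ler_pM2l//.
    by move: mw sw1; clear -L8; move: (m%:R / w) (w * s) (r / L) => a b c *; lra.
  rewrite normrM normrM (gtr0_norm (_ : 0 < L^-1)) ?invr_gt0// ler_pdivrMr//.
  apply: le_trans (ler_pM (normr_ge0 _) (normr_ge0 _) lnl h) _.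
  have -> : 2 * ln L * (C2 * (2 * L + 4 * (r / L))) = C2 * ((4 * ln L + 8 * E) * L).
    by rewrite /E; field; rewrite gt_eqF.
  have -> : C2 * (200 * E) * L = C2 * (200 * E * L) by ring.
  by rewrite ler_pM2l// ler_pM2r//; clear -lnE; lra.
have {b3} b3 : `|(D + w * (Num.sqrt pi / 2 * (euler_gamma R + 2 * ln 2))) / L| <= C3 * (104 * E).
  rewrite normrM (gtr0_norm (_ : 0 < L^-1)) ?invr_gt0// ler_pdivrMr//.
  apply: (le_trans b3); rewrite -[leRHS]mulrA ler_pM2l//.
  have e1 : w * s * (1 + `|ln s|) <= 4 * (r / L) * (2 * ln L).
    case/andP: sw1 => sw0 sw1; apply: ler_pM => //.
    by clear -lns lnL1; lra.
  have e2 : 4 * (r / L) * (2 * ln L) = 8 * E * L by rewrite /E; field; rewrite gt_eqF.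
  have e3 : 2 * L <= 96 * E * L by rewrite ler_pM2r//; clear -LE L8; lra.
  rewrite e2 in e1; have -> : 104 * E * L = 8 * E * L + 96 * E * L by ring.
  by move: mw e1 e3; clear -L8; move: (m%:R / w) (w * s * _) (8 * E * L) (96 * E * L) => a b c d *; lra.
have b4 : `|\sum_(m.+1 <= k < n.+1) hit_prob n k - 2 / L * r| <= C4 * E.
  rewrite hit_prob_tail//.
  apply: le_trans (h4 (n %/ m.+1)%N L8 _) _; last by rewrite ler_pM2l.
  have /andP[y1 y2] := @divn_floor R n m.+1 isT.
  have m1p : 0 < m.+1%:R :> R by rewrite ltr0n.
  have z1 : n%:R / m.+1%:R <= r.
    by rewrite ler_pdivrMr// -rr expr2 ler_pM2l// ltW.
  have z2 : r - 1 <= n%:R / m.+1%:R.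
    rewrite ler_pdivlMr// -rr -natr1; clear -rm1 rp; case/andP: rm1 => a b.
    by move: (m%:R) a b => x a b; nra.
  move: z1 z2 y1 y2; move: (n%:R / m.+1%:R) (n %/ m.+1)%:R => z y; clear => *.
  by apply/andP; split; lra.
have -> : expected_hits n - mean_main L r =
  (S - (A + ((1 + ln (2 / L)) * B - D) / L))
  + (A - (w * Num.sqrt pi - w ^+ 2 / m%:R)) - (w ^+ 2 / m%:R - 2 / L * r)
  + (1 + ln (2 / L)) * (B - w * (Num.sqrt pi / 2)) / L
  - (D + w * (Num.sqrt pi / 2 * (euler_gamma R + 2 * ln 2))) / L
  + (\sum_(m.+1 <= k < n.+1) hit_prob n k - 2 / L * r).
  have -> : expected_hits n = S + \sum_(m.+1 <= k < n.+1) hit_prob n k.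
    by rewrite /expected_hits (@big_cat_nat _ _ _ m.+1).
  rewrite /mean_main -/q ln_div ?posrE// /w.
  by field; rewrite !gt_eqF.
apply: (le_trans (ler_norm_sum6 b0 b1 b5 b2 b3 b4)).
by rewrite le_eqVlt; apply/orP; left; apply/eqP; ring.
Qed.

End ExpectedHits.

(** * Independent events *)

Section IndependentFamilies.
Context {R : realType} {d : measure_display} {T : measurableType d}.
Context (P : probability T R).
Implicit Types (E : nat -> set T) (p : nat -> R) (s t : seq nat).

(** Independence together with the probabilities, over duplicate-free
    sequences of indices so that products can be treated by induction. *)
Definition independent_family E p :=
  (forall i, measurable (E i)) /\
  forall s, uniq s -> P (\big[setI/setT]_(i <- s) E i) = (\prod_(i <- s) p i)%:E.

Lemma measurable_bigsetI E s : (forall i, measurable (E i)) ->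
  measurable (\big[setI/setT]_(i <- s) E i).
Proof. by move=> mE; exact: bigsetI_measurable. Qed.

Lemma independent_familyC E p : independent_family E p ->
  independent_family (fun i => ~` E i) (fun i => 1 - p i).
Proof.
move=> [mE hE]; split=> [i|s us]; first exact: measurableC.
have mEC i : measurable (~` E i) by exact: measurableC.
(* indices move one at a time from the complemented part t to the plain part s0 *)
suff H t : forall s0, uniq (s0 ++ t) ->
    P (\big[setI/setT]_(i <- s0) E i `&` \big[setI/setT]_(i <- t) ~` E i) =
    (\prod_(i <- s0) p i * \prod_(i <- t) (1 - p i))%:E.
  by have := H s [::] us; rewrite !big_nil setTI mul1r.
elim: t => [|x t IH] s0; first by rewrite cats0 => u; rewrite !big_nil setIT mulr1 hE.
rewrite -cat_rcons cat_uniq rcons_uniq => u.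
have u1 : uniq (s0 ++ t).
  case/and3P: u => /andP[_ us0] h ut; rewrite cat_uniq us0 ut andbT /=.
  by apply: contra h => /hasP[y yt ys]; apply/hasP; exists y; rewrite // mem_rcons inE ys orbT.
have u2 : uniq ((x :: s0) ++ t).
  case/and3P: u => /andP[xs us0] h ut; rewrite cat_uniq ut /= xs us0 /= andbT.
  by apply: contra h => /hasP[y yt ys]; apply/hasP; exists y; rewrite // mem_rcons.
rewrite !big_cons.
set A := \big[setI/setT]_(i <- s0) E i; set B := \big[setI/setT]_(i <- t) ~` E i.
have mAB : measurable (A `&` B) by apply: measurableI; exact: measurable_bigsetI.
have -> : A `&` (~` E x `&` B) = (A `&` B) `\` E x.
  by rewrite setDE -setIA [B `&` _]setIC.
rewrite measureD//; last by rewrite -ge0_fin_numE// fin_num_measure.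
have -> : A `&` B `&` E x = \big[setI/setT]_(i <- x :: s0) E i `&` B.
  by rewrite big_cons setIC setIA.
transitivity ((\prod_(i <- s0) p i * \prod_(i <- t) (1 - p i))%:E -
    (\prod_(i <- x :: s0) p i * \prod_(i <- t) (1 - p i))%:E)%E.
  by congr (_ - _)%E; [exact: (IH s0 u1)|exact: (IH (x :: s0) u2)].
by rewrite big_cons -EFinB; congr EFin; ring.
Qed.

(** An intersection of blocks is the intersection over the concatenation of
    the blocks, which is duplicate-free since they are disjoint. *)
Lemma independent_blocks E p (I : nat -> seq nat) :
  independent_family E p -> (forall k, uniq (I k)) ->
  (forall k k' l, l \in I k -> l \in I k' -> k = k') ->
  independent_family (fun k => \big[setI/setT]_(l <- I k) E l)
    (fun k => \prod_(l <- I k) p l).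
Proof.
move=> [mE hE] uI dI; split=> [k|s us]; first exact: measurable_bigsetI.
have -> : \big[setI/setT]_(k <- s) \big[setI/setT]_(l <- I k) E l =
  \big[setI/setT]_(l <- flatten (map I s)) E l by rewrite big_flatten big_map.
have -> : \prod_(k <- s) \prod_(l <- I k) p l = \prod_(l <- flatten (map I s)) p l.
  by rewrite big_flatten big_map.
apply: hE; elim: s us => //= k s IH /andP[ks us].
rewrite cat_uniq uI IH// andbT /=.
apply/hasPn => l /flattenP[J /mapP[k' k's ->] lk'].
apply/negP => lk; move: ks; rewrite (dI _ _ _ lk lk').
by rewrite k's.
Qed.

(** The expectation of a product of functions of independent indicators,
    nonnegative so that the integral is additive without integrability
    conditions. *)
Lemma integral_prod_indic E p s (a b : R) : independent_family E p -> uniq s ->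
  0 <= a -> 0 <= b ->
  (\int[P]_w (\prod_(k <- s) (a + b * \1_(E k) w))%:E = (\prod_(k <- s) (a + b * p k))%:E)%E.
Proof.
move=> [mE hE] us a0 b0.
pose f t w := \prod_(k <- t) (a + b * \1_(E k) w) : R.
have f0 t w : 0 <= f t w.
  by apply: prodr_ge0 => k _; rewrite addr_ge0// mulr_ge0// indicE ler0n.
have mi (A : set T) : measurable A -> measurable_fun setT (\1_A : T -> R).
  by move=> mA; exact: measurable_indic.
have mf t : measurable_fun setT (f t).
  apply: measurable_prod => k _; apply: measurable_funD => //.
  by apply: measurable_funM => //; exact: mi.
(* factors of t are expanded one at a time, and the indices of the indicators
   that are picked move to s0 *)
suff H t : forall s0, uniq (s0 ++ t) ->
    (\int[P]_w (\1_(\big[setI/setT]_(i <- s0) E i) w * f t w)%:E =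
     (\prod_(i <- s0) p i * \prod_(k <- t) (a + b * p k))%:E)%E.
  have := H s [::] us; rewrite !big_nil mul1r => <-.
  by apply: eq_integral => w _; rewrite indicT mul1r.
elim: t => [|x t IH] s0.
  rewrite cats0 => u; rewrite big_nil mulr1.
  transitivity (\int[P]_w (\1_(\big[setI/setT]_(i <- s0) E i) w)%:E)%E.
    by apply: eq_integral => w _; rewrite /f big_nil mulr1.
  rewrite integral_indic//; last exact: measurable_bigsetI.
  by rewrite setIT; exact: hE.
rewrite -cat_rcons cat_uniq rcons_uniq => u.
have u1 : uniq (s0 ++ t).
  case/and3P: u => /andP[_ us0] h ut; rewrite cat_uniq us0 ut andbT /=.
  by apply: contra h => /hasP[y yt ys]; apply/hasP; exists y; rewrite // mem_rcons inE ys orbT.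
have u2 : uniq ((x :: s0) ++ t).
  case/and3P: u => /andP[xs us0] h ut; rewrite cat_uniq ut /= xs us0 /= andbT.
  by apply: contra h => /hasP[y yt ys]; apply/hasP; exists y; rewrite // mem_rcons.
set A := \big[setI/setT]_(i <- s0) E i.
have mA : measurable A by exact: measurable_bigsetI.
pose g (B : set T) w := (\1_B w * f t w : R)%:E.
have g0 B w : (0 <= g B w)%E by rewrite lee_fin mulr_ge0// indicE ler0n.
have mg B : measurable B -> measurable_fun setT (g B).
  by move=> mB; apply/measurable_EFinP; apply: measurable_funM => //; exact: mi.
have E1 w : (\1_A w * f (x :: t) w)%:E = (a%:E * g A w + b%:E * g (E x `&` A) w)%E.
  rewrite /g -!EFinM -EFinD; congr EFin.
  by rewrite /f big_cons indicI /=; ring.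
under eq_integral do rewrite E1.
have mEA : measurable (E x `&` A) by exact: measurableI.
rewrite ge0_integralD//; last 4 first.
- by move=> w _; rewrite mule_ge0.
- by apply: measurable_funeM; exact: mg.
- by move=> w _; rewrite mule_ge0.
- by apply: measurable_funeM; exact: mg.
rewrite !ge0_integralZl_EFin//; [|exact: mg|exact: mg].
have -> : E x `&` A = \big[setI/setT]_(i <- x :: s0) E i by rewrite big_cons.
rewrite (IH s0 u1) (IH (x :: s0) u2) -!EFinM -EFinD; congr EFin.
by rewrite !big_cons; ring.
Qed.

Lemma markov_le (f : T -> R) (c v : R) (A : set T) : measurable_fun setT f ->
  (forall w, 0 <= f w) -> measurable A -> 0 < c -> (forall w, A w -> c <= f w) ->
  (\int[P]_w (f w)%:E = v%:E)%E -> (P A <= (v / c)%:E)%E.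
Proof.
move=> mf f0 mA c0 cf Iv.
rewrite EFinM lee_pdivlMr// -Iv muleC -[X in P X]setIT -integral_indic//.
rewrite -ge0_integralZl_EFin//; last 2 first.
- by apply/measurable_EFinP; exact: measurable_indic.
- exact: ltW.
apply: ge0_le_integral => //.
- by move=> w _; rewrite -EFinM lee_fin; apply: mulr_ge0; [exact: ltW|rewrite indicE].
- by apply: measurable_funeM; apply/measurable_EFinP; exact: measurable_indic.
- exact/measurable_EFinP.
- move=> w _; rewrite -EFinM lee_fin indicE.
  by case: (boolP (w \in A)) => [/set_mem/cf|_]; rewrite ?mulr1 ?mulr0.
Qed.

End IndependentFamilies.

(** * Chernoff bounds *)

Section Chernoff.
Context {R : realType} {d : measure_display} {T : measurableType d}.
Context (P : probability T R).
Implicit Types (E : nat -> set T) (p : nat -> R) (s : seq nat) (x t : R).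

Definition count_events E s (w : T) : R := \sum_(k <- s) \1_(E k) w.

Lemma measurable_count E s : (forall i, measurable (E i)) ->
  measurable_fun setT (count_events E s).
Proof.
move=> mE; apply: measurable_sum => k.
by apply: measurable_indic; exact: mE.
Qed.

Lemma expR_mul_count x E s w :
  expR (x * count_events E s w) = \prod_(k <- s) (1 + (expR x - 1) * \1_(E k) w).
Proof.
rewrite /count_events mulr_sumr expR_sum; apply: eq_bigr => k _.
rewrite indicE; case: (w \in E k) => /=; first by rewrite !mulr1 addrC subrK.
by rewrite !mulr0 expR0 addr0.
Qed.

Lemma independent_family_prob01 E p k : independent_family P E p -> 0 <= p k <= 1.
Proof.
move=> [mE hE]; have := hE [:: k] isT; rewrite !big_seq1 => h.
by rewrite -!lee_fin -h measure_ge0 probability_le1.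
Qed.

Lemma prod_1D_le_expR s (u : nat -> R) : (forall k, 0 <= 1 + u k) ->
  \prod_(k <- s) (1 + u k) <= expR (\sum_(k <- s) u k).
Proof.
move=> u0; rewrite expR_sum; apply: ler_prod => k _.
by rewrite u0 expR_ge1Dx.
Qed.

Lemma expR_le_quadratic x : - (1 / 2) <= x <= 1 / 2 -> expR x <= 1 + x + 2 * x ^+ 2.
Proof.
move=> /andP[x0 x1].
have h1 := expR_ge1Dx (- x); have h2 := expRxMexpNx_1 x.
have e0 := expR_gt0 x.
have h3 : expR x * (1 - x) <= 1 by rewrite -[leRHS]h2 ler_pM2l.
have h4 : 0 < 1 - x by lra.
rewrite -(ler_pM2r h4); apply: (le_trans h3).
by have := sqr_ge0 x; rewrite !expr2; nra.
Qed.

(** Exponential Markov inequality, with the moment bound 1 + p (e^x - 1) <=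
    exp (p (x + 2 x^2)) for |x| <= 1/2. *)
Lemma chernoff_upper E p s x t : independent_family P E p -> uniq s ->
  0 <= x <= 1 / 2 ->
  (P [set w | (\sum_(k <- s) p k + t <= count_events E s w)%R]
   <= (expR (2 * (\sum_(k <- s) p k) * x ^+ 2 - x * t))%:E)%E.
Proof.
move=> hE us /andP[x0 x1]; set mu := \sum_(k <- s) p k.
have mS := measurable_count s hE.1.
have ex0 : 0 <= expR x - 1 by have := expR_ge1Dx x; lra.
have mu0 : 0 <= mu.
  by apply: sumr_ge0 => k _; have /andP[] := independent_family_prob01 k hE.
have := @markov_le _ _ _ P (fun w => expR (x * count_events E s w)) (expR (x * (mu + t)))
  (\prod_(k <- s) (1 + (expR x - 1) * p k)) [set w | mu + t <= count_events E s w].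
move=> /(_ _ _ _ _ _ _) h.
apply: (le_trans (h _ _ _ _ _ _)).
- by apply: measurableT_comp => //; exact: measurable_funM.
- by move=> w; exact: expR_ge0.
- rewrite -[X in measurable X]setTI.
  have := mS measurableT `[mu + t, +oo[%classic (measurable_itv _).
  by congr (measurable (_ `&` _)); apply/seteqP; split => w /=; rewrite in_itv/= andbT.
- exact: expR_gt0.
- by move=> w /= hw; rewrite ler_expR ler_wpM2l.
- under eq_integral do rewrite expR_mul_count.
  exact: (integral_prod_indic hE us ler01 ex0).
- rewrite lee_fin ler_pdivrMr ?expR_gt0// -expRD.
  apply: (@le_trans _ _ (expR (\sum_(k <- s) (expR x - 1) * p k))).
    apply: prod_1D_le_expR => k; rewrite addr_ge0// mulr_ge0//.
    by have /andP[] := independent_family_prob01 k hE.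
  rewrite ler_expR -mulr_sumr -/mu.
  have : expR x - 1 <= x + 2 * x ^+ 2.
    have := @expR_le_quadratic x; have -> : - (1 / 2) <= x <= 1 / 2 by apply/andP; split; lra.
    by move=> /(_ isT); lra.
  by move=> /(ler_wpM2r mu0); lra.
Qed.

(** Same argument with e^{-x S}. As 1 + (e^{-x} - 1) 1_E has a negative
    coefficient, it is written e^{-x} + (1 - e^{-x}) 1_{not E}, and
    [integral_prod_indic] is applied to the complements. *)
Lemma chernoff_lower E p s x t : independent_family P E p -> uniq s ->
  0 <= x <= 1 / 2 ->
  (P [set w | (count_events E s w <= \sum_(k <- s) p k - t)%R]
   <= (expR (2 * (\sum_(k <- s) p k) * x ^+ 2 - x * t))%:E)%E.
Proof.
move=> hE us /andP[x0 x1]; set mu := \sum_(k <- s) p k.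
have mS := measurable_count s hE.1.
have ex0 : 0 <= 1 - expR (- x) by have := expR_le1 (- x); rewrite oppr_le0 x0; lra.
have mu0 : 0 <= mu.
  by apply: sumr_ge0 => k _; have /andP[] := independent_family_prob01 k hE.
have := @markov_le _ _ _ P (fun w => expR (- x * count_events E s w)) (expR (- x * (mu - t)))
  (\prod_(k <- s) (expR (- x) + (1 - expR (- x)) * (1 - p k))) [set w | count_events E s w <= mu - t].
move=> /(_ _ _ _ _ _ _) h.
apply: (le_trans (h _ _ _ _ _ _)).
- by apply: measurableT_comp => //; exact: measurable_funM.
- by move=> w; exact: expR_ge0.
- rewrite -[X in measurable X]setTI.
  have := mS measurableT `]-oo, mu - t]%classic (measurable_itv _).
  by congr (measurable (_ `&` _)); apply/seteqP; split => w /=; rewrite in_itv/=.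
- exact: expR_gt0.
- by move=> w /= hw; rewrite ler_expR !mulNr lerN2 ler_wpM2l.
- rewrite -(integral_prod_indic (independent_familyC hE) us (expR_ge0 _) ex0).
  apply: eq_integral => w _; rewrite expR_mul_count; congr EFin; apply: eq_bigr => k _.
  by rewrite !indicE in_setC; case: (w \in E k) => /=; ring.
- rewrite lee_fin ler_pdivrMr ?expR_gt0// -expRD.
  have -> : \prod_(k <- s) (expR (- x) + (1 - expR (- x)) * (1 - p k)) =
     \prod_(k <- s) (1 + (expR (- x) - 1) * p k) by apply: eq_bigr => k _; ring.
  apply: (@le_trans _ _ (expR (\sum_(k <- s) (expR (- x) - 1) * p k))).
    apply: prod_1D_le_expR => k.
    have /andP[p0 p1] := independent_family_prob01 k hE.
    by have := expR_gt0 (- x); nra.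
  rewrite ler_expR -mulr_sumr -/mu.
  have : expR (- x) - 1 <= - x + 2 * x ^+ 2.
    have := @expR_le_quadratic (- x); have -> : - (1 / 2) <= - x <= 1 / 2 by apply/andP; split; lra.
    by move=> /(_ isT); rewrite sqrrN; lra.
  by move=> /(ler_wpM2r mu0); lra.
Qed.

End Chernoff.

(** * Hits in the Cramer model *)

Section CramerModel.
Context {R : realType} {d : measure_display} {T : measurableType d}.
Context (P : probability T R) (C : T -> set nat).
Context (HC : cramer_model P C).
Implicit Types (n k l : nat).

(** Integers below 3 are never members: their events are empty and of
    probability 0, so independence extends to all indices. *)
Lemma member_independent :
  independent_family P (fun l => [set w | C w l]) (@member_prob R).
Proof.
have [C3 CP [mC iC]] := HC.
have E0 l : (l < 3)%N -> [set w | C w l] = set0.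
  by move=> l3; apply/seteqP; split => // w /= /C3; rewrite leqNgt l3.
split=> [l|s us].
  by have [l3|l3] := ltnP l 3; [rewrite E0|exact: mC].
have [/allP s3|] := boolP (all (leq 3) s); last first.
  move=> /allPn[l ls]; rewrite -ltnNge => l3.
  rewrite (bigD1_seq l)//= E0// set0I measure0 (bigD1_seq l)//=.
  by rewrite /member_prob leqNgt l3 /= mul0r.
have := iC [fset l in s]%fset; rewrite bigcap_fset.
have pm : perm_eq [fset l in s]%fset s.
  apply: uniq_perm => //.
  by move=> l; rewrite inE.
rewrite (perm_big _ pm) (perm_big _ pm)/= => ->.
  rewrite -prodEFin; apply: eq_big_seq => l ls.
  by rewrite CP ?s3// /member_prob s3.
by move=> l /=; rewrite inE => /s3.
Qed.

Definition block n k : seq nat := [seq l.+1 | l <- index_iota (n %/ k.+1) (n %/ k)].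

Lemma mem_block n k l : (l \in block n k) = (n %/ k.+1 < l <= n %/ k)%N.
Proof.
case: l => [|l]; last by rewrite mem_map ?mem_index_iota//; exact: succn_inj.
by apply/negbTE/negP => /mapP[].
Qed.

(** The blocks are disjoint because an integer l determines the index k =
    floor (n / l) of its block. *)
Lemma mem_block_divn n k l : l \in block n k -> k = (n %/ l)%N.
Proof.
rewrite mem_block => /andP[h1 h2].
have l0 : (0 < l)%N by case: l h1 {h2}.
have k0 : (0 < k)%N by case: k h2 {h1} => //; rewrite divn0 leqNgt l0.
apply/eqP; rewrite eqn_leq leq_divRL// mulnC -leq_divRL// h2 /=.
by rewrite -ltnS ltn_divLR// mulnC -ltn_divLR.
Qed.

(** The hit event of a block as the complement of missing each of its
    integers, the form to which independence of blocks applies. *)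
Definition hit n k : set T :=
  ~` (\big[setI/setT]_(l <- block n k) ~` [set w | C w l]).

Lemma hit_independent n : independent_family P (hit n) (@hit_prob R n).
Proof.
have h1 := independent_familyC member_independent.
have h2 := @independent_blocks _ _ _ P _ _ (block n) h1.
have := independent_familyC (h2 _ _).
rewrite /hit_prob /block.
under [X in independent_family _ _ X]eq_fun do rewrite big_map.
apply.
- by move=> k; rewrite map_inj_uniq ?iota_uniq//; exact: succn_inj.
- by move=> k k' l /mem_block_divn-> /mem_block_divn->.
Qed.

Lemma hit_eventE n k : (0 < k)%N -> hit_event R C n k = hit n k.
Proof.
move=> k0; rewrite /hit -bigcap_seq setC_bigcap; apply/seteqP; split => w /=.
- move=> [l [+ Cl]]; rewrite /Ik /= in_itv/= => /andP[h1 h2].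
  exists l; last by rewrite setCK.
  rewrite /= mem_block ltn_divLR// leq_divRL//.
  rewrite ltr_pdivrMr ?ltr0n// -natrM ltr_nat in h1.
  by rewrite ler_pdivlMr ?ltr0n// -natrM ler_nat in h2; rewrite h1.
- move=> [l /= + /contrapT Cl]; rewrite mem_block ltn_divLR// leq_divRL// => /andP[h1 h2].
  exists l; split => //; rewrite /Ik /= in_itv/=.
  by rewrite ltr_pdivrMr ?ltr0n// -natrM ltr_nat h1 ler_pdivlMr ?ltr0n// -natrM ler_nat.
Qed.

Lemma hit_large n k : (n < k)%N -> hit n k = set0.
Proof.
move=> nk; rewrite /hit /block (divn_small nk) big_nil; last exact: setCT.
Qed.

Lemma h_factorialE n w :
  h_factorial R C n w = (count_events (R := R) (hit n) (index_iota 1 n.+1) w)%:E.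
Proof.
rewrite /h_factorial (nneseries_split 1 n); last by move=> k _; rewrite lee_fin indicE.
rewrite [X in (_ + X)%E]eseries0 ?adde0; last first.
  move=> k; rewrite add1n => nk _; rewrite hit_eventE ?hit_large ?indic0//.
  by apply: leq_ltn_trans nk.
rewrite add1n sumEFin; congr EFin; apply: eq_big_nat => k /andP[k0 _].
by rewrite hit_eventE.
Qed.

End CramerModel.

(** * Concentration around the mean *)

Section Deviation.
Context {R : realType} {d : measure_display} {T : measurableType d}.
Context (P : probability T R) (C : T -> set nat).
Context (HC : cramer_model P C).
Implicit Types (n k l : nat).

(** The blocks k <= m = floor (sqrt n) contribute at most 1 each, the later
    ones at most the number of integers up to n / (m + 1) in total. *)
Lemma expected_hits_le n : 8 <= ln (n%:R : R) ->
  0 <= (expected_hits n : R) <= 2 * Num.sqrt (n%:R : R).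
Proof.
move=> L8; have hp k := independent_family_prob01 k (hit_independent HC n).
have mpr l := independent_family_prob01 l (member_independent HC).
have n0 : (0 < n)%N by exact: nat_of_ln_gt0 (lt_le_trans _ L8).
have np : 0 < n%:R :> R by rewrite ltr0n.
set r : R := Num.sqrt n%:R.
have rp : 0 < r by rewrite sqrtr_gt0.
have rr : r ^+ 2 = n%:R by rewrite sqr_sqrtr// ltW.
pose m := Num.truncn r.
have /andP[mr rm] : m%:R <= r < m.+1%:R by apply: truncn_itv; exact: ltW.
have r1 : 1 <= r.
  rewrite -[leLHS](sqrtr1 R) /r ler_sqrt// ler1n//.
have mn : (m <= n)%N.
  by rewrite -(@ler_nat R) -rr; apply: (le_trans mr); rewrite expr2 ler_peMl// ltW.
apply/andP; split; first by apply: sumr_ge0 => k _; have /andP[] := hp k.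
rewrite /expected_hits (@big_cat_nat _ _ _ m.+1)//= hit_prob_tail//.
have h1 : \sum_(1 <= k < m.+1) hit_prob n k <= m%:R :> R.
  rewrite -[leRHS](_ : \sum_(1 <= k < m.+1) 1 = _); last by rewrite sumr_const_nat subn1.
  by apply: ler_sum => k _; have /andP[] := hp k.
have h2 : \sum_(0 <= l < n %/ m.+1) member_prob l.+1 <= (n %/ m.+1)%:R :> R.
  rewrite -[leRHS](_ : \sum_(0 <= l < n %/ m.+1) 1 = _); last by rewrite sumr_const_nat subn0.
  by apply: ler_sum => l _; have /andP[] := mpr l.+1.
have h3 : (n %/ m.+1)%:R <= r.
  have /andP[_ y2] := @divn_floor R n m.+1 isT; apply: (le_trans y2).
  by rewrite ler_pdivrMr ?ltr0n// -rr expr2 ler_pM2l// ltW.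
apply: le_trans (lerD (le_trans h1 mr) (le_trans h2 h3)) _; lra.
Qed.

(** Of order L n^{1/4}: far below the error term of the mean, and large enough
    for summable probabilities. *)
Definition deviation_radius n : R := 2 * ln n%:R * Num.sqrt (Num.sqrt n%:R).

Definition deviation n : set T := if 8 <= ln (n%:R : R) then
  [set w | (expected_hits n + deviation_radius n <= count_events (R := R) (hit C n) (index_iota 1 n.+1) w)%R] `|`
  [set w | (count_events (R := R) (hit C n) (index_iota 1 n.+1) w <= expected_hits n - deviation_radius n)%R]
  else set0.

Lemma measurable_hit n k : measurable (hit C n k).
Proof. by case: (hit_independent HC n) => mh _; exact: mh. Qed.

Lemma measurable_upper n (a : R) :
  measurable [set w | (a <= count_events (R := R) (hit C n) (index_iota 1 n.+1) w)%R].
Proof.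
have mS := @measurable_count R _ _ (hit C n) (index_iota 1 n.+1) (measurable_hit n).
rewrite -[X in measurable X]setTI.
have := mS measurableT `[a, +oo[%classic (measurable_itv _).
by congr (measurable (_ `&` _)); apply/seteqP; split => w /=; rewrite in_itv/= andbT.
Qed.

Lemma measurable_lower n (a : R) :
  measurable [set w | (count_events (R := R) (hit C n) (index_iota 1 n.+1) w <= a)%R].
Proof.
have mS := @measurable_count R _ _ (hit C n) (index_iota 1 n.+1) (measurable_hit n).
rewrite -[X in measurable X]setTI.
have := mS measurableT `]-oo, a]%classic (measurable_itv _).
by congr (measurable (_ `&` _)); apply/seteqP; split => w /=; rewrite in_itv/=.
Qed.

Lemma measurable_deviation n : measurable (deviation n).
Proof.
rewrite /deviation; case: ifP => // _.
by apply: measurableU; [exact: measurable_upper|exact: measurable_lower].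
Qed.

(** Chernoff bounds with x = n^{-1/4}: the quadratic term is at most 4 since
    the mean is at most 2 sqrt n, and the linear term is 2 L, which yields the
    factor n^{-2}. *)
Lemma deviation_le n : (P (deviation n) <= (2 * expR 4 / n%:R ^+ 2)%:E)%E.
Proof.
rewrite /deviation; case: ifPn => [L8|_]; last first.
  by rewrite measure0 lee_fin divr_ge0 ?mulr_ge0 ?expR_ge0 ?exprn_ge0.
have n0 : (0 < n)%N by exact: nat_of_ln_gt0 (lt_le_trans _ L8).
have np : 0 < n%:R :> R by rewrite ltr0n.
have /andP[mu0 mu2] := expected_hits_le L8.
set L := ln (n%:R : R) in L8 *; set r : R := Num.sqrt n%:R in mu2 *.
have rp : 0 < r by rewrite sqrtr_gt0.
set v : R := Num.sqrt r; have vp : 0 < v by rewrite sqrtr_gt0.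
have vv : v ^+ 2 = r by rewrite sqr_sqrtr// ltW.
have rE : r = expR (L / 2) by rewrite /r -ln_nat_sqrt// lnK ?posrE// sqrtr_gt0.
have v2 : 2 <= v.
  have r5 : 5 <= r by rewrite rE; have := expR_ge1Dx (L / 2); lra.
  by rewrite leNgt; apply/negP => v2; move: vv; rewrite expr2; nra.
(* v = n^{1/4}, and its inverse is the parameter of the Chernoff bounds *)
have x01 : 0 <= v^-1 <= 1 / 2.
  by rewrite invr_ge0 ltW//= -[leRHS]invf_div divr1 lef_pV2 ?posrE.
have b : expR (2 * expected_hits n * v^-1 ^+ 2 - v^-1 * deviation_radius n) <= expR 4 / n%:R ^+ 2.
  have -> : v^-1 * deviation_radius n = 2 * L.
    by rewrite /deviation_radius -/L -/r -/v; field; rewrite gt_eqF.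
  have -> : expR 4 / n%:R ^+ 2 = expR (4 - 2 * L).
    by rewrite expRB; congr (_ / _); rewrite expRM_natl lnK ?posrE.
  rewrite ler_expR lerB// exprVn vv ler_pdivrMr//; lra.
have hi := hit_independent HC n.
have ui : uniq (index_iota 1 n.+1) by exact: iota_uniq.
have := chernoff_upper (deviation_radius n) hi ui x01.
have := chernoff_lower (deviation_radius n) hi ui x01.
rewrite -/(expected_hits n) => h1 h2.
apply: le_trans (measureU2 _ _ _) _.
- exact: measurable_upper.
- exact: measurable_lower.
have -> : 2 * expR 4 / n%:R ^+ 2 = expR 4 / n%:R ^+ 2 + expR 4 / n%:R ^+ 2 :> R by ring.
by rewrite EFinD; apply: leeD; [apply: (le_trans h2)|apply: (le_trans h1)]; rewrite lee_fin.
Qed.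

Lemma deviation_summable : (\sum_(n <oo) P (deviation n) < +oo)%E.
Proof.
have K0 := expR_gt0 (4 : R); set K := expR 4 in K0.
apply: (@le_lt_trans _ _ (4 * K)%:E); last exact: ltry.
apply: lime_le; first by apply: is_cvg_nneseries => n _ _; exact: measure_ge0.
apply: nearW => -[|N]; first by rewrite big_geq// lee_fin; lra.
(* telescoping majorant: 2 / n^2 <= 4 / (n (n + 1)) *)
apply: (@le_trans _ _ (4 * K * (1 - N.+1%:R^-1))%:E); last first.
  have i0 : 0 <= (N.+1%:R : R)^-1 by rewrite invr_ge0.
  rewrite lee_fin; move: i0; move: (N.+1%:R^-1 : R) => a a0; clear -a0 K0; nra.
elim: N => [|N IH].
  rewrite big_nat1 invr1 subrr mulr0 /deviation ln0// ifN ?measure0//.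
  by rewrite -ltNge.
rewrite big_nat_recr//=; apply: le_trans (leeD IH (deviation_le N.+1)) _.
rewrite -EFinD lee_fin -/K.
have N0 : 0 < N.+1%:R :> R by rewrite ltr0n.
have N1 : 1 <= N.+1%:R :> R by rewrite ler1n.
rewrite -[N.+2%:R]natr1; move: (N.+1%:R : R) N0 N1 => a a0 a1.
have -> : 4 * K * (1 - (a + 1)^-1) = 4 * K * (1 - a^-1) + 4 * K / (a * (a + 1)).
  by field; rewrite !gt_eqF//; lra.
rewrite lerD2l.
have -> : 2 * K / a ^+ 2 = 2 * K * (a ^+ 2)^-1 by [].
have -> : 4 * K / (a * (a + 1)) = 2 * K * ((a * (a + 1)) / 2)^-1.
  by field; rewrite !gt_eqF//; lra.
rewrite ler_pM2l ?mulr_gt0// lef_pV2 ?posrE; [|by rewrite exprn_gt0|by apply: divr_gt0 => //; apply: mulr_gt0 => //; lra].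
by rewrite expr2; nra.
Qed.

End Deviation.

(** * Relative errors *)

Section Normalization.
Context {R : realType}.
Implicit Types (n N : nat) (L : R).

Lemma expR1_lt3 : expR 1 < 3 :> R.
Proof.
(* e^{-1/6} >= 5/6, hence e <= (6/5)^6 = 2.985984 *)
have h : 5 / 6 <= expR (- (1 / 6)) :> R.
  by have := expR_ge1Dx (- (1 / 6) : R); lra.
rewrite expRN in h.
have h2 : expR (1 / 6) <= 6 / 5 :> R.
  by rewrite -[leLHS]invrK -[leRHS]invf_div lef_pV2 ?posrE// invr_gt0 expR_gt0.
have -> : (1 : R) = 6%:R * (1 / 6) by field.
rewrite expRM_natl.
apply: (@le_lt_trans _ _ ((6 / 5) ^+ 6)); last by rewrite !exprS expr0; lra.
by rewrite lerXn2r ?nnegrE ?expR_ge0//; lra.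
Qed.

Lemma ln_nat_gt0 n : (2 <= n)%N -> 0 < ln (n%:R : R).
Proof. by move=> n2; rewrite ln_gt0// ltr1n. Qed.

(** ln (ln n) = 0 would mean n = e, but e lies strictly between 2 and 3. Hence
    the error term never vanishes for n >= 2. *)
Lemma ln_ln_nat_neq0 n : (2 <= n)%N -> ln (ln (n%:R : R)) != 0.
Proof.
move=> n2; have l0 := ln_nat_gt0 n2.
rewrite ln_eq0//; apply/eqP => l1.
have e : n%:R = expR 1 :> R by have := @lnK R n%:R; rewrite posrE ltr0n (ltnW n2) l1 => ->.
have : (n < 3)%N by rewrite -(@ltr_nat R) e expR1_lt3.
have : (2 < n)%N.
  by rewrite -(@ltr_nat R) e; have := @expR_gt1Dx R 1 (oner_neq0 _); lra.
by move=> h1 h2; have := leq_trans h2 h1; rewrite ltnn.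
Qed.

(** Finitely many indices are absorbed in the constant because the bounds are
    positive there. *)
Lemma eventually_bound_all (e b : nat -> R) (C : R) (n0 N : nat) :
    (forall n, (n0 <= n)%N -> 0 < b n) ->
    (forall n, (N <= n)%N -> `|e n| <= C * b n) ->
  exists K, forall n, (n0 <= n)%N -> `|e n| <= K * b n.
Proof.
move=> bp h; exists (`|C| + \sum_(0 <= i < N) `|e i / b i|) => n nn0.
have bn := bp _ nn0.
have s0 : 0 <= \sum_(0 <= i < N) `|e i / b i| by exact: sumr_ge0.
case: (leqP N n) => nN.
  apply: (le_trans (h _ nN)); rewrite ler_pM2r//.
  by have := ler_norm C; lra.
rewrite -ler_pdivrMr// -[b n in leLHS]gtr0_norm// -normf_div.
rewrite (bigD1_seq n) ?iota_uniq ?mem_index_iota//=.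
have t0 : 0 <= \sum_(0 <= i < N | i != n) `|e i / b i| by exact: sumr_ge0.
by have := normr_ge0 C; lra.
Qed.

Definition leading_term n : R :=
  Num.sqrt (2 * pi) * n%:R `^ (1 / 2) / (ln n%:R) `^ (1 / 2).

Definition bracket n : R :=
  1 - ln (ln n%:R) / (2 * ln n%:R)
    + (1 + euler_gamma R + ln 8) / (2 * ln n%:R).

Lemma leading_term_gt0 n : (2 <= n)%N -> 0 < leading_term n.
Proof.
move=> n2; have l0 := ln_nat_gt0 n2.
rewrite /leading_term divr_gt0 ?mulr_gt0 ?powR_gt0 ?sqrtr_gt0//.
- by rewrite mulr_gt0// pi_gt0.
- by rewrite ltr0n ltnW.
Qed.

Lemma powR_half (x : R) : 0 <= x -> x `^ (1 / 2) = Num.sqrt x.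
Proof. by move=> x0; rewrite div1r powR12_sqrt. Qed.

Lemma powR_three_halves (x : R) : 0 < x -> x `^ (3 / 2) = x * Num.sqrt x.
Proof.
move=> x0; have -> : (3 / 2 : R) = 1 + 1 / 2 by field.
by rewrite powRD ?gt_eqF ?implybT// powRr1 ?ltW// powR_half// ltW.
Qed.

Lemma mean_main_leading_term n : (2 <= n)%N ->
  mean_main (ln n%:R) (Num.sqrt n%:R) = leading_term n * bracket n.
Proof.
move=> n2; have L0 := ln_nat_gt0 n2.
have n0 : 0 < n%:R :> R by rewrite ltr0n; exact: ltnW.
rewrite /mean_main /leading_term /bracket !powR_half ?ltW//.
set L := ln (n%:R : R) in L0 *.
have -> : ln (8 : R) = 3 * ln 2.
  have -> : (8 : R) = 2 ^+ 3 by rewrite !exprS expr0; lra.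
  by rewrite lnXn// -[ln 2 *+ 3]mulr_natl.
rewrite sqrtrM// sqrtrM// sqrtrV ?ltW//.
by field; rewrite !gt_eqF ?sqrtr_gt0.
Qed.

Lemma leading_term_ge n : 8 <= ln (n%:R : R) ->
  Num.sqrt n%:R <= leading_term n * Num.sqrt (ln n%:R).
Proof.
move=> L8; have L0 : 0 < ln (n%:R : R) by lra.
rewrite /leading_term !powR_half//; last exact: ltW.
rewrite divfK; last by rewrite gt_eqF// sqrtr_gt0.
rewrite ler_peMl ?sqrtr_ge0// -[leLHS]sqrtr1 ler_sqrt.
  by have := @pi_ge2 R; lra.
by rewrite mulr_ge0// pi_ge0.
Qed.

Lemma relative_error (C S : R) n : 0 <= C -> 8 <= ln (n%:R : R) ->
    `|S - mean_main (ln n%:R) (Num.sqrt n%:R)|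
      <= C * (Num.sqrt n%:R * ln (ln n%:R) / ln n%:R ^+ 2) ->
  `|S / leading_term n - bracket n|
    <= C * (`|ln (ln n%:R)| / (ln n%:R) `^ (3 / 2)).
Proof.
move=> C0 L8; have l1 := ln_ge1 L8.
have n0 : (0 < n)%N by exact: nat_of_ln_gt0 (lt_le_trans _ L8).
have n2 : (2 <= n)%N.
  by rewrite ltn_neqAle n0 andbT; apply/eqP => n1; move: L8; rewrite -n1 ln1; lra.
have Dp := leading_term_gt0 n2; have := leading_term_ge L8.
rewrite mean_main_leading_term// powR_three_halves ?ln_nat_gt0//.
have L0 := ln_nat_gt0 n2.
move: (leading_term n) (bracket n) Dp; set L := ln (n%:R : R) in L8 l1 L0 *.
move: (Num.sqrt n%:R : R) => r D B Dp rD h.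
have sL : 0 < Num.sqrt L by rewrite sqrtr_gt0.
have -> : S / D - B = (S - D * B) / D by field; rewrite gt_eqF.
rewrite normf_div (gtr0_norm Dp) ler_pdivrMr//; apply: (le_trans h).
rewrite ger0_norm; last lra.
rewrite -[leRHS]mulrA; apply: ler_wpM2l => //.
have -> : ln L / (L * Num.sqrt L) * D = D * Num.sqrt L * (ln L / L ^+ 2).
  have LE : L = Num.sqrt L ^+ 2 by rewrite sqr_sqrtr// ltW.
  move: (ln L) => l; move: (Num.sqrt L) sL LE => q sL ->.
  by field; rewrite gt_eqF.
rewrite -[leLHS]mulrA; apply: ler_wpM2r => //.
by apply: divr_ge0; [lra|apply: exprn_ge0; exact: ltW].
Qed.

(** n^{1/4} = e^{L/4} is at least (L/4)^3 / 6. *)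
Lemma deviation_radius_le n : 8 <= ln (n%:R : R) ->
  2 * ln n%:R * Num.sqrt (Num.sqrt n%:R)
    <= 768 * (Num.sqrt n%:R * ln (ln n%:R) / ln n%:R ^+ 2) :> R.
Proof.
move=> L8; have l1 := ln_ge1 L8.
have n0 : (0 < n)%N by exact: nat_of_ln_gt0 (lt_le_trans _ L8).
have np : 0 < n%:R :> R by rewrite ltr0n.
have rp : 0 < Num.sqrt n%:R :> R by rewrite sqrtr_gt0.
have vp : 0 < Num.sqrt (Num.sqrt n%:R) :> R by rewrite sqrtr_gt0.
have rE : (Num.sqrt n%:R : R) = Num.sqrt (Num.sqrt n%:R) ^+ 2 by rewrite sqr_sqrtr// ltW.
have lnv : ln (Num.sqrt (Num.sqrt n%:R)) = ln n%:R / 4 :> R.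
  have : ln (n%:R : R) = ln (Num.sqrt (Num.sqrt n%:R) ^+ 4).
    by rewrite (exprM _ 2 2) -rE sqr_sqrtr// ltW.
  by rewrite lnXn// -[_ *+ 4]mulr_natl => ->; field.
have L0 : 0 < ln (n%:R : R) by lra.
have vb : ln (n%:R : R) ^+ 3 <= 384 * Num.sqrt (Num.sqrt n%:R).
  have L40 : 0 <= ln (n%:R : R) / 4 by rewrite divr_ge0// ltW.
  have := @expR_ge_pow R _ 3 L40; rewrite -lnv lnK ?posrE// lnv (_ : 3`! = 6)%N// exprMn.
  by clear; move: (ln n%:R ^+ 3) (Num.sqrt _) => z r'; rewrite !exprS !expr0; lra.
rewrite [X in _ <= 768 * (X * _ / _)]rE.
move: (Num.sqrt (Num.sqrt n%:R)) vp vb => v vp vb; move: (ln (n%:R : R)) L0 l1 vb => L L0 l1 vb.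
rewrite mulrA ler_pdivlMr ?exprn_gt0//.
have -> : 2 * L * v * L ^+ 2 = 2 * v * L ^+ 3 by ring.
apply: (@le_trans _ _ (2 * v * (384 * v))); first by rewrite ler_pM2l ?mulr_gt0.
have h : v ^+ 2 * 1 <= v ^+ 2 * ln L by apply: ler_wpM2l => //; exact: exprn_ge0 (ltW vp).
by move: h; rewrite !exprS expr0; lra.
Qed.

End Normalization.

Theorem theorem1p2 (R : realType) (d : measure_display) (T : measurableType d)
    (P : probability T R) (C : T -> set nat) (HC : cramer_model P C) :
  {ae P, forall w, exists K : R, forall n : nat, (2 <= n)%N ->
    exists err : R,
      `|err| <= K * (`|ln (ln n%:R)| / (ln n%:R) `^ (3 / 2)) /\
      h_factorial R C n w =
        (Num.sqrt (2 * pi) * n%:R `^ (1 / 2) / (ln n%:R) `^ (1 / 2) *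
         (1 - ln (ln n%:R) / (2 * ln n%:R)
            + (1 + euler_gamma R + ln 8) / (2 * ln n%:R)
            + err))%:E}.
Proof.
have [A A0 mean] := @mean_asymptotics R.
exists (lim_sup_set (deviation (R := R) C)); split.
- apply: bigcap_measurable => // i _; apply: bigcup_measurable => j _.
  exact: (measurable_deviation HC).
- apply: lim_sup_set_cvg0; first exact: (measurable_deviation HC).
  exact: (deviation_summable HC).
apply: subsetCl => w wF.
(* outside the upper limit of the deviations, only finitely many of them occur *)
have [N devN] : exists N, forall n, (N <= n)%N -> ~ deviation (R := R) C n w.
  apply: contra_notP wF => /forallNP h i _.
  have /existsNP [j /not_implyP [ij /contrapT wj]] := h i.
  by exists j.
pose S n : R := count_events (hit C n) (index_iota 1 n.+1) w.
pose N8 := (Num.truncn (expR 8 : R)).+1.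
have ln8 n : (N8 <= n)%N -> 8 <= ln (n%:R : R).
  move=> Nn; have : expR 8 < N8%:R :> R.
    by have /andP[] := @truncn_itv R _ (expR_ge0 8).
  move=> /lt_le_trans /(_ (_ : N8%:R <= n%:R)); rewrite ler_nat => /(_ Nn) h.
  rewrite -[leLHS]expRK ler_ln ?posrE ?expR_gt0 ?(ltW h)//.
  exact: lt_trans (expR_gt0 _) h.
have bpos n : (2 <= n)%N -> 0 < `|ln (ln n%:R)| / (ln n%:R) `^ (3 / 2) :> R.
  move=> n2; rewrite divr_gt0 ?powR_gt0 ?ln_nat_gt0//.
  by rewrite normr_gt0 ln_ln_nat_neq0.
have late n : (maxn N N8 <= n)%N -> `|S n / leading_term n - bracket n|
    <= (768 + A) * (`|ln (ln n%:R)| / (ln n%:R) `^ (3 / 2)).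
  rewrite geq_max => /andP[Nn N8n].
  have L8 := ln8 _ N8n; apply: (relative_error _ L8).
    by clear -A0; lra.
  have := devN _ Nn; rewrite /deviation L8 => /not_orP[/negP h1 /negP h2].
  rewrite -ltNge in h1; rewrite -ltNge in h2.
  have h : `|S n - expected_hits n| <= deviation_radius n.
    by rewrite ler_norml /S; apply/andP; split; lra.
  have hr := deviation_radius_le L8; rewrite -/(deviation_radius n) in hr.
  rewrite mulrDl -(subrKA (expected_hits n)).
  exact: le_trans (ler_normD _ _) (lerD (le_trans h hr) (mean _ L8)).
have [K HK] := eventually_bound_all bpos late.
exists K => n n2; exists (S n / leading_term n - bracket n); split.
  exact: HK.
rewrite h_factorialE; congr EFin; rewrite -/(S n) -/(leading_term n) -/(bracket n).
by rewrite addrC subrK mulrC divfK// gt_eqF// leading_term_gt0.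
Qed.
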